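(* Let $X=(X_1,\dots,X_n)$ be a vector of independent random variables taking values in a measurable space $\mathcal{X}$. Fix $\delta\in(0,1]$ and let $F=F(X)\in L^{3+\delta}(P)$ be a real-valued measurable function of $X$ that is centered ($E[F]=0$) with $\sigma^2:=\mathrm{Var}(F)\in(0,\infty)$ and $E[F^3]=0$. For any $\alpha,\beta,\gamma\in[0,1]$, put $Z^{(\alpha)}:=\sum_{k=1}^n\mathfrak{D}_kF\,\mathfrak{D}_k^{(\alpha)}F$ and $$Z^{(\alpha,\beta)}:=\sum_{k=1}^n\mathfrak{D}_kF\,\mathfrak{D}^{(\beta)}_kZ^{(\alpha)}-\frac12\sum_{k=1}^n\big(|\mathfrak{D}_kF|^2+E_k|\mathfrak{D}_kF|^2\big)\mathfrak{D}^{(\alpha)}_kF.$$ Then $$\begin{aligned}d_2(F/\sigma,N)\leq{}&\frac{4}{\sigma^{3+\delta}}\sum_{k=1}^nE\left[(|\mathfrak{D}_kF|^{\delta}+E_k|\mathfrak{D}_kF|^{\delta})\,|\mathfrak{D}^{(\gamma)}_kZ^{(\alpha,\beta)}|\right]\\&+\frac{2^{2+\delta}}{\sigma^{3+\delta}}\sum_{k=1}^nE\left[(|\mathfrak{D}_kF|^{1+\delta}+E_k|\mathfrak{D}_kF|^{1+\delta})\,|\mathfrak{D}^{(\beta)}_kZ^{(\alpha)}|\right]\\&+\frac{2^{2+\delta}}{\sigma^{3+\delta}}\sum_{k=1}^nE\left[(|\mathfrak{D}_kF|^{2+\delta}+E_k|\mathfrak{D}_kF|^{2+\delta})\,|\mathfrak{D}^{(\alpha)}_kF|\right],\end{aligned}$$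 and the right-hand side above is in turn bounded by $$\begin{aligned}&\frac{8}{\sigma^{3+\delta}}\Big(\sum_{k=1}^nE|\mathfrak{D}_kF|^{3+\delta}\Big)^{\frac{\delta}{3+\delta}}\Big(\sum_{k=1}^nE|\mathfrak{D}_kZ^{(\alpha,\beta)}|^{\frac{3+\delta}{3}}\Big)^{\frac{3}{3+\delta}}\\&+\frac{2^{3+\delta}}{\sigma^{3+\delta}}\Big(\sum_{k=1}^nE|\mathfrak{D}_kF|^{3+\delta}\Big)^{\frac{1+\delta}{3+\delta}}\Big(\sum_{k=1}^nE|\mathfrak{D}_kZ^{(\alpha)}|^{\frac{3+\delta}{2}}\Big)^{\frac{2}{3+\delta}}+\frac{2^{3+\delta}}{\sigma^{3+\delta}}\sum_{k=1}^nE|\mathfrak{D}_kF|^{3+\delta}.\end{aligned}$$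
   Context: All random variables live on a probability space $(\Omega,\mathfrak{F},P)$; $E|Y|^p$ means $E[|Y|^p]$. $N$ is a standard normal random variable. The $d_2$-distance is $d_2(G,N):=\sup\{|E[h(G)]-E[h(N)]| : h\in\mathcal{C}^2,\ \|h'\|_\infty\le 1,\ \|h''\|_\infty\le 1\}$, where $\mathcal{C}^2$ is the space of twice continuously differentiable $h:\mathbb{R}\to\mathbb{R}$ and $\|\cdot\|_\infty$ is the supremum norm. Let $\mathcal{F}_i:=\sigma(X_k,k\le i)$ and $\mathcal{G}_i:=\sigma(X_k,k\ge i)$ for $1\le i\le n$. For a random variable $U=U(X)\in L^1(P)$ and $1\le i\le n$, $E_i[U]$ denotes the expectation with respect to $X_i$ only (i.e. $X_i$ is integrated out and the other coordinates are kept; equivalently $E_i[U]=E[U\mid X_j,j\ne i]$). The difference operators are $\mathfrak{D}_iU:=U-E_i[U]$ and, for $\alpha\in[0,1]$, $\mathfrak{D}^{(\alpha)}_iU:=\alpha E[\mathfrak{D}_iU\mid\mathcal{F}_i]+(1-\alpha)E[\mathfrak{D}_iU\mid\mathcal{G}_i]$. $E_k|\mathfrak{D}_kF|^{p}$ means $E_k[|\mathfrak{D}_kF|^p]$. *)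

(* Defs.v *)
From HB Require Import structures.
From mathcomp Require Import all_boot all_order all_algebra.
From mathcomp Require Import all_classical all_reals all_analysis measurable_realfun.

Set Implicit Arguments.
Unset Strict Implicit.
Unset Printing Implicit Defensive.

Import Order.TTheory GRing.Theory Num.Theory.
Import numFieldNormedType.Exports.

Local Open Scope classical_set_scope.
Local Open Scope ring_scope.

Section conditional_expectation.
Context {d : measure_display} {Omega : measurableType d} {R : realType}.
Variable P : probability Omega R.

Definition is_condexp (G : set_system Omega) (U V : Omega -> R) : Prop :=
  [/\ forall B : set R, measurable B -> G (V @^-1` B),
      P.-integrable setT (EFin \o V) &
      forall A, G A ->
        (\int[P]_(w in A) (V w)%:E = \int[P]_(w in A) (U w)%:E)%E].

(* A chosen version of E[U | G]; a version exists by [condexpP] when U is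
   integrable, and the default value 0 is only used if there is none. *)
Definition condexp (G : set_system Omega) (U : Omega -> R) : Omega -> R :=
  xget (cst 0) [set V | is_condexp G U V].

Lemma condexpP (G : set_system Omega) (U : Omega -> R) :
  sigma_algebra setT G -> G `<=` measurable ->
  P.-integrable setT (EFin \o U) -> is_condexp G U (condexp G U).
Proof.
move=> sG subG intU; rewrite /condexp.
suff [V isV] : exists V, is_condexp G U V by apply: (xgetI (cst 0) isV).
pose GT := g_sigma_algebraType G.
have mGE : @measurable _ GT = G by exact: measurable_g_measurableTypeE.
have mid : measurable_fun setT (idfun : Omega -> GT).
  by move=> _ A; rewrite mGE => GA; rewrite setTI; exact: subG.
pose idm : {mfun Omega >-> GT} :=
  MeasurableFun.Pack (MeasurableFun.Class (isMeasurableFun.Build _ _ _ _ _ mid)).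
pose PG := distribution P idm.
pose nu0 : {charge set GT -> \bar R} :=
  pushforward (induced_charge intU) idm.
pose nu := nu0 mid.
have nuPG : nu `<< PG.
  apply: dominates_pushforward => //.
  apply/null_content_dominatesP => A mA PA0.
  apply: null_set_integral => //.
  exact: measurable_funTS (measurable_int P intU).
pose V := fine \o Radon_Nikodym nu PG.
have VE : EFin \o V = Radon_Nikodym nu PG.
  by apply/funext => w; rewrite /V /= fineK// Radon_Nikodym_fin_num.
have intV : PG.-integrable setT (EFin \o V).
  by rewrite VE; exact: Radon_Nikodym_integrable.
have mVE := measurable_int PG intV.
have /measurable_EFinP mV := mVE.
have intVP : P.-integrable setT ((EFin \o V) \o idm).
  have mVP : measurable_fun [set: Omega] ((EFin \o V) \o idm).
    exact: measurableT_comp.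
  apply/integrableP; split => //.
  move/integrableP : intV => [_]; rewrite ge0_integral_pushforward//.
  exact: measurableT_comp.
exists V; split.
- by move=> B mB; have := mV measurableT B mB; rewrite setTI mGE.
- exact: intVP.
- move=> A GA; have mA : measurable (A : set GT) by rewrite mGE.
  have := Radon_Nikodym_integral nuPG mA.
  rewrite -VE integral_pushforward//.
  by apply: (integrableS measurableT) => //; exact: subG.
Qed.

End conditional_expectation.

Section independent_coordinates.
Context {d d' : measure_display} {Omega : measurableType d}
  {T : measurableType d'} {R : realType}.
Variables (P : probability Omega R) (n : nat) (X : 'I_n -> {RV P >-> T}).

Definition mutually_independent : Prop :=
  forall (J : {set 'I_n}) (B : 'I_n -> set T), (forall i, measurable (B i)) ->
    (P (\bigcap_(i in [set` J]) (X i @^-1` B i)) =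
     \prod_(i in J) P (X i @^-1` B i))%E.

Definition sigma_of (K : pred 'I_n) : set_system Omega :=
  <<s \bigcup_(k in [set k | K k]) preimage_set_system setT (X k) measurable >>.

Definition past (i : 'I_n) : set_system Omega :=
  sigma_of (fun k => (k <= i)%N).

Definition future (i : 'I_n) : set_system Omega :=
  sigma_of (fun k => (i <= k)%N).

(* For independent coordinates and U = u(X), integrating out X_i alone is
   conditioning on all the other coordinates. *)
Definition Eout (i : 'I_n) (U : Omega -> R) : Omega -> R :=
  condexp P (sigma_of (fun j => j != i)) U.

Definition Ddiff (i : 'I_n) (U : Omega -> R) : Omega -> R :=
  fun w => U w - Eout i U w.

Definition Dalpha (a : R) (i : 'I_n) (U : Omega -> R) : Omega -> R :=
  fun w => a * condexp P (past i) (Ddiff i U) w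
           + (1 - a) * condexp P (future i) (Ddiff i U) w.

Definition Zalpha (a : R) (F : Omega -> R) : Omega -> R :=
  fun w => \sum_(k < n) Ddiff k F w * Dalpha a k F w.

Definition Zalphabeta (a b : R) (F : Omega -> R) : Omega -> R :=
  fun w => (\sum_(k < n) Ddiff k F w * Dalpha b k (Zalpha a F) w)
    - 2^-1 * (\sum_(k < n)
        (`|Ddiff k F w| ^+ 2 + Eout k (fun w => `|Ddiff k F w| ^+ 2) w)
        * Dalpha a k F w).

Definition absD_plus_E (p : R) (k : 'I_n) (F : Omega -> R) : Omega -> R :=
  fun w => `|Ddiff k F w| `^ p + Eout k (fun w => `|Ddiff k F w| `^ p) w.

End independent_coordinates.

Section d2_distance.
Context {R : realType}.

Definition C2 (h : R -> R) : Prop :=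
  [/\ forall x, derivable h x 1, forall x, derivable (derive1 h) x 1 &
      continuous (derive1 (derive1 h))].

Definition supnorm (g : R -> R) : \bar R :=
  ereal_sup (range (fun x => `|g x|%:E)).

(* Only the laws of G and G' matter: they need not share a probability space. *)
Definition d2 {d d' : measure_display}
    {Omega : measurableType d} {Omega' : measurableType d'}
    (P : probability Omega R) (G : Omega -> R)
    (P' : probability Omega' R) (G' : Omega' -> R) : \bar R :=
  ereal_sup [set `| 'E_P[h \o G] - 'E_P'[h \o G'] |%E
            | h in [set h : R -> R | [/\ C2 h, (supnorm (derive1 h) <= 1)%E &
                                         (supnorm (derive1 (derive1 h)) <= 1)%E]]].

End d2_distance.

(* Main.v *)
Require Import Defs.
From HB Require Import structures.
From mathcomp Require Import all_boot all_order all_algebra.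
From mathcomp Require Import all_classical all_reals all_analysis measurable_realfun.
From mathcomp Require Import ring lra.

(** Why the bound holds.

    Stein's equation f'(x) - x f(x) = h(x) - E h(N) turns the difference
    E h(F/s) - E h(N), s = sigma, into s^2 E phi'(F) - E[F phi(F)] for
    phi(x) = f(x/s)/s.  When h' and h'' are bounded by 1, f'' is bounded by 2 and
    has Lipschitz constant 3 ([stein_regularity]); hence
    |f''(x) - f''(y)| <= 4 |x - y|^delta, and phi'' is delta-Hoelder with constant
    4 / s^(3 + delta).  This is the only place where the class of test functions
    enters, and it produces the factor common to the three sums.

    The term E[F phi(F)] is expanded with the covariance identity
    Cov(U, V) = sum_k E[D_k U * D_k^(a) V] ([covariance_Dalpha]).  By
    independence, conditioning on the coordinates with indices in L and then on those
    with indices in K amounts to conditioning on those with indices in both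
    ([condexp_cross]).  Hence E_k commutes with revealing coordinates, V - E V telescopes
    into the martingale increments E[D_k V | F_k], and likewise into the reversed
    increments E[D_k V | G_k]; a convex combination of the two sums is the identity.
    The identity is used three times.
      - For U = phi(F), V = F, Taylor expansion to second order gives
        E[phi'(F) Z^(a)] minus the half-sum with phi'' that enters Z^(a,b).
      - For U = phi'(F), V = Z^(a), where E Z^(a) = Var F = s^2, expansion to first
        order leaves s^2 E phi'(F) + E[phi''(F) Z^(a,b)].
      - For U = phi''(F), V = Z^(a,b), the Hoelder bound on phi'' alone estimates
        Cov(phi''(F), Z^(a,b)).
    What remains is E phi''(F) * E Z^(a,b).  The first two steps with
    phi(x) = x^2/2, whose phi'' has Hoelder constant 0, have no error and show that
    E Z^(a,b) = E F^3 / 2 = 0 ([Ex_Zab]).  The three remainders are exactly the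
    three sums of the first bound ([stein_expansion]).

    The expansions of D_k psi(F) = psi(F) - E_k psi(F) are obtained without an
    independent copy of X_k: for a fixed real x one conditions a Taylor estimate of
    psi(F) around x, then lets x run through the rationals to get a single null
    set, extends to all x by continuity and puts x = F ([conditional_taylor]).

    The second bound is Hoelder's inequality for the pair (sum over k, E)
    together with the conditional Jensen inequality ([sum_absD_Dalpha_le]). *)

Import Order.TTheory GRing.Theory Num.Theory.
Import numFieldNormedType.Exports.
Local Open Scope classical_set_scope.
Local Open Scope ring_scope.

Set Implicit Arguments.
Unset Strict Implicit.
Unset Printing Implicit Defensive.


(** * Real-valued expectations *)

Section expectation_toolbox.
Context {d : measure_display} {Om : measurableType d} {R : realType}.
Variable P : probability Om R.
Implicit Types U V W : Om -> R.

Local Notation Ex U := (Rintegral P setT U).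
Local Notation Intg U := (P.-integrable setT (EFin \o U)).

Lemma Intg_meas U : Intg U -> measurable_fun setT U.
Proof. by move=> /integrableP[/measurable_EFinP]. Qed.

Lemma Intg_le U V : measurable_fun setT U -> (forall w, `|U w| <= `|V w|) ->
  Intg V -> Intg U.
Proof.
move=> mU UV iV; apply: le_integrable iV => //; first exact/measurable_EFinP.
by move=> w _; rewrite /= lee_fin.
Qed.

Lemma IntgD U V : Intg U -> Intg V -> Intg (fun w => U w + V w).
Proof. by move=> iU iV; exact: (integrableD _ iU iV). Qed.

Lemma IntgB U V : Intg U -> Intg V -> Intg (fun w => U w - V w).
Proof. by move=> iU iV; exact: (integrableB _ iU iV). Qed.

Lemma IntgZ k U : Intg U -> Intg (fun w => k * U w).
Proof. by move=> iU; exact: (integrableZl _ k iU). Qed.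

Lemma Intg_cst k : Intg (fun=> k).
Proof. exact: finite_measure_integrable_cst. Qed.

Lemma Intg_norm U : Intg U -> Intg (fun w => `|U w|).
Proof. by move=> iU; exact: (integrable_norm iU). Qed.

Lemma Intg_sum (I : Type) (s : seq I) (Q : pred I) (F : I -> Om -> R) :
  (forall i, Intg (F i)) -> Intg (fun w => \sum_(i <- s | Q i) F i w).
Proof.
move=> iF; elim: s => [|i s ih].
  by under [X in EFin \o X]eq_fun do rewrite big_nil; exact: Intg_cst.
under [X in EFin \o X]eq_fun do rewrite big_cons.
by case: (Q i) => //; exact: IntgD.
Qed.

Lemma ExD U V : Intg U -> Intg V -> Ex (fun w => U w + V w) = Ex U + Ex V.
Proof. by move=> iU iV; rewrite RintegralD. Qed.

Lemma ExB U V : Intg U -> Intg V -> Ex (fun w => U w - V w) = Ex U - Ex V.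
Proof. by move=> iU iV; rewrite RintegralB. Qed.

Lemma ExZ k U : Intg U -> Ex (fun w => k * U w) = k * Ex U.
Proof. by move=> iU; rewrite RintegralZl. Qed.

Lemma Ex_cst k : Ex (fun=> k) = k.
Proof. by rewrite Rintegral_cst//= (@probability_setT _ _ _ P) mulr1. Qed.

Lemma Ex_sum (I : Type) (s : seq I) (Q : pred I) (F : I -> Om -> R) :
  (forall i, Intg (F i)) ->
  Ex (fun w => \sum_(i <- s | Q i) F i w) = \sum_(i <- s | Q i) Ex (F i).
Proof.
move=> iF; elim: s => [|i s ih].
  by under eq_Rintegral do rewrite big_nil; rewrite Ex_cst big_nil.
under eq_Rintegral do rewrite big_cons.
rewrite big_cons; case: (Q i) => //.
by rewrite ExD ?ih//; exact: Intg_sum.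
Qed.

Lemma eq_Ex U V : U =1 V -> Ex U = Ex V.
Proof. by move=> UV; apply: eq_Rintegral => w _; exact: UV. Qed.

Lemma eq_Intg U V : U =1 V -> Intg U -> Intg V.
Proof. by move=> /funext ->. Qed.

Lemma ExE U : Intg U -> (\int[P]_w (U w)%:E)%E = (Ex U)%:E.
Proof. by move=> iU; rewrite /Rintegral fineK//; exact: integrable_fin_num. Qed.

Lemma ae_eq_Ex U V : measurable_fun setT U -> measurable_fun setT V ->
  {ae P, forall w, U w = V w} -> Ex U = Ex V.
Proof.
move=> mU mV UV; rewrite /Rintegral; congr fine; apply: ae_eq_integral => //.
- exact/measurable_EFinP.
- exact/measurable_EFinP.
- by apply: filterS UV => w UVw _ /=; rewrite UVw.
Qed.

Lemma le_Ex U V : Intg U -> Intg V -> {ae P, forall w, U w <= V w} ->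
  Ex U <= Ex V.
Proof.
move=> iU iV UV; rewrite -subr_ge0 -ExB//.
pose D w := V w - U w.
have mD : measurable_fun setT D by apply/Intg_meas/IntgB.
rewrite -/D (@ae_eq_Ex D (fun w => Num.max 0 (D w)))//.
- by apply: Rintegral_ge0 => w _; rewrite le_max lexx.
- exact: measurable_maxr.
- apply: filterS UV => w UVw; rewrite /D; apply/esym/max_idPr.
  by rewrite subr_ge0.
Qed.

Lemma Ex_ge0 U : Intg U -> {ae P, forall w, 0 <= U w} -> 0 <= Ex U.
Proof. by move=> iU U0; rewrite -(Ex_cst 0); apply: le_Ex => //; exact: Intg_cst. Qed.

Lemma norm_Ex U : Intg U -> `|Ex U| <= Ex (fun w => `|U w|).
Proof. by move=> iU; exact: le_normr_Rintegral. Qed.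

Lemma Ex_ge0_ae0 U : Intg U -> {ae P, forall w, 0 <= U w} -> Ex U = 0 ->
  {ae P, forall w, U w = 0}.
Proof.
move=> iU U0 EU.
have mU := Intg_meas iU.
have E0 : (\int[P]_w `|(EFin \o U) w| = 0)%E.
  have -> : (\int[P]_w `|(EFin \o U) w| = \int[P]_w ((fun w => `|U w|) w)%:E)%E by [].
  rewrite ExE; last exact: Intg_norm.
  rewrite (@ae_eq_Ex _ U) ?EU//.
    exact: measurableT_comp.
  by apply: filterS U0 => w Uw; rewrite ger0_norm.
have /ae_eq_integral_abs h := E0.
have {}h := h measurableT (measurable_int P iU).
by apply: filterS h => w /(_ I) [].
Qed.

Lemma Intg_mul_indic A U : measurable A -> Intg U -> Intg (fun w => U w * \1_A w).
Proof.
move=> mA iU; apply: (Intg_le _ _ iU).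
  by apply: measurable_funM; [exact: Intg_meas iU|exact: measurable_indic].
move=> w; rewrite normrM -[leRHS]mulr1 ler_wpM2l//.
by rewrite indicE ger0_norm// lern1 leq_b1.
Qed.

Lemma Ex_indic A U : measurable A -> Intg U ->
  (\int[P]_(w in A) (U w)%:E = (Ex (fun w => U w * \1_A w)%R)%:E)%E.
Proof.
move=> mA iU; rewrite integral_mkcond -ExE; last exact: Intg_mul_indic.
apply: eq_integral => w _; rewrite patchE indicE.
by case: ifPn; rewrite ?mulr1 ?mulr0.
Qed.

Lemma Intg_dominated_cvg (f_ : nat -> Om -> R) (f g : Om -> R) :
  (forall n, measurable_fun setT (f_ n)) -> measurable_fun setT f ->
  (forall w, f_ ^~ w @ \oo --> f w) -> Intg g ->
  (forall n w, `|f_ n w| <= g w) ->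
  Ex (f_ n) @[n --> \oo] --> Ex f.
Proof.
move=> mf_ mf cf ig fg.
have := @dominated_convergence _ _ _ P setT measurableT
  (fun n => EFin \o f_ n) (EFin \o f) (EFin \o g).
case.
- by move=> n; apply/measurable_EFinP; exact: mf_.
- exact/measurable_EFinP.
- apply: aeW => w _ /=; apply: cvg_EFin; [exact: nearW|exact: cf].
- exact: ig.
- by apply: aeW => w n _; rewrite /= lee_fin; exact: fg.
move=> if_ _ h.
have iff n : Intg (f_ n).
  by apply: Intg_le ig => // w; rewrite (le_trans (fg n w))// ler_norm.
have -> : Ex f = fine (\int[P]_(x in setT) (EFin \o f) x)%E by [].
apply: fine_cvg; rewrite fineK; last exact: integrable_fin_num.
exact: h.
Qed.

End expectation_toolbox.


(** * Conditional expectation *)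

Section conditional_expectation_theory.
Context {d : measure_display} {Om : measurableType d} {R : realType}.
Variable P : probability Om R.
Variable G : set_system Om.
Hypothesis sG : sigma_algebra setT G.
Hypothesis GM : G `<=` measurable.
Implicit Types U V W : Om -> R.

Local Notation Ex U := (Rintegral P setT U).
Local Notation Intg U := (P.-integrable setT (EFin \o U)).
Local Notation GT := (g_sigma_algebraType G).

(** Measurability with respect to G is phrased over the measurable type generated
    by G, so that the closure properties of measurable functions apply to it. *)
Definition gmeas W := measurable_fun (setT : set GT) (W : GT -> R).

Lemma GTE : @measurable _ GT = G.
Proof. exact: measurable_g_measurableTypeE. Qed.

Lemma gmeasP W : gmeas W <-> (forall B : set R, measurable B -> G (W @^-1` B)).
Proof.
split=> [mW B mB|mW _ B mB]; last by rewrite setTI GTE; exact: mW.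
by have := mW measurableT B mB; rewrite setTI GTE.
Qed.

Lemma gmeas_meas W : gmeas W -> measurable_fun setT W.
Proof. by move/gmeasP=> mW _ B mB; rewrite setTI; exact/GM/mW. Qed.

Lemma gmeas_indic A : G A -> gmeas \1_A.
Proof. by move=> GA; apply: measurable_indic; rewrite GTE. Qed.

Lemma is_condexp_gmeas U V : is_condexp P G U V -> gmeas V.
Proof. by case=> mV _ _; exact/gmeasP. Qed.

Lemma is_condexp_Intg U V : is_condexp P G U V -> Intg V.
Proof. by case. Qed.

Lemma is_condexp_Ex U V A : Intg U -> is_condexp P G U V -> G A ->
  Ex (fun w => V w * \1_A w) = Ex (fun w => U w * \1_A w).
Proof.
move=> iU [_ iV UV] GA; have := UV A GA.
by rewrite !Ex_indic//; [case|exact: GM|exact: GM].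
Qed.

Lemma is_condexpI U V : gmeas V -> Intg U -> Intg V ->
  (forall A, G A -> Ex (fun w => V w * \1_A w) = Ex (fun w => U w * \1_A w)) ->
  is_condexp P G U V.
Proof.
move=> mV iU iV UV; split => //; first exact/gmeasP.
by move=> A GA; rewrite !Ex_indic ?UV//; exact: GM.
Qed.

(** The set where V > V' belongs to G, and over it the integral of V - V' equals
    that of U - U' <= 0; so this set is null. *)
Lemma is_condexp_le U V U' V' : Intg U -> Intg U' ->
  is_condexp P G U V -> is_condexp P G U' V' ->
  {ae P, forall w, U w <= U' w} -> {ae P, forall w, V w <= V' w}.
Proof.
move=> iU iU' cV cV' UU'.
pose D w := V w - V' w.
have mD : gmeas D.
  by apply: measurable_funB; [exact: is_condexp_gmeas cV|exact: is_condexp_gmeas cV'].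
have iV := is_condexp_Intg cV; have iV' := is_condexp_Intg cV'.
have iD : Intg D by exact: IntgB.
pose A := D @^-1` `]0, +oo[%classic.
have GA : G A by move/gmeasP : mD; apply.
have mA := GM GA.
have D0 : {ae P, forall w, 0 <= D w * \1_A w}.
  apply: aeW => w; rewrite indicE.
  have [/set_mem|_] := boolP (w \in A); last by rewrite mulr0.
  by rewrite /A /= in_itv/= andbT mulr1 => /ltW.
have iDA : Intg (fun w => D w * \1_A w) by exact: Intg_mul_indic.
have ED : Ex (fun w => D w * \1_A w) <= 0.
  rewrite (@eq_Ex _ _ _ _ _ (fun w => V w * \1_A w - V' w * \1_A w)); last first.
    by move=> w; rewrite mulrBl.
  rewrite ExB; [|exact: Intg_mul_indic..].
  rewrite (is_condexp_Ex iU cV GA) (is_condexp_Ex iU' cV' GA) subr_le0.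
  apply: le_Ex; [exact: Intg_mul_indic..|].
  by apply: filterS UU' => w UU'w; rewrite ler_wpM2r.
have := Ex_ge0_ae0 iDA D0.
have -> : Ex (fun w => D w * \1_A w) = 0.
  by apply/eqP; rewrite eq_le ED Ex_ge0.
move=> /(_ erefl); apply: filterS => w.
rewrite indicE leNgt; have [/set_mem|/negP nA _] := boolP (w \in A).
  rewrite /A /= in_itv/= andbT mulr1 => D0w Dw.
  by rewrite Dw ltxx in D0w.
apply/negP => VV; apply: nA; apply/mem_set.
by rewrite /A /= in_itv/= andbT /D subr_gt0.
Qed.

Lemma is_condexp_uniq U V U' V' : Intg U -> Intg U' ->
  is_condexp P G U V -> is_condexp P G U' V' ->
  {ae P, forall w, U w = U' w} -> {ae P, forall w, V w = V' w}.
Proof.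
move=> iU iU' cV cV' UU'.
have l1 : {ae P, forall w, V w <= V' w}.
  by apply: (is_condexp_le iU iU' cV cV'); apply: filterS UU' => w ->.
have l2 : {ae P, forall w, V' w <= V w}.
  by apply: (is_condexp_le iU' iU cV' cV); apply: filterS UU' => w ->.
by apply: filterS2 l1 l2 => w h1 h2; apply/eqP; rewrite eq_le h1.
Qed.

Lemma is_condexp_id W : gmeas W -> Intg W -> is_condexp P G W W.
Proof. by move=> mW iW; exact: is_condexpI. Qed.

Lemma is_condexpD U V U' V' : Intg U -> Intg U' ->
  is_condexp P G U V -> is_condexp P G U' V' ->
  is_condexp P G (fun w => U w + U' w) (fun w => V w + V' w).
Proof.
move=> iU iU' cV cV'; have iV := is_condexp_Intg cV; have iV' := is_condexp_Intg cV'.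
apply: is_condexpI; [|exact: IntgD..|].
  by apply: measurable_funD; [exact: is_condexp_gmeas cV|exact: is_condexp_gmeas cV'].
move=> A GA; have mA := GM GA.
under eq_Ex do rewrite mulrDl.
under [RHS]eq_Ex do rewrite mulrDl.
rewrite !ExD; [|exact: Intg_mul_indic..].
by rewrite (is_condexp_Ex iU cV GA) (is_condexp_Ex iU' cV' GA).
Qed.

Lemma is_condexpZ k U V : Intg U -> is_condexp P G U V ->
  is_condexp P G (fun w => k * U w) (fun w => k * V w).
Proof.
move=> iU cV; have iV := is_condexp_Intg cV.
apply: is_condexpI; [|exact: IntgZ..|].
  by apply: measurable_funM => //; exact: is_condexp_gmeas cV.
move=> A GA; have mA := GM GA.
under eq_Ex do rewrite -mulrA.
under [RHS]eq_Ex do rewrite -mulrA.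
by rewrite !ExZ ?(is_condexp_Ex iU cV GA)//; exact: Intg_mul_indic.
Qed.

Lemma is_condexpB U V U' V' : Intg U -> Intg U' ->
  is_condexp P G U V -> is_condexp P G U' V' ->
  is_condexp P G (fun w => U w - U' w) (fun w => V w - V' w).
Proof.
move=> iU iU' cV cV'.
have := is_condexpD iU (IntgZ (-1) iU') cV (is_condexpZ (-1) iU' cV').
by congr is_condexp; apply/funext => w; rewrite mulN1r.
Qed.

Lemma pull_Ex_sum (s : seq R) (A : R -> set Om) U V : Intg U ->
  is_condexp P G U V -> (forall y, G (A y)) ->
  Ex (fun w => V w * \sum_(y <- s) y * \1_(A y) w) =
  Ex (fun w => U w * \sum_(y <- s) y * \1_(A y) w).
Proof.
move=> iU cV GA; have iV := is_condexp_Intg cV.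
under eq_Ex do rewrite mulr_sumr.
under [RHS]eq_Ex do rewrite mulr_sumr.
have h X y : Intg X -> Intg (fun w => X w * (y * \1_(A y) w)).
  move=> iX; rewrite (_ : (fun w => _) = fun w => y * (X w * \1_(A y) w)).
    by apply: IntgZ; apply: Intg_mul_indic => //; exact: GM.
  by apply/funext => w; rewrite mulrCA.
rewrite !Ex_sum; [|by move=> y; exact: h..].
apply: eq_bigr => y _.
under eq_Ex do rewrite mulrCA.
under [RHS]eq_Ex do rewrite mulrCA.
rewrite !ExZ; [|apply: Intg_mul_indic => //; exact: GM..].
by rewrite (is_condexp_Ex iU cV (GA y)).
Qed.

Import HBNNSimple.

(** Simple functions of G increase to W, and the products are dominated by
    [U W] and [V W]. *)
Lemma pull_Ex_ge0 U V W : Intg U -> is_condexp P G U V -> gmeas W ->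
  (forall w, 0 <= W w) ->
  Intg (fun w => U w * W w) -> Intg (fun w => V w * W w) ->
  Ex (fun w => V w * W w) = Ex (fun w => U w * W w).
Proof.
move=> iU cV mW W0 iUW iVW; have iV := is_condexp_Intg cV.
have mW' : measurable_fun (setT : set GT) (EFin \o W) by exact/measurable_EFinP.
pose g := nnsfun_approx measurableT mW'.
have gW n w : 0 <= g n w <= W w.
  rewrite nnsfun_approxE; apply/andP; split; first by rewrite -nnsfun_approxE.
  by rewrite -lee_fin; apply: (@le_approx _ _ _ setT (EFin \o W)) => // x _; rewrite lee_fin.
have cg w : g ^~ w @ \oo --> W w.
  rewrite -[X in _ --> X]/(fine (W w)%:E).
  have := @cvg_nnsfun_approx _ _ _ setT measurableT _ mW' (fun x _ => W0 x) w I.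
  by move/fine_cvg.
have mg n : measurable_fun setT (g n : Om -> R).
  by apply: gmeas_meas; exact: measurable_funP.
have key X : Intg X -> Intg (fun w => X w * W w) ->
    Ex (fun w => X w * g n w) @[n --> \oo] --> Ex (fun w => X w * W w).
  move=> iX iXW; apply: (@Intg_dominated_cvg _ _ _ P _ _ (fun w => `|X w * W w|)).
  - by move=> n; apply: measurable_funM => //; exact: Intg_meas iX.
  - exact: Intg_meas iXW.
  - by move=> w; apply: cvgM => //; exact: cvg_cst.
  - exact: Intg_norm.
  - move=> n w; rewrite !normrM ler_wpM2l//.
    by have /andP[g0 gW'] := gW n w; rewrite !ger0_norm// (le_trans g0).
have e n : Ex (fun w => V w * g n w) = Ex (fun w => U w * g n w).
  under eq_Ex do rewrite fimfunE fsbig_finite//=.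
  under [RHS]eq_Ex do rewrite fimfunE fsbig_finite//=.
  apply: pull_Ex_sum => // y.
  have := @measurable_funPTI _ _ _ _ (g n) [set y] (measurable_set1 _).
  by rewrite GTE.
have := key V iV iVW.
rewrite (_ : (fun n => Ex (fun w => V w * g n w)) = (fun n => Ex (fun w => U w * g n w))).
  by move=> /(cvg_unique _ (key U iU iUW)) => /(_ (@Rhausdorff R)) ->.
by apply/funext => n; exact: e.
Qed.

(** Only the integrability of the two products is required of W: this covers both
    bounded W and pairs of conjugate exponents. *)
Lemma pull_Ex U V W : Intg U -> is_condexp P G U V -> gmeas W ->
  Intg (fun w => U w * W w) -> Intg (fun w => V w * W w) ->
  Ex (fun w => V w * W w) = Ex (fun w => U w * W w).
Proof.
move=> iU cV mW iUW iVW; have iV := is_condexp_Intg cV.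
pose Wp w := Num.max (W w) 0; pose Wn w := Num.max (- W w) 0.
have mp : gmeas Wp by apply: measurable_maxr.
have mn : gmeas Wn by apply: measurable_maxr => //; exact: measurableT_comp.
have WE w : W w = Wp w - Wn w.
  by rewrite /Wp /Wn /Num.max; case: ltP => h1; case: ltP => h2; lra.
have Wpl w : `|Wp w| <= `|W w|.
  by rewrite /Wp /Num.max; case: ltP => // _; rewrite normr0.
have Wnl w : `|Wn w| <= `|W w|.
  by rewrite /Wn /Num.max; case: ltP => // _; rewrite ?normr0// normrN.
have ib X Y : Intg X -> gmeas Y -> (forall w, `|Y w| <= `|W w|) ->
    Intg (fun w => X w * W w) -> Intg (fun w => X w * Y w).
  move=> iX mY YW; apply: Intg_le.
    by apply: measurable_funM; [exact: Intg_meas iX|exact: gmeas_meas].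
  by move=> w; rewrite !normrM ler_wpM2l.
under eq_Ex do rewrite WE mulrBr.
under [RHS]eq_Ex do rewrite WE mulrBr.
rewrite !ExB; [|exact: ib..].
congr (_ - _); apply: pull_Ex_ge0 => //; try exact: ib.
- by move=> w; rewrite /Wp le_max lexx orbT.
- by move=> w; rewrite /Wn le_max lexx orbT.
Qed.

Lemma is_condexpM U V W : Intg U -> is_condexp P G U V -> gmeas W ->
  Intg (fun w => U w * W w) -> Intg (fun w => V w * W w) ->
  is_condexp P G (fun w => U w * W w) (fun w => V w * W w).
Proof.
move=> iU cV mW iUW iVW; have iV := is_condexp_Intg cV.
apply: is_condexpI => //.
  by apply: measurable_funM => //; exact: is_condexp_gmeas cV.
move=> A GA; have mA := GM GA.
under eq_Ex do rewrite -mulrA.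
under [RHS]eq_Ex do rewrite -mulrA.
have mWA : gmeas (fun w => W w * \1_A w).
  by apply: measurable_funM => //; exact: gmeas_indic.
apply: pull_Ex => //.
  by apply: eq_Intg (Intg_mul_indic mA iUW) => w; rewrite mulrA.
by apply: eq_Intg (Intg_mul_indic mA iVW) => w; rewrite mulrA.
Qed.

End conditional_expectation_theory.


(** * Integrability classes and the conditional Jensen inequality *)

Section powR_facts.
Context {R : realType}.
Implicit Types a b p s : R.

Lemma ler_powRl a b p : 0 <= p -> 0 <= a -> a <= b -> a `^ p <= b `^ p.
Proof.
by move=> p0 a0 ab; apply: ge0_ler_powR => //; rewrite nnegrE// (le_trans a0).
Qed.

Lemma powRK a s : 0 <= a -> s != 0 -> (a `^ s^-1) `^ s = a.
Proof. by move=> a0 s0; rewrite -powRrM mulVf// powRr1. Qed.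

(** Convexity of a^p in its supporting-line form; it is Young's inequality for
    a and b^(p - 1). *)
Lemma powR_tangent a b p : 0 <= a -> 0 <= b -> 1 <= p ->
  b `^ p + p * b `^ (p - 1) * (a - b) <= a `^ p.
Proof.
move=> a0 b0; rewrite le_eqVlt => /predU1P[<-|p1].
  by rewrite subrr !powRr1// powRr0 !mul1r addrCA subrr addr0.
have p0 : 0 < p by apply: lt_trans p1.
have pB : 0 < p - 1 by rewrite subr_gt0.
have q0 : 0 < p / (p - 1) by rewrite divr_gt0.
have pq : p^-1 + (p / (p - 1))^-1 = 1.
  by rewrite invf_div; field; rewrite gt_eqF.
have := @conjugate_powR R a (b `^ (p - 1)) p (p / (p - 1)) a0 (powR_ge0 _ _) p0 q0 pq.
rewrite -powRrM mulrCA divff ?gt_eqF// mulr1 => h.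
have hb : b `^ (p - 1) * b = b `^ p by rewrite mulrC mulr_powRB1.
have := ler_wpM2l (ltW p0) h.
have -> : p * (a `^ p / p + b `^ p / (p / (p - 1))) = a `^ p + (p - 1) * b `^ p.
  by field; rewrite !gt_eqF.
rewrite mulrBr -[p * _ * b]mulrA hb; lra.
Qed.

(** The supporting line of |u|^p at v.  Its slope is a function of v alone, which
    is what lets the slope be pulled out of a conditional expectation. *)
Lemma powR_tangent_real (u v : R) p : 1 <= p ->
  `|v| `^ p + p * `|v| `^ (p - 1) * Num.sg v * (u - v) <= `|u| `^ p.
Proof.
move=> p1; apply: le_trans (powR_tangent (normr_ge0 u) (normr_ge0 v) p1).
rewrite lerD2l -mulrA ler_wpM2l//.
  by rewrite mulr_ge0 ?powR_ge0// (le_trans ler01).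
by rewrite mulrBr -normrEsg lerB// (le_trans (ler_norm _))// normrM;
  rewrite ler_piMl// normr_sg lern1 leq_b1.
Qed.

Lemma measurable_sgr : measurable_fun setT (@Num.sg R).
Proof.
rewrite (_ : @Num.sg R = fun x => \1_`]0, +oo[ x - \1_`]-oo, 0[ x).
  by apply: measurable_funB; exact: measurable_indic.
apply/funext => x; rewrite !indicE !mem_setE !in_itv/= andbT.
by case: sgrP; rewrite ?subrr ?subr0 ?sub0r.
Qed.

End powR_facts.

Section integrability_degree.
Context {d : measure_display} {Om : measurableType d} {R : realType}.
Variable P : probability Om R.
Implicit Types (U V W : Om -> R) (s t : R).

Local Notation Ex U := (Rintegral P setT U).
Local Notation Intg U := (P.-integrable setT (EFin \o U)).

(** The class L^(1/s).  Indexing by the reciprocal exponent makes Hoelder's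
    inequality additive: a product of members of [Lr s] and [Lr t] is in
    [Lr (s + t)].  With c = 1/(3 + delta), F has degree c, Z^(alpha) degree 2c and
    Z^(alpha,beta) degree 3c, and everything of degree at most 1 is integrable. *)
Definition Lr s U :=
  measurable_fun setT U /\ Intg (fun w => `|U w| `^ s^-1).

Lemma Lr_meas s U : Lr s U -> measurable_fun setT U. Proof. by case. Qed.

Lemma measurable_norm_powR U p : measurable_fun setT U ->
  measurable_fun setT (fun w => `|U w| `^ p).
Proof.
move=> mU; apply: (measurableT_comp (measurable_powR p)).
exact: measurableT_comp.
Qed.

Lemma Lr_dom s U V : measurable_fun setT U -> Intg V ->
  (forall w, `|U w| `^ s^-1 <= V w) -> Lr s U.
Proof.
move=> mU iV UV; split => //; apply: (Intg_le _ _ iV).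
  exact: measurable_norm_powR.
by move=> w; rewrite ger0_norm ?powR_ge0// (le_trans (UV w))// ler_norm.
Qed.

Lemma Lr_le s U V : 0 < s -> measurable_fun setT U ->
  (forall w, `|U w| <= `|V w|) -> Lr s V -> Lr s U.
Proof.
move=> s0 mU UV [mV iV]; apply: (Lr_dom mU iV) => w.
by apply: ler_powRl => //; rewrite invr_ge0 ltW.
Qed.

Lemma Lr_sub s t U : 0 < s -> s <= t -> Lr s U -> Lr t U.
Proof.
move=> s0 st [mU iU]; apply: (Lr_dom mU (IntgD (Intg_cst P 1) iU)) => w.
have t0 : 0 < t by apply: lt_le_trans st.
have [U1|U1] := leP `|U w| 1.
  apply: (@le_trans _ _ 1); last by rewrite lerDl powR_ge0.
  have <- : 1 `^ t^-1 = 1 :> R by rewrite powR1.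
  by apply: ler_powRl => //; rewrite invr_ge0 ltW.
apply: (@le_trans _ _ (`|U w| `^ s^-1)); last by rewrite lerDr.
by apply: ler_powR; [exact: ltW|rewrite lef_pV2].
Qed.

Lemma Lr1P U : Lr 1 U <-> Intg U.
Proof.
split=> [[mU iU]|iU].
  apply: (Intg_le mU _ iU) => w; rewrite invr1 powRr1//.
  by rewrite normr_id.
split; first exact: Intg_meas iU.
by apply: eq_Intg (Intg_norm iU) => w; rewrite invr1 powRr1.
Qed.

Lemma Lr_Intg s U : 0 < s -> s <= 1 -> Lr s U -> Intg U.
Proof. by move=> s0 s1 lU; apply/Lr1P; exact: Lr_sub lU. Qed.

(** With x = |U|^(1/s) and y = |V|^(1/t), both factors are bounded by powers of
    x + y, so |U V|^(1/(s + t)) <= x + y pointwise. *)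
Lemma LrM s t U V : 0 < s -> 0 < t -> Lr s U -> Lr t V ->
  Lr (s + t) (fun w => U w * V w).
Proof.
move=> s0 t0 [mU iU] [mV iV].
apply: (Lr_dom _ (IntgD iU iV)); first exact: measurable_funM.
move=> w; set x := `|U w| `^ _; set y := `|V w| `^ _.
have x0 : 0 <= x by exact: powR_ge0.
have y0 : 0 <= y by exact: powR_ge0.
have st0 : 0 < s + t by rewrite addr_gt0.
have -> : x + y = ((x + y) `^ s * (x + y) `^ t) `^ (s + t)^-1.
  have xy0 : 0 <= x + y by rewrite addr_ge0.
  rewrite -powRD; last by rewrite (gt_eqF st0).
  by rewrite -powRrM divff ?gt_eqF// powRr1.
apply: ler_powRl => //; first by rewrite invr_ge0 ltW.
rewrite normrM; apply: ler_pM => //.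
  rewrite -[leLHS](@powRK _ _ s) ?gt_eqF//; apply: ler_powRl => //; first exact: ltW.
  by rewrite lerDl.
rewrite -[leLHS](@powRK _ _ t) ?gt_eqF//; apply: ler_powRl => //; first exact: ltW.
by rewrite lerDr.
Qed.

Lemma LrD s U V : 0 < s -> Lr s U -> Lr s V -> Lr s (fun w => U w + V w).
Proof.
move=> s0 [mU iU] [mV iV].
apply: (Lr_dom _ (IntgZ (2 `^ s^-1) (IntgD iU iV))); first exact: measurable_funD.
have s0' : 0 <= s^-1 by rewrite invr_ge0 ltW.
move=> w; have [UV|VU] := leP `|U w| `|V w|.
  apply: (@le_trans _ _ ((2 * `|V w|) `^ s^-1)).
    by apply: ler_powRl => //; rewrite (le_trans (ler_normD _ _))//; lra.
  by rewrite powRM// ler_wpM2l ?powR_ge0// lerDr powR_ge0.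
apply: (@le_trans _ _ ((2 * `|U w|) `^ s^-1)).
  by apply: ler_powRl => //; rewrite (le_trans (ler_normD _ _))//; lra.
by rewrite powRM// ler_wpM2l ?powR_ge0// lerDl powR_ge0.
Qed.

Lemma LrZ s k U : Lr s U -> Lr s (fun w => k * U w).
Proof.
move=> [mU iU]; split; first exact: measurable_funM.
by apply: eq_Intg (IntgZ (`|k| `^ s^-1) iU) => w; rewrite normrM powRM.
Qed.

Lemma LrB s U V : 0 < s -> Lr s U -> Lr s V -> Lr s (fun w => U w - V w).
Proof.
move=> s0 lU lV; have := LrD s0 lU (LrZ (-1) lV).
by congr Lr; apply/funext => w; rewrite mulN1r.
Qed.

Lemma Lr_cst s k : Lr s (fun=> k).
Proof. by split => //; exact: Intg_cst. Qed.

Lemma Lr_sum s (I : Type) (r : seq I) (Q : pred I) (F : I -> Om -> R) : 0 < s ->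
  (forall i, Lr s (F i)) -> Lr s (fun w => \sum_(i <- r | Q i) F i w).
Proof.
move=> s0 lF; elim: r => [|i r ih].
  by under eq_fun do rewrite big_nil; exact: Lr_cst.
by under eq_fun do rewrite big_cons; case: (Q i) => //; exact: LrD.
Qed.

Lemma Lr_norm s U : Lr s U -> Lr s (fun w => `|U w|).
Proof.
move=> [mU iU]; split; first exact: measurableT_comp.
by apply: eq_Intg iU => w; rewrite normr_id.
Qed.

Lemma Lr_powR s p U : 0 < p -> Lr s U -> Lr (p * s) (fun w => `|U w| `^ p).
Proof.
move=> p0 [mU iU]; split; first exact: measurable_norm_powR.
apply: eq_Intg iU => w; rewrite (ger0_norm (powR_ge0 _ _)) -powRrM.
by rewrite invfM mulrA divff ?gt_eqF// mul1r.
Qed.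

Lemma Lr_bdd s U k : 0 < s -> measurable_fun setT U -> (forall w, `|U w| <= k) ->
  Lr s U.
Proof.
move=> s0 mU Uk; apply: (Lr_le s0 mU _ (Lr_cst s k)) => w.
by rewrite (le_trans (Uk w))// ler_norm.
Qed.

Lemma LrM_bdd s U V k : 0 < s -> measurable_fun setT U ->
  (forall w, `|U w| <= k) -> Lr s V -> Lr s (fun w => U w * V w).
Proof.
move=> s0 mU Uk lV; apply: (Lr_le s0 _ _ (LrZ k lV)).
  by apply: measurable_funM => //; exact: Lr_meas lV.
move=> w; rewrite !normrM ler_wpM2r//.
by rewrite (le_trans (Uk w))// ler_norm.
Qed.

Variable G : set_system Om.
Hypothesis sG : sigma_algebra setT G.
Hypothesis GM : G `<=` measurable.

(** Jensen's inequality on the G-event |V| <= n: there the slope of the supporting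
    line at V is bounded, so E[slope * (U - V)] = 0. *)
Lemma is_condexp_trunc_powR p U V n : 1 <= p -> Intg U -> is_condexp P G U V ->
  Intg (fun w => `|U w| `^ p) ->
  Ex (fun w => `|V w| `^ p * \1_[set w | `|V w| <= n%:R] w) <=
  Ex (fun w => `|U w| `^ p).
Proof.
move=> p1 iU cV iUp; set A := [set w | _].
have p0 : 0 < p by apply: lt_le_trans p1.
have iV := is_condexp_Intg cV.
have mV := Intg_meas iV.
have gV := is_condexp_gmeas sG cV.
have GA : G A.
  have -> : A = V @^-1` ((@Num.norm R R) @^-1` `]-oo, n%:R]).
    by apply/seteqP; split => w; rewrite /A /= in_itv.
  by apply: (gmeasP sG V).1 => //; rewrite -[X in measurable X]setTI; exact: normr_measurable.
have mA := GM GA.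
pose W w := p * `|V w| `^ (p - 1) * Num.sg (V w) * \1_A w.
have gW : gmeas G W.
  apply: measurable_funM; last exact: gmeas_indic.
  apply: measurable_funM; last first.
    by apply: measurableT_comp gV; exact: measurable_sgr.
  apply: measurable_funM => //.
  apply: (measurableT_comp (measurable_powR (p - 1))).
  exact: measurableT_comp gV.
have Wb w : `|W w| <= p * n%:R `^ (p - 1).
  rewrite /W indicE; have [/set_mem Aw|_] := boolP (w \in A); last first.
    by rewrite mulr0 normr0 mulr_ge0 ?powR_ge0// ltW.
  rewrite mulr1 !normrM (ger0_norm (ltW p0)) (ger0_norm (powR_ge0 _ _)).
  rewrite -[leRHS]mulr1; apply: ler_pM => //.
  - by rewrite mulr_ge0 ?powR_ge0// ltW.
  - rewrite ler_wpM2l ?(ltW p0)//; apply: ler_powRl => //.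
    by rewrite subr_ge0.
  - by rewrite normr_sg lern1 leq_b1.
have mW : measurable_fun setT W by exact: gmeas_meas gW.
have ib X : Intg X -> Intg (fun w => X w * W w).
  move=> iX; apply: (Intg_le _ _ (IntgZ (p * n%:R `^ (p - 1)) iX)).
    by apply: measurable_funM => //; exact: Intg_meas iX.
  move=> w; rewrite mulrC normrM [leRHS]normrM ler_wpM2r// (le_trans (Wb w))//.
  exact: ler_norm.
have iVA : Intg (fun w => `|V w| `^ p * \1_A w).
  apply: (Intg_le _ _ (Intg_cst P (n%:R `^ p))).
    apply: measurable_funM; last exact: measurable_indic.
    exact: measurable_norm_powR.
  move=> w; rewrite indicE [leRHS]ger0_norm ?powR_ge0//.
  have [/set_mem Aw|_] := boolP (w \in A); last by rewrite mulr0 normr0 powR_ge0.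
  by rewrite mulr1 ger0_norm ?powR_ge0//; apply: ler_powRl => //; exact: ltW.
have E0 : Ex (fun w => U w * W w) - Ex (fun w => V w * W w) = 0.
  by rewrite (pull_Ex sG GM iU cV gW (ib _ iU) (ib _ iV)) subrr.
rewrite -[leLHS]addr0 -E0 -ExB; [|exact: ib..].
rewrite -ExD//; last by apply: IntgB; exact: ib.
apply: le_Ex => //; first by apply: IntgD => //; apply: IntgB; exact: ib.
apply: aeW => w; rewrite /W indicE.
have [_|_] := boolP (w \in A); last by rewrite !mulr0 subrr addr0 powR_ge0.
apply: le_trans (powR_tangent_real (U w) (V w) p1).
by rewrite !mulr1 le_eqVlt; apply/orP; left; apply/eqP; ring.
Qed.

(** The truncation level tends to infinity by monotone convergence; this yields
    the integrability of |V|^p as well. *)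
Lemma is_condexp_powR p U V : 1 <= p -> Intg U -> is_condexp P G U V ->
  Intg (fun w => `|U w| `^ p) ->
  Intg (fun w => `|V w| `^ p) /\
  Ex (fun w => `|V w| `^ p) <= Ex (fun w => `|U w| `^ p).
Proof.
move=> p1 iU cV iUp.
have iV := is_condexp_Intg cV.
have mV := Intg_meas iV.
pose A n := [set w | `|V w| <= n%:R].
pose f n w := `|V w| `^ p * \1_(A n) w.
have mA n : measurable (A n).
  rewrite (_ : A n = V @^-1` ((@Num.norm R R) @^-1` `]-oo, n%:R])); last first.
    by apply/seteqP; split => w; rewrite /A /= in_itv.
  rewrite -[X in measurable X]setTI; apply: mV => //.
  by rewrite -[X in measurable X]setTI; exact: normr_measurable.
have mf n : measurable_fun setT (f n).
  apply: measurable_funM; last exact: measurable_indic.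
  exact: measurable_norm_powR.
have f0 n w : 0 <= f n w by rewrite mulr_ge0 ?powR_ge0.
have nf w : {homo (fun n => (f n w)%:E) : m n / (m <= n)%N >-> (m <= n)%E}.
  move=> m n mn; rewrite lee_fin ler_wpM2l ?powR_ge0// !indicE.
  have [/set_mem Aw|//] := boolP (w \in A m).
  rewrite mem_set// /A/= (le_trans Aw)// ler_nat//.
have iA n : Intg (f n).
  apply: (Intg_le _ _ (Intg_cst P (n%:R `^ p))) => // w.
  rewrite /f indicE [leRHS]ger0_norm ?powR_ge0//.
  have [/set_mem Aw|_] := boolP (w \in A n); last by rewrite mulr0 normr0 powR_ge0.
  rewrite mulr1 ger0_norm ?powR_ge0//; apply: ler_powRl => //.
  by rewrite (le_trans ler01).
have cf w : (f n w)%:E @[n --> \oo] --> (`|V w| `^ p)%:E.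
  apply: cvg_near_cst; exists (Num.truncn `|V w|).+1 => //= n /= Vn.
  rewrite /f indicE mem_set ?mulr1// /A /= (le_trans (ltW (truncnS_gt _)))//.
  by rewrite ler_nat.
have le : (\int[P]_w (`|V w| `^ p)%:E <= (Ex (fun w => `|U w| `^ p))%:E)%E.
  rewrite (_ : (\int[P]_w (`|V w| `^ p)%:E =
      \int[P]_w limn (fun n => (f n w)%:E))%E); last first.
    by apply: eq_integral => w _; apply/esym/cvg_lim => //; exact: cf.
  have := @cvg_monotone_convergence _ _ _ P setT measurableT (fun n => EFin \o f n)
    (fun n => (measurable_EFinP _ _).2 (mf n))
    (fun n x _ => f0 n x) (fun x _ => nf x).
  move=> h; rewrite -(cvg_lim _ h)//; apply: lime_le.
    by apply/cvg_ex; eexists; exact: h.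
  apply: nearW => n; rewrite ExE ?lee_fin//.
  exact: is_condexp_trunc_powR.
have iVp : Intg (fun w => `|V w| `^ p).
  apply/integrableP; split; first by apply/measurable_EFinP/measurable_norm_powR.
  apply: (@le_lt_trans _ _ (\int[P]_w (`|V w| `^ p)%:E)%E).
    rewrite le_eqVlt; apply/orP; left; apply/eqP; apply: eq_integral => w _.
    by rewrite /= ger0_norm// powR_ge0.
  by rewrite (le_lt_trans le)// ltry.
by split => //; rewrite -lee_fin -ExE.
Qed.

Lemma Lr_condexp s U V : 0 < s -> s <= 1 -> is_condexp P G U V -> Lr s U ->
  Lr s V /\ Ex (fun w => `|V w| `^ s^-1) <= Ex (fun w => `|U w| `^ s^-1).
Proof.
move=> s0 s1 cV lU; have iU := Lr_Intg s0 s1 lU.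
have p1 : 1 <= s^-1 by rewrite invf_ge1.
have [iV le] := is_condexp_powR p1 iU cV lU.2.
by split => //; split => //; exact: Intg_meas (is_condexp_Intg cV).
Qed.

End integrability_degree.


(** * Conditioning on sub-families of independent coordinates *)

Section condexp_on_pi_system.
Context {d : measure_display} {Om : measurableType d} {R : realType}.
Variable P : probability Om R.
Variable C : set_system Om.
Hypothesis CI : setI_closed C.
Hypothesis CT : C setT.
Hypothesis CM : C `<=` measurable.

Local Notation Ex U := (Rintegral P setT U).
Local Notation Intg U := (P.-integrable setT (EFin \o U)).

Lemma g_sigma_measurable : <<s C >> `<=` measurable.
Proof. by apply: smallest_sub => //; exact: sigma_algebra_measurable. Qed.

(** The events on which the two integrals agree form a Dynkin system. *)
Lemma is_condexp_pi (U V : Om -> R) : gmeas <<s C >> V -> Intg U -> Intg V ->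
  (forall A, C A -> Ex (fun w => V w * \1_A w) = Ex (fun w => U w * \1_A w)) ->
  is_condexp P <<s C >> U V.
Proof.
move=> mV iU iV UV.
pose H := [set A | measurable A /\
  Ex (fun w => V w * \1_A w) = Ex (fun w => U w * \1_A w)].
have EVU : Ex V = Ex U.
  have := UV _ CT.
  under eq_Ex do rewrite indicT mulr1.
  by under [RHS]eq_Ex do rewrite indicT mulr1.
suff CH : <<s C >> `<=` H.
  apply: is_condexpI => //; first exact: g_sigma_measurable.
  by move=> A /CH[].
rewrite -setI_closed_g_dynkin_g_sigma_algebra//.
apply: smallest_sub; last by move=> A CA; split; [exact: CM|exact: UV].
split.
- by split => //; exact: UV.
- move=> A [mA EA]; split; first exact: measurableC.
  have e X : Intg X -> Ex (fun w => X w * \1_(~` A) w) =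
      Ex X - Ex (fun w => X w * \1_A w).
    move=> iX; rewrite -ExB//; last exact: Intg_mul_indic.
    apply: eq_Ex => w; rewrite !indicE in_setC.
    by case: (w \in A); rewrite ?mulr1 ?mulr0 ?subrr ?subr0.
  by rewrite !e// EA EVU.
- move=> F tF FH.
  have mF n : measurable (F n) by case: (FH n).
  have mU : measurable (\bigcup_k F k) by exact: bigcupT_measurable.
  split => //.
  suff : (\int[P]_(w in \bigcup_k F k) (V w)%:E =
          \int[P]_(w in \bigcup_k F k) (U w)%:E)%E.
    by rewrite !Ex_indic// => -[].
  rewrite !(integral_bigcup tF mF); [|exact: integrableS _ iU|exact: integrableS _ iV].
  apply: eq_eseriesr => n _.
  by rewrite !Ex_indic//; congr EFin; case: (FH n).
Qed.

End condexp_on_pi_system.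

Section independence.
Context {d d' : measure_display} {Om : measurableType d}
  {T : measurableType d'} {R : realType}.
Variables (P : probability Om R) (n : nat) (X : 'I_n -> {RV P >-> T}).
Implicit Types (K L : pred 'I_n) (B : 'I_n -> set T).

Local Notation Ex U := (Rintegral P setT U).
Local Notation Intg U := (P.-integrable setT (EFin \o U)).

(** Rectangles over the coordinates in K form a pi-system on which independence is
    a product rule. *)
Definition rect K B : set Om := \bigcap_(i in [set i | K i]) (X i @^-1` B i).

Definition rects K : set_system Om :=
  [set A | exists2 B, (forall i, measurable (B i)) & A = rect K B].

Lemma rectI K B B' : rect K B `&` rect K B' = rect K (fun i => B i `&` B' i).
Proof.
apply/seteqP; split => [w [h h'] i Ki|w h]; first by split; [exact: h|exact: h'].
by split => i Ki; have [] := h i Ki.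
Qed.

Lemma rectsI K : setI_closed (rects K).
Proof.
move=> _ _ [B mB ->] [B' mB' ->]; exists (fun i => B i `&` B' i); last exact: rectI.
by move=> i; exact: measurableI.
Qed.

Lemma rectsT K : rects K setT.
Proof. by exists (fun=> setT) => //; apply/seteqP; split. Qed.

Lemma sigma_of_rects K : sigma_of X K = <<s rects K >>.
Proof.
apply/seteqP; split.
  apply: smallest_sub; first exact: smallest_sigma_algebra.
  move=> A [i /= Ki [B mB <-]]; apply: sub_sigma_algebra.
  exists (fun j => if j == i then B else setT).
    by move=> j; case: ifPn.
  apply/seteqP; split => [w [_ Bw] j Kj /=|w h].
    by case: eqP => // ->.
  by split => //; have := h i Ki; rewrite /= eqxx.
apply: smallest_sub; first exact: smallest_sigma_algebra.
move=> A [B mB ->]; rewrite /sigma_of.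
set GG := (X in <<s X >>).
have := @fin_bigcap_measurable _ (g_sigma_algebraType GG) _ [set i | K i]
  (fun i => X i @^-1` B i).
apply; first exact: finite_finset.
move=> i Ki; apply: sub_sigma_algebra; exists i => //; exists (B i) => //.
by rewrite setTI.
Qed.

Lemma rects_measurable K : rects K `<=` measurable.
Proof.
move=> A [B mB ->]; apply: fin_bigcap_measurable; first exact: finite_finset.
by move=> i Ki; rewrite -[X in measurable X]setTI; exact: measurable_funPT.
Qed.

Lemma sigma_of_measurable K : sigma_of X K `<=` measurable.
Proof. by rewrite sigma_of_rects; exact/g_sigma_measurable/rects_measurable. Qed.

Lemma sigma_of_sigma K : sigma_algebra setT (sigma_of X K).
Proof. exact: smallest_sigma_algebra. Qed.

Lemma sub_sigma_of K L : (forall i, K i -> L i) -> sigma_of X K `<=` sigma_of X L.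
Proof.
move=> KL; apply: sub_sigma_algebra2 => A [i /= Ki XA].
by exists i => //; exact: KL.
Qed.

Hypothesis indepX : mutually_independent X.

Lemma rectE K B : rect K B = \bigcap_(i in [set` [set i | K i]%SET]) (X i @^-1` B i).
Proof.
rewrite /rect (_ : [set` _] = [set i | K i])//.
by apply/seteqP; split => i /=; rewrite inE.
Qed.

Lemma prob_rectI K L B B' : (forall i, measurable (B i)) ->
  (forall i, measurable (B' i)) -> (forall i, K i -> ~~ L i) ->
  P (rect K B `&` rect L B') = (P (rect K B) * P (rect L B'))%E.
Proof.
move=> mB mB' KL.
pose B2 i := if K i then B i else B' i.
have -> : rect K B `&` rect L B' = rect (fun i => K i || L i) B2.
  apply/seteqP; split => [w [h h'] i /= /orP KLi|w h].
    rewrite /B2; case: ifPn => Ki; first exact: h.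
    by case: KLi => [Ki'|Li]; [rewrite Ki' in Ki|exact: h'].
  split=> i /= Ki; have := h i; rewrite /= Ki ?orbT /B2 ?Ki => /(_ isT)//.
  by case: ifPn => // Ki'; have := KL _ Ki'; rewrite Ki.
rewrite !rectE !indepX//; last by move=> i; rewrite /B2; case: ifPn.
rewrite (eq_bigl [in [predU [set i | K i]%SET & [set i | L i]%SET]]); last first.
  by move=> i; rewrite !inE.
rewrite bigU/=; last first.
  rewrite disjoint_subset; apply/fintype.subsetP => i; rewrite !inE => Ki.
  exact: KL.
congr (_ * _)%E; apply: eq_bigr => i; rewrite inE => Ki; rewrite /B2.
  by rewrite Ki.
by case: ifPn => // Ki'; have := KL _ Ki'; rewrite Ki.
Qed.

(** Independence of the event from the coordinates in L, in the form in which it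
    can be combined with pulling out factors measurable in those coordinates. *)
Lemma condexp_indic_indep K L B : (forall i, measurable (B i)) ->
  (forall i, K i -> ~~ L i) ->
  is_condexp P (sigma_of X L) \1_(rect K B) (fun=> fine (P (rect K B))).
Proof.
move=> mB KL.
have mK : measurable (rect K B) by apply: (rects_measurable (K := K)); exists B.
have iK : Intg \1_(rect K B) by exact: integrable_indic.
rewrite sigma_of_rects; apply: is_condexp_pi => //.
- exact: rectsI.
- exact: rectsT.
- exact: rects_measurable.
- exact: measurable_cst.
- exact: Intg_cst.
move=> A [B' mB' ->].
have mL : measurable (rect L B') by apply: (rects_measurable (K := L)); exists B'.
rewrite ExZ; last exact: integrable_indic.
under [RHS]eq_Ex do rewrite -[_ * _]/((\1_(rect K B) \* \1_(rect L B')) _) -indicI.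
rewrite /Rintegral !integral_indic// ?setIT; last exact: measurableI.
rewrite -fineM ?fin_num_measure//; congr fine; apply/esym.
exact: prob_rectI.
Qed.

(** Test against a rectangle over K, cut into its part A1 over K and L and its part
    A2 over K minus L.  The event A2 is independent of everything else involved, so
    both sides equal P(A2) E[U 1_A1]. *)
Theorem condexp_cross K L (U W Z : Om -> R) : Intg U ->
  is_condexp P (sigma_of X L) U W ->
  is_condexp P (sigma_of X (fun i => K i && L i)) U Z ->
  is_condexp P (sigma_of X K) W Z.
Proof.
move=> iU cW cZ.
have iW := is_condexp_Intg cW; have iZ := is_condexp_Intg cZ.
pose KL i := K i && L i; pose KnL i := K i && ~~ L i.
rewrite sigma_of_rects; apply: is_condexp_pi => //.
- exact: rectsI.
- exact: rectsT.
- exact: rects_measurable.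
- rewrite -sigma_of_rects; apply/gmeasP; first exact: sigma_of_sigma.
  move=> B mB; apply: (@sub_sigma_of KL); first by move=> i /andP[].
  by case: cZ => + _ _; apply.
move=> _ [B mB ->].
have -> : rect K B = rect KL B `&` rect KnL B.
  apply/seteqP; split => [w h|w [h h'] i Ki].
    by split => i /andP[Ki _]; exact: h.
  have [Li|nLi] := boolP (L i); [apply: h|apply: h'].
    by rewrite /KL /= Ki Li.
  by rewrite /KnL /= Ki nLi.
set A1 := rect KL B; set A2 := rect KnL B; set p := fine (P A2).
have mA1 : measurable A1 by apply: (rects_measurable (K := KL)); exists B.
have mA2 : measurable A2 by apply: (rects_measurable (K := KnL)); exists B.
have GA1 : sigma_of X KL A1.
  by rewrite sigma_of_rects; apply: sub_sigma_algebra; exists B.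
have GA1L : sigma_of X L A1 by apply: sub_sigma_of GA1 => i /andP[].
have split_off M (V : Om -> R) : (forall i, KnL i -> ~~ M i) ->
    sigma_of X M A1 -> gmeas (sigma_of X M) V -> Intg V ->
    Ex (fun w => V w * \1_(A1 `&` A2) w) = p * Ex (fun w => V w * \1_A1 w).
  move=> dM MA1 gV iV.
  have iVA : Intg (fun w => V w * \1_A1 w) by exact: Intg_mul_indic.
  have gVA : gmeas (sigma_of X M) (fun w => V w * \1_A1 w).
    by apply: measurable_funM => //; apply: gmeas_indic MA1; exact: sigma_of_sigma.
  have := @pull_Ex _ _ _ P _ (sigma_of_sigma M) (@sigma_of_measurable M)
    \1_A2 (fun=> p) (fun w => V w * \1_A1 w) (integrable_indic _ mA2)
    (condexp_indic_indep mB dM) gVA.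
  rewrite -ExZ// => ->.
  - apply: eq_Ex => w; rewrite indicI/=; ring.
  - apply: eq_Intg (Intg_mul_indic mA2 iVA) => w; exact: mulrC.
  - exact: IntgZ.
rewrite (split_off KL)//; last 2 first.
- by move=> i /andP[Ki nLi]; rewrite /KL negb_and nLi orbT.
- exact: (is_condexp_gmeas (sigma_of_sigma _) cZ).
rewrite (split_off L)//; last 2 first.
- by move=> i /andP[].
- exact: (is_condexp_gmeas (sigma_of_sigma _) cW).
congr (_ * _).
rewrite (is_condexp_Ex _ iU cZ GA1); last exact: sigma_of_measurable.
by rewrite (is_condexp_Ex _ iU cW GA1L)//; exact: sigma_of_measurable.
Qed.

End independence.


(** * The covariance identity *)

Section clark_ocone.
Context {d d' : measure_display} {Om : measurableType d}
  {T : measurableType d'} {R : realType}.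
Variables (P : probability Om R) (n : nat) (X : 'I_n -> {RV P >-> T}).
Hypothesis indepX : mutually_independent X.
Implicit Types (K L : pred 'I_n) (U V W Z : Om -> R) (k : 'I_n) (s t : R).

Local Notation Ex U := (Rintegral P setT U).
Local Notation Intg U := (P.-integrable setT (EFin \o U)).
Local Notation ce K U := (condexp P (sigma_of X K) U).

Lemma ceP K U : Intg U -> is_condexp P (sigma_of X K) U (ce K U).
Proof. by apply: condexpP; [exact: sigma_of_sigma|exact: sigma_of_measurable]. Qed.

Lemma ce_gmeas K U : Intg U -> gmeas (sigma_of X K) (ce K U).
Proof. by move=> /(ceP K); apply: is_condexp_gmeas; exact: sigma_of_sigma. Qed.

Lemma ce_ae K U Z : Intg U -> is_condexp P (sigma_of X K) U Z ->
  {ae P, forall w, ce K U w = Z w}.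
Proof.
move=> iU cZ; apply: (is_condexp_uniq (sigma_of_sigma X K) (@sigma_of_measurable _ _ _ _ _ _ _ X K)
  iU iU (ceP K iU) cZ).
exact: aeW.
Qed.

Lemma Lr_ce s K U : 0 < s -> s <= 1 -> Lr P s U -> Lr P s (ce K U).
Proof.
move=> s0 s1 lU; have iU := Lr_Intg s0 s1 lU.
by have [] := Lr_condexp (sigma_of_sigma X K) (@sigma_of_measurable _ _ _ _ _ _ _ X K) s0 s1 (ceP K iU) lU.
Qed.

Lemma Ex_ce_powR s K U : 0 < s -> s <= 1 -> Lr P s U ->
  Ex (fun w => `|ce K U w| `^ s^-1) <= Ex (fun w => `|U w| `^ s^-1).
Proof.
move=> s0 s1 lU; have iU := Lr_Intg s0 s1 lU.
by have [] := Lr_condexp (sigma_of_sigma X K) (@sigma_of_measurable _ _ _ _ _ _ _ X K) s0 s1 (ceP K iU) lU.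
Qed.

Lemma Lr_Eout s k U : 0 < s -> s <= 1 -> Lr P s U -> Lr P s (Eout X k U).
Proof. exact: Lr_ce. Qed.

Lemma Lr_Ddiff s k U : 0 < s -> s <= 1 -> Lr P s U -> Lr P s (Ddiff X k U).
Proof. by move=> s0 s1 lU; apply: LrB => //; exact: Lr_Eout. Qed.

Lemma Lr_Dalpha s a k U : 0 < s -> s <= 1 -> Lr P s U -> Lr P s (Dalpha X a k U).
Proof.
move=> s0 s1 lU; have lD := Lr_Ddiff k s0 s1 lU.
by apply: LrD => //; apply: LrZ; apply: Lr_ce.
Qed.

Lemma Intg_mul s t U V : 0 < s -> 0 < t -> s + t <= 1 -> Lr P s U -> Lr P t V ->
  Intg (fun w => U w * V w).
Proof.
move=> s0 t0 st lU lV; apply: (@Lr_Intg _ _ _ _ (s + t)) => //.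
  exact: addr_gt0.
exact: LrM.
Qed.

Lemma condexp_ce K L U : Intg U ->
  is_condexp P (sigma_of X K) (ce L U) (ce (fun i => K i && L i) U).
Proof.
move=> iU; apply: (condexp_cross indepX iU); exact: ceP.
Qed.

(** With L the coordinates other than k, E[D_k V | K] = E[V | K] - E[V | K and L].
    This increment has conditional expectation 0 given L, hence is orthogonal to
    E_k U, and D_k U may be replaced by U. *)
Lemma Ex_ce_Ddiff K k s t U V : 0 < s -> 0 < t -> s + t <= 1 ->
  Lr P s U -> Lr P t V ->
  Ex (fun w => Ddiff X k U w * ce K (Ddiff X k V) w) =
  Ex (fun w => ce K V w * U w) - Ex (fun w => ce (fun i => K i && (i != k)) V w * U w).
Proof.
move=> s0 t0 st lU lV.
have s1 : s <= 1 by apply: le_trans st; rewrite lerDl ltW.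
have t1 : t <= 1 by apply: le_trans st; rewrite lerDr ltW.
have iU := Lr_Intg s0 s1 lU; have iV := Lr_Intg t0 t1 lV.
pose L := (fun i => i != k) : pred 'I_n.
pose VK := ce K V; pose Z := ce (fun i => K i && L i) V; pose UL := ce L U.
have lVK : Lr P t VK by exact: Lr_ce.
have lZ : Lr P t Z by exact: Lr_ce.
have lUL : Lr P s UL by exact: Lr_ce.
have iVK := Lr_Intg t0 t1 lVK; have iZ := Lr_Intg t0 t1 lZ.
have lDU := Lr_Ddiff k s0 s1 lU; have lDV := Lr_Ddiff k t0 t1 lV.
have ts : t + s <= 1 by rewrite addrC.
have eD : {ae P, forall w, ce K (Ddiff X k V) w = VK w - Z w}.
  apply: ce_ae; first exact: Lr_Intg lDV.
  apply: is_condexpB => //.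
  - exact: sigma_of_sigma.
  - exact: sigma_of_measurable.
  - exact: (is_condexp_Intg (ceP L iV)).
  - exact: ceP.
  - exact: condexp_ce.
have -> : Ex (fun w => Ddiff X k U w * ce K (Ddiff X k V) w) =
    Ex (fun w => (VK w - Z w) * (U w - UL w)).
  apply: ae_eq_Ex.
  - apply: Intg_meas (Intg_mul s0 t0 st lDU _); exact: Lr_ce.
  - by apply: measurable_funM; apply: measurable_funB;
      [exact: Lr_meas lVK|exact: Lr_meas lZ|exact: Lr_meas lU|exact: Lr_meas lUL].
  - by apply: filterS eD => w ->; rewrite mulrC.
have -> : Ex (fun w => (VK w - Z w) * (U w - UL w)) =
    Ex (fun w => (VK w * U w - Z w * U w) - (VK w * UL w - Z w * UL w)).
  by apply: eq_Ex => w; ring.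
rewrite !ExB; try (by apply: IntgB; apply: (Intg_mul t0 s0));
  try by apply: (Intg_mul t0 s0).
suff -> : Ex (fun w => VK w * UL w) = Ex (fun w => Z w * UL w).
  by rewrite subrr subr0.
have cZ : is_condexp P (sigma_of X L) VK Z.
  have := condexp_ce L K iV; rewrite (_ : (fun i => L i && K i) = (fun i => K i && L i))//.
  by apply/funext => i; rewrite andbC.
rewrite -(pull_Ex (sigma_of_sigma X _) (@sigma_of_measurable _ _ _ _ _ _ _ X L) iVK cZ)//.
- exact: ce_gmeas.
- exact: (Intg_mul t0 s0).
- exact: (Intg_mul t0 s0).
Qed.

(** The starting point of the telescoping sum: conditioning on no coordinate. *)
Lemma sigma_of_none K A : (forall i, ~~ K i) -> sigma_of X K A -> A = set0 \/ A = setT.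
Proof.
move=> K0; apply: (@smallest_sub _ _ _ [set A | A = set0 \/ A = setT]).
  split; first by left.
  - by move=> B [->|->]; [right; rewrite setD0|left; rewrite setDv].
  - move=> B B0; have [[m Bm]|h] := pselect (exists m, B m = setT).
      by right; apply/seteqP; split => // w _; exists m => //; rewrite Bm.
    left; apply/seteqP; split => // w [m _ Bm].
    have [B0'|BT] := B0 m; first by rewrite B0' in Bm.
    by case: h; exists m.
by move=> B [i /= Ki]; have := K0 i; rewrite Ki.
Qed.

Lemma Ex_ce_none K s t U V : (forall i, ~~ K i) -> 0 < s -> 0 < t -> s + t <= 1 ->
  Lr P s U -> Lr P t V -> Ex (fun w => ce K V w * U w) = Ex U * Ex V.
Proof.
move=> K0 s0 t0 st lU lV.
have s1 : s <= 1 by apply: le_trans st; rewrite lerDl ltW.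
have t1 : t <= 1 by apply: le_trans st; rewrite lerDr ltW.
have iU := Lr_Intg s0 s1 lU; have iV := Lr_Intg t0 t1 lV.
have cV : is_condexp P (sigma_of X K) V (fun=> Ex V).
  apply: is_condexpI => //.
  - exact: sigma_of_sigma.
  - exact: sigma_of_measurable.
  - exact: measurable_cst.
  - exact: Intg_cst.
  move=> A /(sigma_of_none K0)[->|->].
    rewrite indic0; under eq_Ex do rewrite mulr0.
    by under [RHS]eq_Ex do rewrite mulr0.
  rewrite indicT; under eq_Ex do rewrite mulr1.
  under [RHS]eq_Ex do rewrite mulr1.
  exact: Ex_cst.
rewrite mulrC -ExZ//; apply: ae_eq_Ex.
- apply: measurable_funM; last exact: Lr_meas lU.
  exact: Lr_meas (Lr_ce K t0 t1 lV).
- by apply: measurable_funM => //; exact: Lr_meas lU.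
- by apply: filterS (ce_ae iV cV) => w ->.
Qed.

Lemma Ex_ce_all K s t U V : (forall i, K i) -> 0 < s -> 0 < t -> s + t <= 1 ->
  gmeas (sigma_of X predT) U ->
  Lr P s U -> Lr P t V -> Ex (fun w => ce K V w * U w) = Ex (fun w => U w * V w).
Proof.
move=> KT s0 t0 st gU lU lV.
have t1 : t <= 1 by apply: le_trans st; rewrite lerDr ltW.
have iV := Lr_Intg t0 t1 lV.
have KE : K = predT by apply/funext => i; exact: KT.
have ts : t + s <= 1 by rewrite addrC.
rewrite {}KE (pull_Ex (sigma_of_sigma X predT) (@sigma_of_measurable _ _ _ _ _ _ _ X predT) iV (ceP predT iV) gU).
- by apply: eq_Ex => w; exact: mulrC.
- exact: (Intg_mul t0 s0).
- by apply: (Intg_mul t0 s0) => //; exact: Lr_ce.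
Qed.

Lemma covariance_past s t U V : 0 < s -> 0 < t -> s + t <= 1 ->
  gmeas (sigma_of X predT) U -> Lr P s U -> Lr P t V ->
  \sum_(k < n) Ex (fun w => Ddiff X k U w * condexp P (past X k) (Ddiff X k V) w) =
  Ex (fun w => U w * V w) - Ex U * Ex V.
Proof.
move=> s0 t0 st gU lU lV.
pose A j := Ex (fun w => ce (fun i : 'I_n => (i < j)%N) V w * U w).
transitivity (\sum_(k < n) (A k.+1 - A k)).
  apply: eq_bigr => k _; rewrite (Ex_ce_Ddiff _ _ s0 t0)//; congr (_ - _).
  rewrite /A (_ : (fun i : 'I_n => (i <= k)%N && (i != k)) =
    (fun i : 'I_n => (i < k)%N))//.
  by apply/funext => i; rewrite ltn_neqAle andbC.
rewrite -(big_mkord xpredT (fun k : nat => A k.+1 - A k)) telescope_sumr//.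
by rewrite /A (Ex_ce_all _ s0 t0)// (Ex_ce_none _ s0 t0).
Qed.

Lemma covariance_future s t U V : 0 < s -> 0 < t -> s + t <= 1 ->
  gmeas (sigma_of X predT) U -> Lr P s U -> Lr P t V ->
  \sum_(k < n) Ex (fun w => Ddiff X k U w * condexp P (future X k) (Ddiff X k V) w) =
  Ex (fun w => U w * V w) - Ex U * Ex V.
Proof.
move=> s0 t0 st gU lU lV.
pose A j := - Ex (fun w => ce (fun i : 'I_n => (j <= i)%N) V w * U w).
transitivity (\sum_(k < n) (A k.+1 - A k)).
  apply: eq_bigr => k _; rewrite (Ex_ce_Ddiff _ _ s0 t0)// /A opprK addrC; congr (- _ + _).
  rewrite (_ : (fun i : 'I_n => (k <= i)%N && (i != k)) =
    (fun i : 'I_n => (k < i)%N))//.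
  by apply/funext => i; rewrite ltn_neqAle andbC eq_sym.
rewrite -(big_mkord xpredT (fun k : nat => A k.+1 - A k)) telescope_sumr//.
rewrite /A (Ex_ce_none _ s0 t0)//; last by move=> i; rewrite -ltnNge.
by rewrite (Ex_ce_all _ s0 t0)// opprK addrC.
Qed.

(** The convex combination, with weight [a], of the identities obtained by revealing
    the coordinates in increasing and in decreasing order. *)
Theorem covariance_Dalpha a s t U V : 0 < s -> 0 < t -> s + t <= 1 ->
  gmeas (sigma_of X predT) U -> Lr P s U -> Lr P t V ->
  Ex (fun w => U w * V w) - Ex U * Ex V =
  \sum_(k < n) Ex (fun w => Ddiff X k U w * Dalpha X a k V w).
Proof.
move=> s0 t0 st gU lU lV.
have s1 : s <= 1 by apply: le_trans st; rewrite lerDl ltW.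
have t1 : t <= 1 by apply: le_trans st; rewrite lerDr ltW.
have h K k : Intg (fun w => Ddiff X k U w * ce K (Ddiff X k V) w).
  apply: (Intg_mul s0 t0) => //; first exact: Lr_Ddiff.
  by apply: Lr_ce => //; exact: Lr_Ddiff.
transitivity (\sum_(k < n)
   (a * Ex (fun w => Ddiff X k U w * condexp P (past X k) (Ddiff X k V) w) +
   (1 - a) * Ex (fun w => Ddiff X k U w * condexp P (future X k) (Ddiff X k V) w))).
  rewrite big_split/= -!mulr_sumr (covariance_past s0 t0)//.
  by rewrite (covariance_future s0 t0)//; ring.
apply: eq_bigr => k _.
rewrite -!ExZ//; [|exact: h..].
rewrite -ExD; [|by apply: IntgZ; exact: h..].
by apply: eq_Ex => w; rewrite /Dalpha; ring.
Qed.

End clark_ocone.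


(** * Taylor expansion with a Hoelder second derivative *)

Section taylor_hoelder.
Context {R : realType}.
Implicit Types (f df phi : R -> R) (x y z a b : R).

Lemma is_derive_continuous f df : (forall x, is_derive x 1 f (df x)) -> continuous f.
Proof.
move=> h x; apply/differentiable_continuous/derivable1_diffP.
exact: (@ex_derive _ _ _ _ _ _ _ (h x)).
Qed.

Lemma mean_value f df x y : (forall x, is_derive x 1 f (df x)) -> x != y ->
  exists c, [/\ f y - f x = df c * (y - x), c != x & `|c - x| <= `|y - x|].
Proof.
move=> h; have cf a b : {within `[a, b], continuous f}.
  by apply: continuous_subspaceT => z; exact: is_derive_continuous h z.
rewrite neq_lt => /orP[xy|yx].
  have [c cxy e] := @MVT _ f df x y xy (fun z _ => h z) (cf _ _).
  exists c; move: cxy; rewrite in_itv/= => /andP[xc cy].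
  split => //; first by rewrite gt_eqF.
  by rewrite !gtr0_norm ?subr_gt0// lerD2r ltW.
have [c cyx e] := @MVT _ f df y x yx (fun z _ => h z) (cf _ _).
exists c; move: cyx; rewrite in_itv/= => /andP[yc cx].
split; [|by rewrite lt_eqF|].
  by rewrite -opprB e -mulrN opprB.
by rewrite !ltr0_norm ?subr_lt0// lerN2 lerD2r ltW.
Qed.

Lemma powR_subadd a b delta : 0 <= a -> 0 <= b -> 0 < delta <= 1 ->
  (a + b) `^ delta <= a `^ delta + b `^ delta.
Proof.
move=> a0 b0 /andP[d0 d1].
have [ab0|ab0] := eqVneq (a + b) 0.
  by rewrite ab0 powR0 ?gt_eqF// addr_ge0// powR_ge0.
have {}ab0 : 0 < a + b by rewrite lt_def ab0 addr_ge0.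
have h u : 0 <= u -> u <= a + b -> u / (a + b) * (a + b) `^ delta <= u `^ delta.
  move=> u0 uab; have [->|un0] := eqVneq u 0.
    by rewrite !mul0r powR_ge0.
  have ugt0 : 0 < u by rewrite lt_def un0.
  have u1 : 0 < u / (a + b) <= 1 by rewrite divr_gt0//= ler_pdivrMr// mul1r.
  rewrite -[in leRHS](@divfK _ (a + b) _ u) ?gt_eqF// powRM ?(ltW ab0)//; last first.
    by case/andP : u1 => /ltW.
  by rewrite ler_wpM2r ?powR_ge0//; exact: ger1_powR.
have := lerD (h a a0 _) (h b b0 _); rewrite -mulrDl -mulrDl divff ?gt_eqF// mul1r.
by apply; rewrite ?lerDl ?lerDr.
Qed.

(** The supporting line at the midpoint, added over both endpoints. *)
Lemma powR_convex2 a b p : 0 <= a -> 0 <= b -> 1 <= p ->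
  (a + b) `^ p <= 2 `^ (p - 1) * (a `^ p + b `^ p).
Proof.
move=> a0 b0 p1.
have m0 : 0 <= (a + b) / 2 by rewrite divr_ge0// addr_ge0.
have ha := powR_tangent a0 m0 p1; have hb := powR_tangent b0 m0 p1.
have := lerD ha hb.
set m := _ `^ p; set t := p * _.
rewrite addrACA -mulrDr (_ : a - (a + b) / 2 + (b - (a + b) / 2) = 0); last by field.
rewrite mulr0 addr0 => h.
have -> : (a + b) `^ p = 2 `^ p * m by rewrite -powRM//; congr powR; field.
have -> : 2 `^ p = 2 `^ (p - 1) * 2 :> R.
  by rewrite mulrC mulr_powRB1// (lt_le_trans ltr01).
rewrite -mulrA ler_wpM2l ?powR_ge0//; lra.
Qed.

(** Cauchy's mean value theorem against the square (y - x)^2; a cruder integration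
    of the bound on [df] would lose the factor 1/2. *)
Lemma second_order_remainder f df q K x y :
  (forall x, is_derive x 1 f (df x)) ->
  (forall c, `|c - x| <= `|y - x| ->
    `|df c - df x - 2 * q * (c - x)| <= K * `|c - x|) ->
  `|f y - f x - df x * (y - x) - q * (y - x) ^+ 2| <= K / 2 * (y - x) ^+ 2.
Proof.
move=> hf hK; have [->|xy] := eqVneq x y.
  by rewrite !subrr expr0n/= !mulr0 !subr0 normr0.
pose r t := f t - f x - df x * (t - x) - q * (t - x) ^+ 2.
pose dr t := df t - df x - 2 * q * (t - x).
(* the mean value theorem for r(t) (y - x)^2 - r(y) (t - x)^2, null at x and y *)
pose g t := r t * (y - x) ^+ 2 - r y * (t - x) ^+ 2.
pose dg t := dr t * (y - x) ^+ 2 - r y * (2 * (t - x)).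
have hg (t : R) : is_derive t 1 g (dg t).
  have ht := hf t.
  rewrite /g /r; apply: is_derive_eq.
  by rewrite /dg /dr /r /GRing.scale/=; ring.
have [c [e cx cxy]] := mean_value hg xy.
have ry : r y * (2 * (c - x)) = dr c * (y - x) ^+ 2.
  apply/eqP; rewrite eq_sym -subr_eq0 -/(dg c).
  have : dg c * (y - x) = 0 by rewrite -e /g {3}/r; ring.
  have yx0 : y - x != 0 by rewrite subr_eq0 eq_sym.
  by move/eqP; rewrite mulf_eq0 (negbTE yx0) orbF.
have cx0 : 0 < `|c - x| by rewrite normr_gt0 subr_eq0.
rewrite -/(r y) -(ler_pM2r (_ : 0 < 2 * `|c - x|)); last by rewrite mulr_gt0.
have -> : `|r y| * (2 * `|c - x|) = `|dr c| * (y - x) ^+ 2.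
  rewrite -[in RHS](ger0_norm (sqr_ge0 (y - x))) -normrM -ry !normrM.
  by rewrite (ger0_norm (_ : 0 <= 2)).
apply: (@le_trans _ _ (K * `|c - x| * (y - x) ^+ 2)).
  by rewrite ler_wpM2r ?sqr_ge0//; exact: hK.
by rewrite le_eqVlt; apply/orP; left; apply/eqP; field.
Qed.

Variables (phi phi1 phi2 : R -> R) (L delta : R).
Hypothesis dphi : forall x, is_derive x 1 phi (phi1 x).
Hypothesis dphi1 : forall x, is_derive x 1 phi1 (phi2 x).
Hypothesis delta01 : 0 < delta <= 1.
Hypothesis L0 : 0 <= L.
Hypothesis hphi2 : forall x y, `|phi2 x - phi2 y| <= L * `|x - y| `^ delta.

Let d0 : 0 < delta. Proof. by case/andP : delta01. Qed.

Lemma taylor1_hoelder x y :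
  `|phi1 y - phi1 x - phi2 x * (y - x)| <= L * `|y - x| `^ (1 + delta).
Proof.
have [->|xy] := eqVneq x y.
  by rewrite !subrr mulr0 subr0 normr0 mulr_ge0// powR_ge0.
have [c [-> cx cxy]] := mean_value dphi1 xy.
rewrite -mulrBl normrM powRD; last first.
  by rewrite normr_eq0 subr_eq0 (eq_sym y) xy implybT.
rewrite powRr1// mulrCA mulrC ler_wpM2l//.
apply: le_trans (hphi2 c x) _; rewrite ler_wpM2l//.
by apply: ler_powRl => //; exact: ltW.
Qed.

Lemma taylor2_hoelder x y :
  `|phi y - phi x - phi1 x * (y - x) - phi2 x / 2 * (y - x) ^+ 2| <=
  L / 2 * `|y - x| `^ (2 + delta).
Proof.
have -> : L / 2 * `|y - x| `^ (2 + delta) = L * `|y - x| `^ delta / 2 * (y - x) ^+ 2.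
  rewrite powRD ?pnatr_eq0; last by rewrite gt_eqF// addr_gt0.
  rewrite (_ : `|y - x| `^ 2 = `|y - x| ^+ 2); last exact: powR_mulrn.
  by rewrite real_normK ?num_real//; field.
apply: second_order_remainder => // u uy.
have -> : phi1 u - phi1 x - 2 * (phi2 x / 2) * (u - x) =
    phi1 u - phi1 x - phi2 x * (u - x) by field.
apply: le_trans (taylor1_hoelder _ _) _.
have [->|ux] := eqVneq u x.
  by rewrite subrr normr0 powR0 ?mulr0// gt_eqF// addr_gt0.
rewrite powRD; last by rewrite normr_eq0 subr_eq0 ux implybT.
rewrite powRr1// -mulrA ler_wpM2l// mulrC ler_wpM2r//.
by apply: ler_powRl => //; exact: ltW.
Qed.

(** In this lemma and the two that follow, the error is split at an
    intermediate point z, as [conditional_taylor] requires. *)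
Lemma hoelder_split0 x y z :
  `|phi2 y - phi2 x - 0 * (y - x) - 0 * (y - x) ^+ 2| <=
  L * (`|y - z| `^ delta + `|z - x| `^ delta).
Proof.
rewrite !mul0r !subr0; apply: le_trans (hphi2 _ _) _; rewrite ler_wpM2l//.
have -> : y - x = (y - z) + (z - x) by ring.
apply: le_trans (powR_subadd _ _ delta01) => //.
by apply: ler_powRl; [exact: ltW| |exact: ler_normD].
Qed.

Lemma powR_norm_split p x y z : 1 <= p ->
  `|y - x| `^ p <= 2 `^ (p - 1) * (`|y - z| `^ p + `|z - x| `^ p).
Proof.
move=> p1; apply: le_trans (powR_convex2 _ _ p1) => //.
have -> : y - x = (y - z) + (z - x) by ring.
by apply: ler_powRl; [exact: le_trans p1| |exact: ler_normD].
Qed.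

Lemma taylor1_split x y z :
  `|phi1 y - phi1 x - phi2 x * (y - x) - 0 * (y - x) ^+ 2| <=
  L * 2 `^ delta * (`|y - z| `^ (1 + delta) + `|z - x| `^ (1 + delta)).
Proof.
rewrite mul0r subr0; apply: le_trans (taylor1_hoelder _ _) _.
rewrite -mulrA ler_wpM2l//.
have := @powR_norm_split (1 + delta) x y z; rewrite [_ + delta - 1]addrAC subrr add0r.
by apply; rewrite lerDl ltW.
Qed.

Lemma taylor2_split x y z :
  `|phi y - phi x - phi1 x * (y - x) - phi2 x / 2 * (y - x) ^+ 2| <=
  L * 2 `^ delta * (`|y - z| `^ (2 + delta) + `|z - x| `^ (2 + delta)).
Proof.
apply: le_trans (taylor2_hoelder _ _) _.
have -> : L * 2 `^ delta = L / 2 * 2 `^ (2 + delta - 1).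
  have -> : 2 + delta - 1 = 1 + delta by ring.
  by rewrite powRD ?pnatr_eq0 ?implybT// powRr1//; field.
rewrite -[leRHS]mulrA ler_wpM2l//; first by rewrite divr_ge0.
by apply: powR_norm_split; have := d0; lra.
Qed.

End taylor_hoelder.


(** * Conditional Taylor expansion *)

Section continuity_facts.
Context {R : realType}.

(** The point x = m is treated apart, because powers are differentiable only away
    from 0. *)
Lemma continuous_normr_powR (p m : R) : 0 < p ->
  continuous (fun x : R => `|m - x| `^ p).
Proof.
move=> p0 x; have [mx|mx] := eqVneq x m.
  rewrite /continuous_at mx subrr normr0 powR0 ?gt_eqF//.
  apply/cvgrPdist_lt => /= e e0.
  exists (e `^ p^-1); first by rewrite /= powR_gt0.
  move=> y /= my; rewrite sub0r normrN ger0_norm ?powR_ge0//.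
  rewrite -[ltRHS](@powRK _ _ p^-1^-1) ?(ltW e0)//; last by rewrite invrK gt_eqF.
  rewrite !invrK; apply: gt0_ltr_powR => //; rewrite nnegrE//.
  exact: powR_ge0.
apply: (@continuous_comp _ _ _ (fun x => `|m - x|) (fun a => a `^ p)).
  apply: (@continuous_comp _ _ _ (fun x => m - x) (@Num.norm R R)).
    by apply: cvgB; [exact: cvg_cst|exact: cvg_id].
  exact: norm_continuous.
apply/differentiable_continuous/derivable1_diffP/derivable_powR.
by rewrite in_itv/= andbT normr_gt0 subr_eq0 eq_sym.
Qed.

Lemma le_rat_continuous (f g : R -> R) : continuous f -> continuous g ->
  (forall q : rat, f (ratr q) <= g (ratr q)) -> forall x, f x <= g x.
Proof.
move=> cf cg fg x; rewrite leNgt; apply/negP => gfx.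
have o : open [set y | 0 < (f \- g) y].
  apply: (@open_comp _ _ (f \- g) [set y | 0 < y]); last exact: open_gt.
  by move=> y _; apply: cvgB; [exact: cf|exact: cg].
have [|y [/= fgy [q _ qy]]] := @dense_rat R _ _ o.
  by exists x; rewrite /= subr_gt0.
by move: fgy; rewrite -qy subr_gt0 ltNge fg.
Qed.

End continuity_facts.

Section conditional_taylor.
Context {d : measure_display} {Om : measurableType d} {R : realType}.
Variable P : probability Om R.
Variable G : set_system Om.
Hypothesis sG : sigma_algebra setT G.
Hypothesis GM : G `<=` measurable.

Local Notation Ex U := (Rintegral P setT U).
Local Notation Intg U := (P.-integrable setT (EFin \o U)).

Variables (c p C : R) (F M : Om -> R).
Hypothesis c0 : 0 < c.
Hypothesis c2 : c + c <= 1.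
Hypothesis p0 : 0 < p.
Hypothesis pc : p * c <= 1.
Hypothesis lF : Lr P c F.
Hypothesis cM : is_condexp P G F M.

Let D w := F w - M w.

Let c1 : c <= 1. Proof. by apply: le_trans c2; rewrite lerDl ltW. Qed.

Let lM : Lr P c M.
Proof. by have [] := Lr_condexp sG GM c0 c1 cM lF. Qed.

Let lD : Lr P c D. Proof. exact: LrB. Qed.

Let gM : gmeas G M. Proof. exact: is_condexp_gmeas cM. Qed.

Lemma condexp_residual0 : is_condexp P G D (fun=> 0).
Proof.
have iF := Lr_Intg c0 c1 lF; have iM := Lr_Intg c0 c1 lM.
have := is_condexpB sG GM iF iM cM (is_condexp_id sG GM gM iM).
by congr is_condexp; apply/funext => w; rewrite subrr.
Qed.

Let LrMx x : Lr P c (fun w => M w - x).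
Proof. by apply: LrB => //; exact: Lr_cst. Qed.

Let Intg2 (U V : Om -> R) : Lr P c U -> Lr P c V -> Intg (fun w => U w * V w).
Proof.
move=> lU lV; apply: (@Lr_Intg _ _ _ P (c + c)) => //; first exact: addr_gt0.
exact: LrM.
Qed.

Let IntgD2 : Intg (fun w => D w ^+ 2).
Proof. by apply: eq_Intg (Intg2 lD lD) => w; rewrite expr2. Qed.

Lemma condexp_sqr_shift S x : is_condexp P G (fun w => D w ^+ 2) S ->
  is_condexp P G (fun w => (F w - x) ^+ 2) (fun w => S w + (M w - x) ^+ 2).
Proof.
move=> cS.
have gx : gmeas G (fun w => M w - x) by apply: measurable_funB.
have iMx2 : Intg (fun w => (M w - x) ^+ 2).
  by apply: eq_Intg (Intg2 (LrMx x) (LrMx x)) => w; rewrite expr2.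
have g2 : gmeas G (fun w => (M w - x) ^+ 2) by exact: measurable_funX.
have iD := Lr_Intg c0 c1 lD.
have iDM := Intg2 lD (LrMx x).
have cDM : is_condexp P G (fun w => D w * (M w - x)) (fun w => 0 * (M w - x)).
  apply: is_condexpM => //; first exact: condexp_residual0.
  by apply: eq_Intg (Intg_cst P 0) => w; rewrite mul0r.
have := is_condexpD sG GM (IntgD IntgD2 (IntgZ 2 iDM)) iMx2
  (is_condexpD sG GM IntgD2 (IntgZ 2 iDM) cS (is_condexpZ sG GM 2 iDM cDM))
  (is_condexp_id sG GM g2 iMx2).
congr is_condexp; apply/funext => w; rewrite /D; ring.
Qed.

(** A countable family of almost sure statements holds on one null set. *)
Lemma ae_forall_rat (Q : rat -> Om -> Prop) :
  (forall q, {ae P, forall w, Q q w}) -> {ae P, forall w q, Q q w}.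
Proof.
move=> aeQ.
have h n : {ae P, forall w, if unpickle n is Some q then Q q w else True}.
  by case: (unpickle n) => [q|]; [exact: aeQ|exact: aeW].
have := ae_foralln h.
by apply: filterS => w hw q; have := hw (pickle q); rewrite pickleK.
Qed.

(** Integrating out one coordinate in a Taylor estimate around the random point F
    itself.  For each rational x, conditioning the estimate of [psi (F w)] around x
    bounds a quantity in which x occurs only through continuous functions; so the
    bound holds almost surely for all real x at once, in particular for x = F w.
    The intermediate point z of the hypothesis is E[F | G], which splits the error
    into |D|^p and a power of |E[F | G] - x|, equal to |D|^p at x = F. *)
Theorem conditional_taylor (psi k0 k1 k2 : R -> R) (N S Q : Om -> R) :
  continuous k0 -> continuous k1 -> continuous k2 -> 0 <= C ->
  (forall x y z, `|psi y - k0 x - k1 x * (y - x) - k2 x * (y - x) ^+ 2| <=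
                 C * (`|y - z| `^ p + `|z - x| `^ p)) ->
  Intg (psi \o F) -> is_condexp P G (psi \o F) N ->
  is_condexp P G (fun w => D w ^+ 2) S ->
  is_condexp P G (fun w => `|D w| `^ p) Q ->
  {ae P, forall w,
    `|k0 (F w) - N w - k1 (F w) * D w
      + k2 (F w) * (D w ^+ 2 + S w)| <= C * (`|D w| `^ p + Q w)}.
Proof.
move=> ck0 ck1 ck2 C0 hpsi iN cN cS cQ.
pose U x w := psi (F w) - k0 x - k1 x * (F w - x) - k2 x * (F w - x) ^+ 2.
pose V x w := N w - k0 x - k1 x * (M w - x) - k2 x * (S w + (M w - x) ^+ 2).
pose B x w := C * (`|D w| `^ p + `|M w - x| `^ p).
pose BC x w := C * (Q w + `|M w - x| `^ p).
have iF := Lr_Intg c0 c1 lF; have iM := Lr_Intg c0 c1 lM.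
have iFx2 x : Intg (fun w => (F w - x) ^+ 2).
  have lFx : Lr P c (fun w => F w - x) by apply: LrB => //; exact: Lr_cst.
  by apply: eq_Intg (Intg2 lFx lFx) => w; rewrite expr2.
have cst k : is_condexp P G (fun=> k) (fun=> k).
  by apply: is_condexp_id => //; [exact: measurable_cst|exact: Intg_cst].
have iU x : Intg (U x).
  apply: IntgB; last exact: IntgZ.
  apply: IntgB; last by apply: IntgZ; apply: IntgB => //; exact: Intg_cst.
  by apply: IntgB => //; exact: Intg_cst.
have cU x : is_condexp P G (U x) (V x).
  apply: is_condexpB => //.
  - apply: IntgB; last by apply: IntgZ; apply: IntgB => //; exact: Intg_cst.
    by apply: IntgB => //; exact: Intg_cst.
  - exact: IntgZ.
  - apply: is_condexpB => //.
    + by apply: IntgB => //; exact: Intg_cst.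
    + by apply: IntgZ; apply: IntgB => //; exact: Intg_cst.
    + by apply: is_condexpB => //; exact: Intg_cst.
    + apply: is_condexpZ => //; first by apply: IntgB => //; exact: Intg_cst.
      by apply: is_condexpB => //; exact: Intg_cst.
  - by apply: is_condexpZ => //; exact: condexp_sqr_shift.
have iDp : Intg (fun w => `|D w| `^ p).
  by apply: (@Lr_Intg _ _ _ P (p * c)) => //; [exact: mulr_gt0|exact: Lr_powR].
have iMp x : Intg (fun w => `|M w - x| `^ p).
  by apply: (@Lr_Intg _ _ _ P (p * c)) => //; [exact: mulr_gt0|exact: Lr_powR].
have iB x : Intg (B x) by apply: IntgZ; exact: IntgD.
have cB x : is_condexp P G (B x) (BC x).
  apply: is_condexpZ => //; first exact: IntgD.
  apply: is_condexpD => //; apply: is_condexp_id => //.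
  apply: (measurableT_comp (measurable_powR p)).
  by apply: measurableT_comp => //; exact: measurable_funB.
have UB x w : `|U x w| <= B x w by exact: hpsi.
have VB x : {ae P, forall w, `|V x w| <= BC x w}.
  have le1 : {ae P, forall w, V x w <= BC x w}.
    apply: (is_condexp_le sG GM _ _ (cU x) (cB x)) => //.
    by apply: aeW => w; exact: le_trans (ler_norm _) (UB x w).
  have le2 : {ae P, forall w, -1 * BC x w <= V x w}.
    apply: (is_condexp_le sG GM _ _ (is_condexpZ sG GM (-1) (iB x) (cB x)) (cU x)) => //.
      exact: IntgZ.
    by apply: aeW => w; rewrite mulN1r; have := UB x w; rewrite ler_norml => /andP[].
  apply: filterS2 le1 le2 => w h1 h2.
  by rewrite ler_norml h1 andbT -mulN1r.
have := ae_forall_rat (fun q => VB (ratr q)); apply: filterS => w hw.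
have cMx : continuous (fun x => M w - x).
  by move=> x; apply: cvgB; [exact: cvg_cst|exact: cvg_id].
have hx : forall x, `|V x w| <= BC x w.
  apply: (@le_rat_continuous _ (fun x => `|V x w|) (fun x => BC x w)) => //.
    move=> x; apply: cvg_norm; apply: cvgB; [apply: cvgB|].
    - by apply: cvgB; [exact: cvg_cst|exact: ck0].
    - by apply: cvgM; [exact: ck1|exact: cMx].
    - apply: cvgM; first exact: ck2.
      apply: cvgD; first exact: cvg_cst.
      by rewrite expr2; under eq_fun do rewrite expr2; apply: cvgM; exact: cMx.
  move=> x; apply: cvgM; first exact: cvg_cst.
  by apply: cvgD; [exact: cvg_cst|exact: continuous_normr_powR].
have := hx (F w); rewrite /BC (distrC (M w)) -/(D w) (addrC (Q w)) -(normrN (V _ _)).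
by congr (`|_| <= _); rewrite /V /D; ring.
Qed.

End conditional_taylor.


(** * Expansion of the Stein expectation *)

Section stein_expansion.
Context {d d' : measure_display} {Om : measurableType d}
  {T : measurableType d'} {R : realType}.
Variables (P : probability Om R) (n : nat) (X : 'I_n -> {RV P >-> T}).
Hypothesis indepX : mutually_independent X.

Local Notation Ex U := (Rintegral P setT U).
Local Notation Intg U := (P.-integrable setT (EFin \o U)).

(** The two sums are passed through equations, so that covariance identities can be
    substituted without rewriting inside large expressions. *)
Lemma sum_Ex_remainder (C SA SB : R) (A B Y Z : 'I_n -> Om -> R) :
  SA = \sum_(k < n) Ex (fun w => A k w * Z k w) ->
  SB = \sum_(k < n) Ex (fun w => B k w * Z k w) ->
  (forall k, Intg (fun w => A k w * Z k w)) ->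
  (forall k, Intg (fun w => B k w * Z k w)) ->
  (forall k, Intg (fun w => Y k w * `|Z k w|)) ->
  (forall k, {ae P, forall w, `|A k w - B k w| <= C * Y k w}) ->
  `|SA - SB| <= C * \sum_(k < n) Ex (fun w => Y k w * `|Z k w|).
Proof.
move=> -> -> iA iB iY AB; rewrite -sumrB mulr_sumr.
apply: le_trans (ler_norm_sum _ _ _) _; apply: ler_sum => k _.
rewrite -ExB// -ExZ//.
have iAB : Intg (fun w => A k w * Z k w - B k w * Z k w) by exact: IntgB.
apply: le_trans (norm_Ex iAB) _; apply: le_Ex => //.
- exact: Intg_norm.
- exact: IntgZ.
- apply: filterS (AB k) => w h.
  by rewrite -mulrBl normrM mulrA ler_wpM2r.
Qed.

Variables (delta c : R) (F : Om -> R).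
Hypothesis delta01 : 0 < delta <= 1.
Hypothesis c0 : 0 < c.
Hypothesis cE : (3 + delta) * c = 1.
Hypothesis lF : Lr P c F.
Hypothesis gF : gmeas (sigma_of X predT) F.
Hypothesis EF0 : Ex F = 0.
Variables (al be ga : R).

Let d0 : 0 < delta. Proof. by case/andP : delta01. Qed.
Let d1 : delta <= 1. Proof. by case/andP : delta01. Qed.
Let dc0 : 0 < delta * c. Proof. exact: mulr_gt0. Qed.
Let c3 : c + c + c <= 1. Proof. by have := cE; have := dc0; lra. Qed.
Let c2 : c + c <= 1. Proof. by have := c3; have := c0; lra. Qed.
Let c1 : c <= 1. Proof. by have := c3; have := c0; lra. Qed.
Let c20 : 0 < c + c. Proof. exact: addr_gt0. Qed.
Let c30 : 0 < c + c + c. Proof. exact: addr_gt0. Qed.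

Let D k := Ddiff X k F.
Let Za := Zalpha X al F.
Let Zab := Zalphabeta X al be F.
Let sqrD k := Eout X k (fun w => `|D k w| ^+ 2).

Lemma Lr_DF k : Lr P c (D k). Proof. exact: Lr_Ddiff. Qed.

Lemma Lr_DaF k : Lr P c (Dalpha X al k F). Proof. exact: Lr_Dalpha. Qed.

Lemma Lr_Za : Lr P (c + c) Za.
Proof.
by apply: Lr_sum => // k; apply: LrM => //; [exact: Lr_DF|exact: Lr_DaF].
Qed.

Lemma Lr_DZa k : Lr P (c + c) (Dalpha X be k Za).
Proof. by apply: Lr_Dalpha => //; exact: Lr_Za. Qed.

Lemma Lr_sqrD k : Lr P (c + c) (fun w => `|D k w| ^+ 2).
Proof.
under eq_fun do rewrite expr2.
by apply: LrM => //; apply: Lr_norm; exact: Lr_DF.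
Qed.

Lemma Lr_second k : Lr P (c + c) (fun w => `|D k w| ^+ 2 + sqrD k w).
Proof.
by apply: LrD => //; [exact: Lr_sqrD|apply: Lr_Eout => //; exact: Lr_sqrD].
Qed.

Lemma Lr_Zab : Lr P (c + c + c) Zab.
Proof.
apply: LrB => //.
  apply: Lr_sum => // k; rewrite addrC addrA.
  by rewrite -addrA; apply: LrM => //; [exact: Lr_DF|exact: Lr_DZa].
apply: LrZ; apply: Lr_sum => // k.
by apply: LrM => //; [exact: Lr_second|exact: Lr_DaF].
Qed.

Lemma Lr_DZab k : Lr P (c + c + c) (Dalpha X ga k Zab).
Proof. by apply: Lr_Dalpha => //; exact: Lr_Zab. Qed.

Lemma Lr_absD p k : 0 < p -> p * c <= 1 -> Lr P (p * c) (absD_plus_E X p k F).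
Proof.
move=> p0 pc; have pc0 : 0 < p * c by exact: mulr_gt0.
have h : Lr P (p * c) (fun w => `|Ddiff X k F w| `^ p).
  by apply: Lr_powR => //; exact: Lr_DF.
by apply: LrD => //; exact: Lr_Eout.
Qed.

Lemma Intg_absD p t k Z : 0 < p -> 0 < t -> p * c + t <= 1 -> Lr P t Z ->
  Intg (fun w => absD_plus_E X p k F w * `|Z w|).
Proof.
move=> p0 t0 pt lZ; have pc0 : 0 < p * c by exact: mulr_gt0.
apply: (Intg_mul pc0 t0) => //; last exact: Lr_norm.
by apply: Lr_absD => //; apply: le_trans pt; rewrite lerDl ltW.
Qed.

(** [conditional_taylor] for the coordinates other than k; the conditional second
    moment of D_k F is the E_k |D_k F|^2 of the definition of Z^(alpha,beta). *)
Lemma Ddiff_expansion k p C t (psi k1 k2 : R -> R) :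
  0 < p -> p * c <= 1 -> 0 < t -> t <= 1 -> 0 <= C ->
  continuous psi -> continuous k1 -> continuous k2 ->
  (forall x y z, `|psi y - psi x - k1 x * (y - x) - k2 x * (y - x) ^+ 2| <=
                 C * (`|y - z| `^ p + `|z - x| `^ p)) ->
  Lr P t (psi \o F) ->
  {ae P, forall w, `|Ddiff X k (psi \o F) w -
     (k1 (F w) * D k w - k2 (F w) * (`|D k w| ^+ 2 + sqrD k w))| <=
     C * absD_plus_E X p k F w}.
Proof.
move=> p0 pc t0 t1 C0 cpsi ck1 ck2 hpsi lpsi.
have pc0 : 0 < p * c by exact: mulr_gt0.
have sE : (fun w => (F w - Eout X k F w) ^+ 2) = (fun w => `|D k w| ^+ 2).
  by apply/funext => w; rewrite real_normK// num_real.
have iF := Lr_Intg c0 c1 lF.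
have ipsi := Lr_Intg t0 t1 lpsi.
have := @conditional_taylor _ _ _ P _ (sigma_of_sigma X (fun j => j != k))
  (@sigma_of_measurable _ _ _ _ _ _ _ X _) c p C F (Eout X k F) c0 c2 p0 pc lF
  (ceP X _ iF) psi psi k1 k2 (Eout X k (psi \o F)) (sqrD k)
  (Eout X k (fun w => `|D k w| `^ p)) cpsi ck1 ck2 C0 hpsi ipsi (ceP X _ ipsi).
rewrite sE.
case.
- by apply: ceP; exact: (Lr_Intg c20 c2 (Lr_sqrD k)).
- by apply: ceP; apply: (Lr_Intg pc0 pc); apply: Lr_powR => //; exact: Lr_DF.
move=> A [mA A0 hA]; exists A; split => // w hw; apply: hA => /=.
apply: contra_not hw => /=.
rewrite (_ : (F w - Eout X k F w) ^+ 2 = `|D k w| ^+ 2); last first.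
  by rewrite real_normK// num_real.
rewrite /Ddiff/= => h.
rewrite (_ : _ - (_ - _) = psi (F w) - Eout X k (psi \o F) w -
  k1 (F w) * (F w - Eout X k F w) + k2 (F w) * (`|D k w| ^+ 2 + sqrD k w))//.
rewrite /D /Ddiff; ring.
Qed.

Section test_function.
Variables (phi phi1 phi2 : R -> R) (L K : R).
Hypothesis dphi : forall x : R, is_derive x 1 phi (phi1 x).
Hypothesis dphi1 : forall x : R, is_derive x 1 phi1 (phi2 x).
Hypothesis cphi2 : continuous phi2.
Hypothesis phi2K : forall x, `|phi2 x| <= K.
Hypothesis L0 : 0 <= L.
Hypothesis hphi2 : forall x y, `|phi2 x - phi2 y| <= L * `|x - y| `^ delta.

Let cphi : continuous phi. Proof. exact: is_derive_continuous dphi. Qed.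
Let cphi1 : continuous phi1. Proof. exact: is_derive_continuous dphi1. Qed.

Let gcomp (psi : R -> R) : continuous psi -> gmeas (sigma_of X predT) (psi \o F).
Proof.
move=> cpsi; apply: measurableT_comp gF.
exact: continuous_measurable_fun.
Qed.

Let mcomp (psi : R -> R) : continuous psi -> measurable_fun setT (psi \o F).
Proof.
move=> cpsi; apply: gmeas_meas (gcomp cpsi); first exact: sigma_of_sigma.
exact: sigma_of_measurable.
Qed.

Lemma Lr_phi2 s : 0 < s -> Lr P s (phi2 \o F).
Proof. by move=> s0; apply: (@Lr_bdd _ _ _ _ _ _ K s0 (mcomp cphi2)) => w; exact: phi2K. Qed.

Lemma phi1_growth x : `|phi1 x| <= `|phi1 0| + K * `|x|.
Proof.
have [<-|x0] := eqVneq 0 x; first by rewrite normr0 mulr0 addr0.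
have [z [e _ _]] := mean_value dphi1 x0.
have -> : phi1 x = phi1 0 + phi2 z * x by rewrite -[in RHS](subr0 x) -e addrCA subrr addr0.
by rewrite (le_trans (ler_normD _ _))// lerD2l normrM ler_wpM2r.
Qed.

Lemma phi_growth x : `|phi x| <= `|phi 0| + `|phi1 0| * `|x| + K * `|x| ^+ 2.
Proof.
have [<-|x0] := eqVneq 0 x.
  by rewrite normr0 mulr0 expr0n/= mulr0 !addr0.
have [z [e _ zx]] := mean_value dphi x0.
rewrite !subr0 in e zx.
have -> : phi x = phi 0 + phi1 z * x by rewrite -e addrCA subrr addr0.
rewrite (le_trans (ler_normD _ _))// -addrA lerD2l normrM.
have -> : `|phi1 0| * `|x| + K * `|x| ^+ 2 = (`|phi1 0| + K * `|x|) * `|x| by ring.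
rewrite ler_wpM2r// (le_trans (phi1_growth z))// lerD2l ler_wpM2l//.
exact: le_trans (phi2K 0).
Qed.

Lemma Lr_phi1 : Lr P c (phi1 \o F).
Proof.
apply: (@Lr_le _ _ _ P c _ (fun w => `|phi1 0| + K * `|F w|)) => //.
- exact: mcomp.
- by move=> w; rewrite (le_trans (phi1_growth _))// ler_norm.
- by apply: LrD => //; [exact: Lr_cst|apply: LrZ; exact: Lr_norm].
Qed.

Lemma Lr_phi : Lr P (c + c) (phi \o F).
Proof.
apply: (@Lr_le _ _ _ P (c + c) _
  (fun w => `|phi 0| + `|phi1 0| * `|F w| + K * (`|F w| * `|F w|))) => //.
- exact: mcomp.
- by move=> w; rewrite (le_trans (phi_growth _))// expr2 ler_norm.
- apply: LrD => //; last by apply: LrZ; apply: LrM => //; exact: Lr_norm.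
  apply: LrD => //; first exact: Lr_cst.
  apply: LrZ; apply: Lr_norm; apply: (Lr_sub c0 _ lF).
  by rewrite lerDl ltW.
Qed.

(** The sums of the first bound.  The index j is the integer part of the exponent
    j + delta: [err2], [err1], [err0] control the expansions of phi, phi' and
    phi''. *)
Definition err2 := \sum_(k < n)
  Ex (fun w => absD_plus_E X (2 + delta) k F w * `|Dalpha X al k F w|).
Definition err1 := \sum_(k < n)
  Ex (fun w => absD_plus_E X (1 + delta) k F w * `|Dalpha X be k Za w|).
Definition err0 := \sum_(k < n)
  Ex (fun w => absD_plus_E X delta k F w * `|Dalpha X ga k Zab w|).

(** The covariance identity for U = V = F: the mean of Z^(alpha) is the variance. *)
Lemma Ex_Za : Ex Za = Ex (fun w => F w * F w).
Proof.
have := covariance_Dalpha indepX al c0 c0 c2 gF lF lF.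
rewrite EF0 mulr0 subr0 => ->.
rewrite /Za /Zalpha Ex_sum// => k.
by apply: (Intg_mul c0 c0) => //; [exact: Lr_DF|exact: Lr_DaF].
Qed.

Let LrD_phi2 s k Z : 0 < s -> Lr P s Z -> Lr P (c + s) (fun w => phi2 (F w) * D k w * Z w).
Proof.
move=> s0 lZ; apply: LrM => //.
by apply: (LrM_bdd c0 (mcomp cphi2) (fun w => phi2K (F w))); exact: Lr_DF.
Qed.

Let Intg_phi2M s U : 0 < s -> s <= 1 -> Lr P s U -> Intg (fun w => phi2 (F w) * U w).
Proof.
move=> s0 s1 lU; apply: (Lr_Intg s0 s1).
exact: (LrM_bdd s0 (mcomp cphi2) (fun w => phi2K (F w))).
Qed.

Lemma Ex_phi2_Zab : Ex (fun w => phi2 (F w) * Zab w) =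
  \sum_(k < n) Ex (fun w => phi2 (F w) * D k w * Dalpha X be k Za w) -
  \sum_(k < n) Ex (fun w => phi2 (F w) / 2 * (`|D k w| ^+ 2 + sqrD k w) * Dalpha X al k F w).
Proof.
pose A k w := phi2 (F w) * D k w * Dalpha X be k Za w.
pose B k w := phi2 (F w) / 2 * (`|D k w| ^+ 2 + sqrD k w) * Dalpha X al k F w.
have iA k : Intg (A k).
  apply: (@Lr_Intg _ _ _ P (c + (c + c))); rewrite ?addrA//.
  by rewrite -addrA; apply: LrD_phi2 => //; exact: Lr_DZa.
have iB k : Intg (B k).
  have := Intg_phi2M c30 c3 (LrM c20 c0 (Lr_second k) (Lr_DaF k)).
  by move/(IntgZ 2^-1); apply: eq_Intg => w; rewrite /B mulrA (mulrC 2^-1) !mulrA.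
transitivity (Ex (fun w => \sum_(k < n) A k w - \sum_(k < n) B k w)).
  apply: eq_Ex => w; rewrite /Zab /Zalphabeta mulrBr; congr (_ - _).
    by rewrite mulr_sumr; apply: eq_bigr => k _; rewrite /A mulrA.
  by rewrite mulrA mulr_sumr; apply: eq_bigr => k _; rewrite /B !mulrA.
rewrite ExB; [|exact: Intg_sum iA|exact: Intg_sum iB].
congr (_ - _).
  exact: (Ex_sum (index_enum _) xpredT iA).
exact: (Ex_sum (index_enum _) xpredT iB).
Qed.

(** The covariance identity, used for phi(F) and F, then for phi'(F) and
    Z^(alpha); the second-order term of the first use completes Z^(alpha,beta). *)
Lemma expansion_order2 :
  `|Ex (fun w => phi (F w) * F w) - Ex (fun w => F w * F w) * Ex (phi1 \o F)
    - Ex (fun w => phi2 (F w) * Zab w)| <= L * 2 `^ delta * (err2 + err1).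
Proof.
have C0 : 0 <= L * 2 `^ delta by rewrite mulr_ge0// powR_ge0.
have c2c : c + c + c <= 1 := c3.
have c1' : c + (c + c) <= 1 by rewrite addrA.
have cov1 := covariance_Dalpha indepX al c20 c0 c2c (gcomp cphi) Lr_phi lF.
rewrite EF0 mulr0 subr0 in cov1.
have p2 : 0 < 2 + delta by rewrite addr_gt0.
have p2c : (2 + delta) * c + c <= 1 by have := cE; lra.
have p2c' : (2 + delta) * c <= 1 by have := p2c; have := c0; lra.
have p1 : 0 < 1 + delta by rewrite addr_gt0.
have p1c : (1 + delta) * c + (c + c) <= 1 by have := cE; lra.
have p1c' : (1 + delta) * c <= 1 by have := p1c; have := c0; lra.
have cphi22 : continuous (fun x => phi2 x / 2).
  by move=> x; apply: cvgM; [exact: cphi2|exact: cvg_cst].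
have ae1 k := Ddiff_expansion k p2 p2c' c20 c2 C0 cphi cphi1 cphi22
  (taylor2_split dphi dphi1 delta01 L0 hphi2) Lr_phi.
pose T1 k w := phi1 (F w) * D k w - phi2 (F w) / 2 * (`|D k w| ^+ 2 + sqrD k w).
have iphi1 k : Intg (fun w => phi1 (F w) * D k w * Dalpha X al k F w).
  apply: (@Lr_Intg _ _ _ P (c + c + c)) => //.
  by apply: LrM => //; [apply: LrM => //; [exact: Lr_phi1|exact: Lr_DF]|exact: Lr_DaF].
have iphi2 k : Intg (fun w => phi2 (F w) / 2 * (`|D k w| ^+ 2 + sqrD k w) * Dalpha X al k F w).
  have := Intg_phi2M c30 c3 (LrM c20 c0 (Lr_second k) (Lr_DaF k)).
  by move/(IntgZ 2^-1); apply: eq_Intg => w; rewrite mulrA (mulrC 2^-1) !mulrA.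
pose S2 := \sum_(k < n) Ex (fun w => phi2 (F w) / 2 * (`|D k w| ^+ 2 + sqrD k w) * Dalpha X al k F w).
have s1 : \sum_(k < n) Ex (fun w => T1 k w * Dalpha X al k F w) =
    Ex (fun w => phi1 (F w) * Za w) -
    S2.
  rewrite (_ : Ex (fun w => phi1 (F w) * Za w) =
     \sum_(k < n) Ex (fun w => phi1 (F w) * D k w * Dalpha X al k F w)); last first.
    transitivity (Ex (fun w => \sum_(k < n) phi1 (F w) * D k w * Dalpha X al k F w)).
      apply: eq_Ex => w; rewrite /Za /Zalpha mulr_sumr.
      by apply: eq_bigr => k _; rewrite mulrA.
    exact: (Ex_sum (index_enum _) xpredT iphi1).
  rewrite -sumrB; apply: eq_bigr => k _; rewrite -ExB//.
  by apply: eq_Ex => w; rewrite mulrBl.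
have e1 : `|Ex (fun w => phi (F w) * F w) - (Ex (fun w => phi1 (F w) * Za w) - S2)| <=
    L * 2 `^ delta * err2.
  apply: (sum_Ex_remainder cov1 (esym s1) _ _ _ ae1).
  - move=> k; apply: (Intg_mul c20 c0) => //; last exact: Lr_DaF.
    by apply: Lr_Ddiff => //; exact: Lr_phi.
  - by move=> k; apply: eq_Intg (IntgB (iphi1 k) (iphi2 k)) => w; rewrite mulrBl.
  - by move=> k; apply: (Intg_absD _ p2 c0 p2c); exact: Lr_DaF.
have cov2 := covariance_Dalpha indepX be c0 c20 c1' (gcomp cphi1) Lr_phi1 Lr_Za.
rewrite Ex_Za in cov2.
have czero : continuous (fun _ : R => 0 : R) by move=> x; exact: cvg_cst.
have ae2 k := Ddiff_expansion k p1 p1c' c0 c1 C0 cphi1 cphi2 czero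
  (taylor1_split dphi1 delta01 L0 hphi2) Lr_phi1.
pose S1 := \sum_(k < n) Ex (fun w => phi2 (F w) * D k w * Dalpha X be k Za w).
have e2 : `|Ex (fun w => phi1 (F w) * Za w) - Ex (phi1 \o F) * Ex (fun w => F w * F w) - S1|
    <= L * 2 `^ delta * err1.
  apply: (sum_Ex_remainder cov2 (erefl S1)).
  - move=> k; apply: (Intg_mul c0 c20) => //; last exact: Lr_DZa.
    by apply: Lr_Ddiff => //; exact: Lr_phi1.
  - move=> k; apply: (@Lr_Intg _ _ _ P (c + (c + c))) => //; first by rewrite addr_gt0.
    by apply: LrD_phi2 => //; exact: Lr_DZa.
  - by move=> k; apply: (Intg_absD _ p1 c20 p1c); exact: Lr_DZa.
  - by move=> k; apply: filterS (ae2 k) => w; rewrite mul0r subr0.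
have e3 : Ex (fun w => phi2 (F w) * Zab w) = S1 - S2 by exact: Ex_phi2_Zab.
rewrite e3 mulrDr; apply: le_trans (lerD e1 e2); apply: le_trans (ler_normD _ _).
by rewrite le_eqVlt; apply/orP; left; apply/eqP; congr `|_|; ring.
Qed.

(** Since Z^(alpha,beta) is centered, E[phi''(F) Z^(alpha,beta)] is a covariance. *)
Lemma stein_expansion : Ex Zab = 0 ->
  `|Ex (fun w => phi (F w) * F w) - Ex (fun w => F w * F w) * Ex (phi1 \o F)| <=
  L * err0 + L * 2 `^ delta * err1 + L * 2 `^ delta * err2.
Proof.
move=> EZ.
have s : delta * c + (c + c + c) <= 1 by have := cE; lra.
have cov := covariance_Dalpha indepX ga dc0 c30 s (gcomp cphi2) (Lr_phi2 dc0) Lr_Zab.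
rewrite EZ mulr0 subr0 in cov.
have dc1 : delta * c <= 1 by have := s; have := c30; lra.
have czero : continuous (fun _ : R => 0 : R) by move=> x; exact: cvg_cst.
have ae k := Ddiff_expansion k d0 dc1 dc0 dc1 L0 cphi2 czero czero
  (hoelder_split0 delta01 L0 hphi2) (Lr_phi2 dc0).
have z : 0 = \sum_(k < n) Ex (fun w => 0 * Dalpha X ga k Zab w).
  by rewrite big1// => k _; under eq_Ex do rewrite mul0r; rewrite Ex_cst.
have e : `|Ex (fun w => phi2 (F w) * Zab w) - 0| <= L * err0.
  apply: (sum_Ex_remainder (B := fun _ _ => 0) cov z).
  - move=> k; apply: (Intg_mul dc0 c30) => //; last exact: Lr_DZab.
    by apply: Lr_Ddiff => //; exact: Lr_phi2.
  - by move=> k; apply: eq_Intg (Intg_cst P 0) => w; rewrite mul0r.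
  - by move=> k; apply: (Intg_absD _ d0 c30 s); exact: Lr_DZab.
  - by move=> k; apply: filterS (ae k) => w; rewrite !mul0r subr0.
rewrite subr0 in e.
have := lerD expansion_order2 e; rewrite mulrDr => h.
apply: (@le_trans _ _ (L * 2 `^ delta * err2 + L * 2 `^ delta * err1 + L * err0)); last first.
  by rewrite le_eqVlt; apply/orP; left; apply/eqP; ring.
apply: le_trans h; apply: le_trans (ler_normD _ _).
by rewrite subrK.
Qed.

End test_function.

(** [expansion_order2] is exact for phi(x) = x^2/2, and then reads
    E[F^3] / 2 = s^2 E[F] + E[Z^(alpha,beta)]. *)
Lemma Ex_Zab : Ex (fun w => F w ^+ 3) = 0 -> Ex Zab = 0.
Proof.
move=> EF3.
have dphi (x : R) : is_derive x 1 (fun x : R => x ^+ 2 / 2) x.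
  by apply: is_derive_eq; rewrite /GRing.scale/=; field.
have dphi1 (x : R) : is_derive x 1 (fun x : R => x) 1 by exact: is_derive_id.
have cone : continuous (fun _ : R => 1 : R) by move=> x; exact: cvg_cst.
have := @expansion_order2 (fun x => x ^+ 2 / 2) id (fun=> 1) 0 1 dphi dphi1 cone.
have one_le (x : R) : `|1 : R| <= 1 by rewrite normr1.
have diff0 (x y : R) : `|1 - 1 : R| <= 0 * `|x - y| `^ delta.
  by rewrite subrr normr0 mul0r.
move=> /(_ one_le (lexx _) diff0).
rewrite !mul0r EF0 mulr0 subr0.
have -> : Ex (fun w => F w ^+ 2 / 2 * F w) = 0.
  have iF3 : Intg (fun w => F w ^+ 3).
    have := Lr_Intg c30 c3 (LrM c20 c0 (LrM c0 c0 lF lF) lF).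
    by apply: eq_Intg => w; rewrite -expr2 -exprSr.
  rewrite -[RHS](mulr0 2^-1) -EF3 -ExZ//; apply: eq_Ex => w; by field.
rewrite sub0r normrN normr_le0 => /eqP <-.
by apply: eq_Ex => w; rewrite mul1r.
Qed.

End stein_expansion.


(** * Moment bounds *)

Section hoelder_for_sums.
Context {d : measure_display} {Om : measurableType d} {R : realType}.
Variable P : probability Om R.

Local Notation Ex U := (Rintegral P setT U).
Local Notation Intg U := (P.-integrable setT (EFin \o U)).

Lemma weighted_AMGM (x y s t : R) : 0 <= x -> 0 <= y -> 0 < s -> 0 < t -> s + t = 1 ->
  x `^ s * y `^ t <= s * x + t * y.
Proof.
move=> x0 y0 s0 t0 st.
have := @conjugate_powR R (x `^ s) (y `^ t) s^-1 t^-1 (powR_ge0 _ _) (powR_ge0 _ _).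
rewrite !invr_gt0 !invrK => /(_ s0 t0 st).
by rewrite -!powRrM !divff ?gt_eqF// !powRr1// (mulrC x) (mulrC y).
Qed.

(** The form in which Young's inequality proves Hoelder's: A and B stand for the
    total masses. *)
Lemma weighted_AMGM_scaled (A B x y s t : R) : 0 < A -> 0 < B -> 0 <= x -> 0 <= y ->
  0 < s -> 0 < t -> s + t = 1 ->
  x `^ s * y `^ t <= A `^ s * B `^ t * (s / A * x + t / B * y).
Proof.
move=> A0 B0 x0 y0 s0 t0 st.
have xA : 0 <= x / A by rewrite divr_ge0// ltW.
have yB : 0 <= y / B by rewrite divr_ge0// ltW.
have -> : x `^ s * y `^ t = A `^ s * B `^ t * ((x / A) `^ s * (y / B) `^ t).
  rewrite mulrACA -(powRM _ (ltW A0) xA) -(powRM _ (ltW B0) yB).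
  by rewrite (mulrC A) (mulrC B) !divfK// gt_eqF.
rewrite ler_wpM2l ?mulr_ge0 ?powR_ge0//.
have -> : s / A * x = s * (x / A) by ring.
have -> : t / B * y = t * (y / B) by ring.
exact: weighted_AMGM.
Qed.

Variables (n : nat) (s t : R) (a b : 'I_n -> Om -> R).
Hypothesis s0 : 0 < s.
Hypothesis t0 : 0 < t.
Hypothesis st : s + t = 1.
Hypothesis a0 : forall k w, 0 <= a k w.
Hypothesis b0 : forall k w, 0 <= b k w.
Hypothesis ia : forall k, Intg (a k).
Hypothesis ib : forall k, Intg (b k).

Let m_ab k : measurable_fun setT (fun w => a k w `^ s * b k w `^ t).
Proof.
by apply: measurable_funM;
  [apply: (measurableT_comp (measurable_powR s)); exact: Intg_meas (ia k)
  |apply: (measurableT_comp (measurable_powR t)); exact: Intg_meas (ib k)].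
Qed.

Let i_ab k : Intg (fun w => a k w `^ s * b k w `^ t).
Proof.
apply: (Intg_le (m_ab k) _ (IntgD (IntgZ s (ia k)) (IntgZ t (ib k)))) => w.
rewrite !ger0_norm ?weighted_AMGM//.
  by rewrite addr_ge0// mulr_ge0// ltW.
by rewrite mulr_ge0// powR_ge0.
Qed.

Lemma sum_Ex_eq0 (u : 'I_n -> Om -> R) : (forall k w, 0 <= u k w) ->
  (forall k, Intg (u k)) -> \sum_(k < n) Ex (u k) = 0 ->
  forall k, {ae P, forall w, u k w = 0}.
Proof.
move=> u0 iu su k; apply: Ex_ge0_ae0 => //; first exact: aeW.
have E0 i : 0 <= Ex (u i) by apply: Ex_ge0 => //; exact: aeW.
exact: (psumr_eq0P (fun i _ => E0 i) su).
Qed.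

(** Hoelder's inequality for the product of the counting measure on the indices with
    P; if one of the total masses vanishes, so do all the integrands. *)
Lemma hoelder_sum : \sum_(k < n) Ex (fun w => a k w `^ s * b k w `^ t) <=
  (\sum_(k < n) Ex (a k)) `^ s * (\sum_(k < n) Ex (b k)) `^ t.
Proof.
set A := \sum_(k < n) Ex (a k); set B := \sum_(k < n) Ex (b k).
have A0 : 0 <= A by apply: sumr_ge0 => k _; apply: Ex_ge0 => //; exact: aeW.
have B0 : 0 <= B by apply: sumr_ge0 => k _; apply: Ex_ge0 => //; exact: aeW.
have zero : (forall k, {ae P, forall w, a k w `^ s * b k w `^ t = 0}) ->
    \sum_(k < n) Ex (fun w => a k w `^ s * b k w `^ t) <= A `^ s * B `^ t.
  move=> h; rewrite big1 ?mulr_ge0 ?powR_ge0// => k _.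
  by rewrite (@ae_eq_Ex _ _ _ P _ (fun=> 0))// Ex_cst.
have [A00|A00] := eqVneq A 0.
  apply: zero => k; apply: filterS (sum_Ex_eq0 a0 ia A00 k) => w ->.
  by rewrite powR0 ?mul0r// gt_eqF.
have [B00|B00] := eqVneq B 0.
  apply: zero => k; apply: filterS (sum_Ex_eq0 b0 ib B00 k) => w ->.
  by rewrite powR0 ?mulr0// gt_eqF.
have {}A0 : 0 < A by rewrite lt_def A00.
have {}B0 : 0 < B by rewrite lt_def B00.
(* Young's inequality after normalising both sums to one *)
have le k : Ex (fun w => a k w `^ s * b k w `^ t) <=
    A `^ s * B `^ t * (s / A * Ex (a k) + t / B * Ex (b k)).
  rewrite -(ExZ (s / A) (ia k)) -(ExZ (t / B) (ib k)).
  rewrite -(ExD (IntgZ _ (ia k)) (IntgZ _ (ib k))).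
  rewrite -ExZ; last by apply: IntgD; exact: IntgZ.
  apply: le_Ex => //.
    by apply: IntgZ; apply: IntgD; exact: IntgZ.
  apply: aeW => w.
  exact: weighted_AMGM_scaled.
apply: le_trans (ler_sum _ (fun k _ => le k)) _.
have sA : \sum_(k < n) (s / A * Ex (a k) + t / B * Ex (b k)) = 1.
  by rewrite big_split/= -!mulr_sumr !divfK.
by rewrite -mulr_sumr sA mulr1 lexx.
Qed.

End hoelder_for_sums.

Section moment_bound.
Context {d d' : measure_display} {Om : measurableType d}
  {T : measurableType d'} {R : realType}.
Variables (P : probability Om R) (n : nat) (X : 'I_n -> {RV P >-> T}).

Local Notation Ex U := (Rintegral P setT U).
Local Notation Intg U := (P.-integrable setT (EFin \o U)).

Lemma powR_convex_comb (u v a p : R) : 0 <= a <= 1 -> 1 <= p ->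
  `|a * u + (1 - a) * v| `^ p <= a * `|u| `^ p + (1 - a) * `|v| `^ p.
Proof.
move=> /andP[a0 a1] p1.
have a1' : 0 <= 1 - a by rewrite subr_ge0.
have m0 : 0 <= a * `|u| + (1 - a) * `|v| by rewrite addr_ge0// mulr_ge0.
apply: (@le_trans _ _ ((a * `|u| + (1 - a) * `|v|) `^ p)).
  apply: ler_powRl => //; first exact: le_trans p1.
  rewrite (le_trans (ler_normD _ _))// !normrM.
  by rewrite (ger0_norm a0) (ger0_norm a1').
have hu := ler_wpM2l a0 (powR_tangent (normr_ge0 u) m0 p1).
have hv := ler_wpM2l a1' (powR_tangent (normr_ge0 v) m0 p1).
apply: le_trans (lerD hu hv); rewrite le_eqVlt; apply/orP; left; apply/eqP.
ring.
Qed.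

(** Convexity in the weight [a], then Jensen's inequality for each of the two
    conditional expectations. *)
Lemma Ex_Dalpha_powR a t k V : 0 <= a <= 1 -> 0 < t -> t <= 1 -> Lr P t V ->
  Ex (fun w => `|Dalpha X a k V w| `^ t^-1) <= Ex (fun w => `|Ddiff X k V w| `^ t^-1).
Proof.
move=> a01 t0 t1 lV.
have /andP[a0 a1] := a01.
have p1 : 1 <= t^-1 by rewrite invf_ge1.
have lD := Lr_Ddiff X k t0 t1 lV.
have lp K := Lr_ce X K t0 t1 lD.
set C := Ex (fun w => `|Ddiff X k V w| `^ t^-1).
pose U1 := condexp P (past X k) (Ddiff X k V).
pose U2 := condexp P (future X k) (Ddiff X k V).
have h1 : Ex (fun w => `|U1 w| `^ t^-1) <= C by exact: Ex_ce_powR.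
have h2 : Ex (fun w => `|U2 w| `^ t^-1) <= C by exact: Ex_ce_powR.
have [_ i1] := lp (fun i : 'I_n => (i <= k)%N).
have [_ i2] := lp (fun i : 'I_n => (k <= i)%N).
have iU1 : Intg (fun w => `|U1 w| `^ t^-1) by exact: i1.
have iU2 : Intg (fun w => `|U2 w| `^ t^-1) by exact: i2.
apply: (@le_trans _ _ (a * Ex (fun w => `|U1 w| `^ t^-1)
                       + (1 - a) * Ex (fun w => `|U2 w| `^ t^-1))).
  rewrite -(ExZ a iU1) -(ExZ (1 - a) iU2) -(ExD (IntgZ _ iU1) (IntgZ _ iU2)).
  apply: le_Ex.
  - by have [] := Lr_Dalpha X a k t0 t1 lV.
  - exact: (IntgD (IntgZ _ iU1) (IntgZ _ iU2)).
  - by apply: aeW => w; exact: powR_convex_comb.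
have a1' : 0 <= 1 - a by rewrite subr_ge0.
have comb (u : R) : a * u + (1 - a) * u = u by ring.
apply: le_trans (lerD (ler_wpM2l a0 h1) (ler_wpM2l a1' h2)) _.
by rewrite comb lexx.
Qed.

(** The factor 2 comes from the two parts of |D_k F|^p + E_k |D_k F|^p, which obey
    the same bound by Jensen's inequality. *)
Lemma sum_absD_Dalpha_le a c p t F V : 0 <= a <= 1 ->
  0 < c -> 0 < p -> 0 < t -> c <= 1 -> p * c + t = 1 -> Lr P c F -> Lr P t V ->
  \sum_(k < n) Ex (fun w => absD_plus_E X p k F w * `|Dalpha X a k V w|) <=
  2 * ((\sum_(k < n) Ex (fun w => `|Ddiff X k F w| `^ c^-1)) `^ (p * c) *
       (\sum_(k < n) Ex (fun w => `|Ddiff X k V w| `^ t^-1)) `^ t).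
Proof.
move=> a01 c0 p0 t0 c1 pct lF lV.
have pc0 : 0 < p * c by exact: mulr_gt0.
have pc1 : p * c <= 1 by rewrite -pct lerDl ltW.
have t1 : t <= 1 by rewrite -pct lerDr ltW.
have pcn : p * c != 0 by rewrite gt_eqF.
have tn : t != 0 by rewrite gt_eqF.
have pct1 : p * c + t <= 1 by rewrite pct.
pose Q k := Eout X k (fun w => `|Ddiff X k F w| `^ p).
have lD k : Lr P c (Ddiff X k F) by exact: Lr_Ddiff.
have lDp k : Lr P (p * c) (fun w => `|Ddiff X k F w| `^ p) by exact: Lr_powR.
have lQ k : Lr P (p * c) (Q k) by exact: Lr_Eout.
have lZ k : Lr P t (Dalpha X a k V) by exact: Lr_Dalpha.
pose A := \sum_(k < n) Ex (fun w => `|Ddiff X k F w| `^ c^-1).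
pose B := \sum_(k < n) Ex (fun w => `|Ddiff X k V w| `^ t^-1).
have bound (U : 'I_n -> Om -> R) : (forall k, Lr P (p * c) (U k)) ->
    (forall k, Ex (fun w => `|U k w| `^ (p * c)^-1) <=
      Ex (fun w => `|Ddiff X k F w| `^ c^-1)) ->
    \sum_(k < n) Ex (fun w => `|U k w| * `|Dalpha X a k V w|) <=
    A `^ (p * c) * B `^ t.
  move=> lU UA.
  have hs := @hoelder_sum _ _ _ P n (p * c) t
    (fun k w => `|U k w| `^ (p * c)^-1) (fun k w => `|Dalpha X a k V w| `^ t^-1)
    pc0 t0 pct (fun k w => powR_ge0 _ _) (fun k w => powR_ge0 _ _)
    (fun k => (lU k).2) (fun k => (lZ k).2).
  apply: le_trans (le_trans _ hs) _.
    apply: ler_sum => k _; rewrite le_eqVlt; apply/orP; left; apply/eqP.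
    by apply: eq_Ex => w; rewrite !powRK.
  have ge0 (u : 'I_n -> Om -> R) r :
      0 <= \sum_(k < n) Ex (fun w => `|u k w| `^ r).
    by apply: sumr_ge0 => k _; apply: Rintegral_ge0 => w _; exact: powR_ge0.
  apply: (ler_pM (powR_ge0 _ _) (powR_ge0 _ _)).
    by apply: (ler_powRl (ltW pc0) (ge0 _ _)); apply: ler_sum => k _; exact: UA.
  apply: (ler_powRl (ltW t0) (ge0 _ _)); apply: ler_sum => k _.
  exact: Ex_Dalpha_powR.
have iDZ k : Intg (fun w => `| `|Ddiff X k F w| `^ p| * `|Dalpha X a k V w|).
  exact: (Intg_mul pc0 t0 pct1 (Lr_norm (lDp k)) (Lr_norm (lZ k))).
have iQZ k : Intg (fun w => `|Q k w| * `|Dalpha X a k V w|).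
  exact: (Intg_mul pc0 t0 pct1 (Lr_norm (lQ k)) (Lr_norm (lZ k))).
have bD : \sum_(k < n) Ex (fun w => `| `|Ddiff X k F w| `^ p| * `|Dalpha X a k V w|)
    <= A `^ (p * c) * B `^ t.
  apply: (bound _ lDp) => k; rewrite le_eqVlt; apply/orP; left; apply/eqP.
  apply: eq_Ex => w; rewrite (ger0_norm (powR_ge0 _ _)) -powRrM.
  by rewrite invfM mulrA divff ?gt_eqF// mul1r.
have bQ : \sum_(k < n) Ex (fun w => `|Q k w| * `|Dalpha X a k V w|)
    <= A `^ (p * c) * B `^ t.
  apply: (bound _ lQ) => k; apply: le_trans (Ex_ce_powR X _ pc0 pc1 (lDp k)) _.
  rewrite le_eqVlt; apply/orP; left; apply/eqP.
  apply: eq_Ex => w; rewrite (ger0_norm (powR_ge0 _ _)) -powRrM.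
  by rewrite invfM mulrA divff ?gt_eqF// mul1r.
have dbl (x : R) : 2 * x = x + x by ring.
rewrite dbl; apply: le_trans (lerD bD bQ); rewrite -big_split/=.
apply: ler_sum => k _; rewrite -(ExD (iDZ k) (iQZ k)); apply: le_Ex.
- exact: (Intg_mul pc0 t0 pct1 (LrD pc0 (lDp k) (lQ k)) (Lr_norm (lZ k))).
- exact: IntgD (iDZ k) (iQZ k).
- apply: aeW => w; rewrite -mulrDl ler_wpM2r// /absD_plus_E.
  by apply: lerD; exact: ler_norm.
Qed.

End moment_bound.


(** * A priori bounds for the Stein equation *)

Section stein_ode.
Context {R : realType}.
Implicit Types (f H psi : R -> R) (x t A B E k : R).

Definition gauss x : R := expR (- x ^+ 2 / 2).

Lemma gauss_gt0 x : 0 < gauss x. Proof. exact: expR_gt0. Qed.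

Lemma gaussN x : gauss (- x) = gauss x.
Proof. by rewrite /gauss sqrrN. Qed.

#[local] Instance is_derive_gauss x : is_derive x 1 gauss (- x * gauss x).
Proof.
by rewrite /gauss; apply: is_derive_eq; rewrite /GRing.scale/=; field.
Qed.

(** Limits along the integers suffice for monotone functions, and they are directly
    accessible to dominated convergence. *)
Definition vanishes f := f n%:R @[n --> \oo] --> (0 : R).

Lemma vanishesD f g : vanishes f -> vanishes g -> vanishes (fun x => f x + g x).
Proof. by move=> vf vg; rewrite /vanishes -(addr0 0); apply: cvgD. Qed.

Lemma vanishesZ k f : vanishes f -> vanishes (fun x => k * f x).
Proof. by move=> vf; rewrite /vanishes -(mulr0 k); apply: cvgM => //; exact: cvg_cst. Qed.

Lemma vanishes_eq f g : f =1 g -> vanishes f -> vanishes g.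
Proof. by move=> /funext ->. Qed.

Lemma vanishes_harmonic f k : (forall n : nat, `|f n%:R| <= k / n.+1%:R) -> vanishes f.
Proof.
move=> fk; have h : (fun n : nat => k / n.+1%:R) @ \oo --> (0 : R).
  rewrite -(mulr0 k); apply: cvgM; first exact: cvg_cst.
  exact: cvg_harmonic.
apply/cvgr0Pnorm_lt => e e0.
have /cvgr0Pnorm_lt/(_ e e0) := h; apply: filterS => n.
by apply: le_lt_trans; rewrite (le_trans (fk n))// ler_norm.
Qed.

Lemma gauss_decay (n : nat) : gauss n%:R <= 3 / n.+1%:R /\ n%:R * gauss n%:R <= 3 / n.+1%:R.
Proof.
set y := n%:R : R; have y0 : 0 <= y by rewrite ler0n.
have y1 : 0 < y + 1 by rewrite ltr_wpDl.
have eE : gauss y * (1 + y ^+ 2 / 2) <= 1.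
  have := ler_wpM2l (expR_ge0 (- (y ^+ 2 / 2))) (expR_ge1Dx (y ^+ 2 / 2)).
  by rewrite [X in _ <= X]mulrC expRxMexpNx_1 -mulNr.
have g0 := gauss_gt0 y.
rewrite -natr1 -/y !ler_pdivlMr//; split; nra.
Qed.

Lemma vanishes_gauss : vanishes gauss.
Proof.
apply: (@vanishes_harmonic _ 3) => n; rewrite gtr0_norm ?gauss_gt0//.
exact: (gauss_decay n).1.
Qed.

Lemma vanishes_xgauss : vanishes (fun x => x * gauss x).
Proof.
apply: (@vanishes_harmonic _ 3) => n; rewrite ger0_norm.
  exact: (gauss_decay n).2.
by rewrite mulr_ge0// ltW// gauss_gt0.
Qed.

(** This applies the a priori bounds to f', which is bounded but about which
    nothing else is known at infinity. *)
Lemma vanishes_bounded f k : (forall x, `|f x| <= k) -> vanishes (fun x => f x * gauss x).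
Proof.
move=> fk; have k0 : 0 <= k by apply: le_trans (fk 0).
apply: (@vanishes_harmonic _ (k * 3)) => n; rewrite normrM (gtr0_norm (gauss_gt0 _)).
by rewrite -mulrA; apply: ler_pM => //; [exact/ltW/gauss_gt0|exact: (gauss_decay n).1].
Qed.

Lemma nonincreasing_vanishes_ge0 (x0 : R) psi dpsi : (forall t, is_derive t 1 psi (dpsi t)) ->
  (forall t, x0 < t -> dpsi t <= 0) -> vanishes psi -> 0 <= psi x0.
Proof.
move=> dp dle v; rewrite leNgt; apply/negP => p0.
have /cvgrPdist_lt/(_ (- psi x0)) := v; rewrite oppr_gt0 => /(_ p0)[N _ hN].
pose m := maxn N (Num.truncn `|x0|).+1.
have xm : x0 < m%:R.
  apply: (le_lt_trans (ler_norm _)); apply: (lt_le_trans (truncnS_gt _)).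
  by rewrite ler_nat leq_maxr.
have := hN m; rewrite /= leq_maxl sub0r => /(_ isT); rewrite normrN ltNge => /negP; apply.
have cp : continuous psi by exact: is_derive_continuous dp.
have [c] := @MVT _ psi dpsi x0 m%:R xm (fun z _ => dp z) (continuous_subspaceT cp).
rewrite in_itv/= => /andP[xc _] e.
have : psi m%:R <= psi x0.
  by rewrite -subr_le0 e mulr_le0_ge0 ?subr_ge0 ?dle// ltW.
move=> le; rewrite -normrN (le_trans _ (ler_norm _))// lerN2//.
Qed.

(** With H = h - E h(N) this is Stein's equation; it is needed for general H, since
    f' solves the equation with right-hand side h' + f. *)
Definition stein_eq f H := forall t : R, is_derive t 1 f (t * f t + H t).

(** The function (f - f2) times the Gaussian weight is nonincreasing beyond x0 and
    tends to 0, so it is nonnegative at x0. *)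
Lemma stein_comparison (x0 : R) f H f2 H2 : stein_eq f H -> stein_eq f2 H2 ->
  vanishes (fun t => f t * gauss t) -> vanishes (fun t => f2 t * gauss t) ->
  (forall t, x0 <= t -> H t <= H2 t) -> f2 x0 <= f x0.
Proof.
move=> df df2 vf vf2 HH.
pose psi t := (f t - f2 t) * gauss t.
have dpsi t : is_derive t 1 psi ((H t - H2 t) * gauss t).
  have h1 := df t; have h2 := df2 t.
  by rewrite /psi; apply: is_derive_eq; rewrite /GRing.scale/=; ring.
have : 0 <= psi x0.
  apply: (@nonincreasing_vanishes_ge0 x0 psi _ dpsi).
    move=> t xt; rewrite mulr_le0_ge0 ?subr_le0 ?HH ?(ltW xt)//.
    exact/ltW/gauss_gt0.
  apply: vanishes_eq (vanishesD vf (vanishesZ (-1) vf2)) => t; rewrite /psi; ring.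
by rewrite /psi pmulr_lge0 ?gauss_gt0// subr_ge0.
Qed.

(** The reflection x -> -x transfers estimates over the right half-line to the left
    half-line. *)
Lemma stein_eq_reflect f H : stein_eq f H ->
  stein_eq (fun t => - f (- t)) (fun t => H (- t)).
Proof.
move=> df t.
have h : is_derive t 1 (f \o -%R) ((- t * f (- t) + H (- t)) * - 1).
  by apply: is_derive1_comp; exact: df.
have : is_derive t 1 (fun t => - f (- t)) (- ((- t * f (- t) + H (- t)) * - 1)).
  exact: is_deriveN.
congr is_derive; rewrite /GRing.scale/=; ring.
Qed.

Variable Q : R -> R.
Hypothesis dQ : forall x : R, is_derive x 1 Q (- gauss x).
Hypothesis vQ : vanishes Q.

Definition mills x := Q x / gauss x.

Lemma mills_eq : stein_eq mills (fun=> -1).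
Proof.
move=> t; have h := dQ t.
have g0 : gauss t != 0 by rewrite gt_eqF// gauss_gt0.
have hV : is_derive t 1 (fun x => (gauss x)^-1) (- (gauss t) ^- 2 *: (- t * gauss t)).
  exact: is_deriveV.
rewrite /mills; apply: is_derive_eq; rewrite /GRing.scale/=; field.
by [].
Qed.

Lemma vanishes_mills : vanishes (fun t => mills t * gauss t).
Proof.
by apply: vanishes_eq vQ => t; rewrite /mills divfK// gt_eqF// gauss_gt0.
Qed.

(** [mom1] and [mom2] are the integrals of t - x and (t - x)^2 against the weight
    e^(-(t^2 - x^2)/2) over t >= x, computed by parts from the Mills ratio. *)
Definition mom1 x := 1 - x * mills x.
Definition mom2 x := (1 + x ^+ 2) * mills x - x.

(** Quadratic right-hand sides are solved explicitly by the Mills ratio and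
    polynomials; they serve as barriers in [stein_comparison]. *)
Lemma quad_solution x0 A B E :
  exists2 f2, stein_eq f2 (fun t => A + B * (t - x0) + E * (t - x0) ^+ 2) &
    vanishes (fun t => f2 t * gauss t) /\
    f2 x0 = - (A * mills x0 + B * mom1 x0 + E * mom2 x0).
Proof.
pose f2 t := - (A - B * x0 + E * x0 ^+ 2 + E) * mills t - (B - 2 * E * x0) - E * t.
exists f2.
  move=> t; have h := mills_eq t.
  by rewrite /f2; apply: is_derive_eq; rewrite /GRing.scale/=; ring.
split; last by rewrite /f2 /mom1 /mom2; ring.
apply: vanishes_eq (vanishesD (vanishesD (vanishesZ (- (A - B * x0 + E * x0 ^+ 2 + E)) vanishes_mills)
  (vanishesZ (- (B - 2 * E * x0)) vanishes_gauss)) (vanishesZ (- E) vanishes_xgauss)) => t.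
rewrite /f2; ring.
Qed.

Lemma stein_lower x0 A B E f H : stein_eq f H -> vanishes (fun t => f t * gauss t) ->
  (forall t, x0 <= t -> H t <= A + B * (t - x0) + E * (t - x0) ^+ 2) ->
  - (A * mills x0 + B * mom1 x0 + E * mom2 x0) <= f x0.
Proof.
move=> df vf HH; have [f2 df2 [vf2 <-]] := quad_solution x0 A B E.
exact: stein_comparison df df2 vf vf2 HH.
Qed.

Lemma stein_upper x0 A B E f H : stein_eq f H -> vanishes (fun t => f t * gauss t) ->
  (forall t, x0 <= t -> A + B * (t - x0) + E * (t - x0) ^+ 2 <= H t) ->
  f x0 <= - (A * mills x0 + B * mom1 x0 + E * mom2 x0).
Proof.
move=> df vf HH; have [f2 df2 [vf2 <-]] := quad_solution x0 A B E.
exact: stein_comparison df2 df vf2 vf HH.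
Qed.

Lemma stein_eq0 : stein_eq (fun=> 0) (fun=> 0).
Proof. by move=> t; apply: is_derive_eq; rewrite mulr0 addr0. Qed.

Lemma vanishes0 : vanishes (fun t => 0 * gauss t).
Proof. exact: (vanishesZ 0 vanishes_gauss). Qed.

(** The signs of the Mills ratio and of its two moments follow by comparing the zero
    solution with the barriers for 1, t - x and (t - x)^2. *)
Lemma mills_ge0 x : 0 <= mills x.
Proof.
have := @stein_lower x 1 0 0 _ _ stein_eq0 vanishes0.
by rewrite !mul0r !addr0 mul1r oppr_le0; apply => t _; rewrite !mul0r !addr0.
Qed.

Lemma mom1_ge0 x : 0 <= mom1 x.
Proof.
have := @stein_lower x 0 1 0 _ _ stein_eq0 vanishes0.
rewrite !mul0r add0r addr0 mul1r oppr_le0; apply => t xt.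
by rewrite mul0r mul1r addr0 add0r subr_ge0.
Qed.

Lemma mom2_ge0 x : 0 <= mom2 x.
Proof.
have := @stein_lower x 0 0 1 _ _ stein_eq0 vanishes0.
rewrite !mul0r !add0r mul1r oppr_le0; apply => t xt.
by rewrite !mul0r mul1r !add0r sqr_ge0.
Qed.

Lemma mills_gt0 x : 0 <= x -> 0 < mills x.
Proof.
move=> x0.
(* -1 <= -u + u^2 / 4 because (1 - u / 2)^2 >= 0 *)
have := @stein_lower x 0 (-1) (4^-1) _ _ mills_eq vanishes_mills.
have h t : x <= t -> -1 <= 0 + -1 * (t - x) + 4^-1 * (t - x) ^+ 2.
  by move=> _; have := sqr_ge0 (1 - (t - x) / 2); nra.
move=> /(_ h); rewrite /mom1 /mom2 => le; rewrite lt_def mills_ge0 andbT.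
apply/eqP => m0; rewrite m0 in le; lra.
Qed.

Let M x := mills x + mills (- x).

Lemma millsD_gt0 x : 0 < M x.
Proof.
have [x0|x0] := leP 0 x; first by rewrite ltr_wpDr ?mills_ge0 ?mills_gt0.
by rewrite ltr_wpDl ?mills_ge0 ?mills_gt0// oppr_ge0 ltW.
Qed.

(** This identity makes the two one-sided estimates combine with total weight 1 in
    both bounds that follow. *)
Lemma mom_cross x : mom1 x * mom2 (- x) + mom1 (- x) * mom2 x = M x.
Proof. rewrite /mom1 /mom2 /M; ring. Qed.

Variables (f H dH : R -> R).
Hypothesis df : stein_eq f H.
Hypothesis vf : vanishes (fun t => f t * gauss t).
Hypothesis vfN : vanishes (fun t => f (- t) * gauss t).
Hypothesis hdH : forall x : R, is_derive x 1 H (dH x).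

Let dfN := stein_eq_reflect df.

Let vfN' : vanishes (fun t => - f (- t) * gauss t).
Proof. by apply: vanishes_eq (vanishesZ (-1) vfN) => t; ring. Qed.

(** The left-hand side is f'' - H' for a solution f.  The barriers H(x) +- k (t - x)
    on each side of x estimate [f x + H x * mills x] and [f x - H x * mills (- x)];
    the quantity to bound is a combination of these two with the nonnegative weights
    [mom2 (- x)] and [mom2 x], and [mom_cross] evaluates the total. *)
Lemma stein_bound_lipschitz k x : (forall x, `|dH x| <= k) ->
  `|(1 + x ^+ 2) * f x + x * H x| <= k.
Proof.
move=> dHk.
have hH t : `|H t - H x| <= k * `|t - x|.
  have [->|tx] := eqVneq x t; first by rewrite !subrr !normr0 mulr0.
  have [c [-> _ _]] := mean_value hdH tx.
  by rewrite normrM ler_wpM2r.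
have r1 : - (H x * mills x + k * mom1 x + 0 * mom2 x) <= f x.
  apply: (stein_lower df vf) => t xt; have := hH t.
  by rewrite (ger0_norm (_ : 0 <= t - x)) ?subr_ge0// ler_norml => /andP[_]; lra.
have r2 : f x <= - (H x * mills x + (- k) * mom1 x + 0 * mom2 x).
  apply: (stein_upper df vf) => t xt; have := hH t.
  by rewrite (ger0_norm (_ : 0 <= t - x)) ?subr_ge0// ler_norml => /andP[]; lra.
have l1 : - (H x * mills (- x) + k * mom1 (- x) + 0 * mom2 (- x)) <= - f (- - x).
  apply: (stein_lower dfN vfN') => t xt; have := hH (- t).
  have tx : - t - x <= 0 by lra.
  by rewrite (ler0_norm tx) ler_norml => /andP[_]; lra.
have l2 : - f (- - x) <= - (H x * mills (- x) + (- k) * mom1 (- x) + 0 * mom2 (- x)).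
  apply: (stein_upper dfN vfN') => t xt; have := hH (- t).
  have tx : - t - x <= 0 by lra.
  by rewrite (ler0_norm tx) ler_norml => /andP[]; lra.
rewrite opprK in l1 l2.
set a := f x + H x * mills x; set b := f x - H x * mills (- x).
have a_le : `|a| <= k * mom1 x by rewrite ler_norml /a; apply/andP; split; lra.
have b_le : `|b| <= k * mom1 (- x) by rewrite ler_norml /b; apply/andP; split; lra.
have M0 := millsD_gt0 x.
rewrite -(ler_pM2r M0) -[X in _ * X <= _](gtr0_norm M0) -normrM.
have -> : ((1 + x ^+ 2) * f x + x * H x) * M x = a * mom2 (- x) + b * mom2 x.
  by rewrite /a /b /mom2 /M; ring.
have m2 := mom2_ge0 x; have m2N := mom2_ge0 (- x).
apply: le_trans (ler_normD _ _) _.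
rewrite !normrM (ger0_norm m2) (ger0_norm m2N).
apply: le_trans (lerD (ler_wpM2r m2N a_le) (ler_wpM2r m2 b_le)) _.
by rewrite -mom_cross le_eqVlt; apply/orP; left; apply/eqP; ring.
Qed.

(** The left-hand side is f'.  The same argument with second-order barriers; the
    combination with weights [mom1 (- x)] and [mom1 x] eliminates the unknown slope
    [dH x]. *)
Lemma stein_bound_smooth (d2H : R -> R) k x :
  (forall x : R, is_derive x 1 dH (d2H x)) -> (forall x, `|d2H x| <= k) ->
  `|x * f x + H x| <= k / 2.
Proof.
move=> hd2H d2Hk.
have k0 : 0 <= k by apply: le_trans (d2Hk 0).
have hH t : `|H t - H x - dH x * (t - x)| <= k / 2 * (t - x) ^+ 2.
  have := @second_order_remainder _ H dH 0 k x t hdH.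
  rewrite mul0r subr0; apply => c _; rewrite mulr0 mul0r subr0.
  have [->|cx] := eqVneq x c; first by rewrite !subrr !normr0 mulr0.
  have [u [-> _ _]] := mean_value hd2H cx.
  by rewrite normrM ler_wpM2r.
have hu t := proj1 (andP (etrans (esym (ler_norml _ _)) (hH t))).
have hl t := proj2 (andP (etrans (esym (ler_norml _ _)) (hH t))).
have r1 : - (H x * mills x + dH x * mom1 x + k / 2 * mom2 x) <= f x.
  by apply: (stein_lower df vf) => t xt; have := hl t; lra.
have r2 : f x <= - (H x * mills x + dH x * mom1 x + (- (k / 2)) * mom2 x).
  by apply: (stein_upper df vf) => t xt; have := hu t; lra.
have l1 : - (H x * mills (- x) + (- dH x) * mom1 (- x) + k / 2 * mom2 (- x)) <= - f (- - x).
  apply: (stein_lower dfN vfN') => t xt; have := hl (- t).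
  have -> : (- t - x) ^+ 2 = (t - - x) ^+ 2 by ring.
  lra.
have l2 : - f (- - x) <= - (H x * mills (- x) + (- dH x) * mom1 (- x) + (- (k / 2)) * mom2 (- x)).
  apply: (stein_upper dfN vfN') => t xt; have := hu (- t).
  have -> : (- t - x) ^+ 2 = (t - - x) ^+ 2 by ring.
  lra.
rewrite opprK in l1 l2.
set a := f x + H x * mills x + dH x * mom1 x.
set b := f x - H x * mills (- x) + dH x * mom1 (- x).
have a_le : `|a| <= k / 2 * mom2 x by rewrite ler_norml /a; apply/andP; split; lra.
have b_le : `|b| <= k / 2 * mom2 (- x) by rewrite ler_norml /b; apply/andP; split; lra.
have M0 := millsD_gt0 x.
rewrite -(ler_pM2r M0) -[X in _ * X <= _](gtr0_norm M0) -normrM.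
have -> : (x * f x + H x) * M x = a * mom1 (- x) - b * mom1 x.
  by rewrite /a /b /mom1 /M; ring.
have m1 := mom1_ge0 x; have m1N := mom1_ge0 (- x).
apply: le_trans (ler_normB _ _) _.
rewrite !normrM (ger0_norm m1) (ger0_norm m1N).
apply: le_trans (lerD (ler_wpM2r m1N a_le) (ler_wpM2r m1 b_le)) _.
by rewrite -mom_cross le_eqVlt; apply/orP; left; apply/eqP; ring.
Qed.

End stein_ode.


(** * Gaussian integrals *)

Section gaussian_primitive.
Context {R : realType}.
Local Notation mu := (@lebesgue_measure R).
Implicit Types (g : R -> R) (x : R).

Definition primitive g x := \int[mu]_(t in `]-oo, x]) g t.

Lemma is_derive_primitive g x : continuous g -> mu.-integrable setT (EFin \o g) ->
  is_derive x 1 (primitive g) (g x).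
Proof.
move=> cg ig.
have ig' : mu.-integrable [set` Interval -oo%O (BRight (x + 1))] (EFin \o g).
  exact: integrableS ig.
have x1 : x < x + 1 by rewrite ltrDl.
have [d <-] := @continuous_FTC1 R g -oo%O x (x + 1) x1 ig' (ltNyr _) (cg x).
apply: DeriveDef; first exact: d.
exact: (esym (derive1E _ _)).
Qed.

Lemma primitive_indic g x : mu.-integrable setT (EFin \o g) ->
  (primitive g x)%:E = (\int[mu]_t (g t * \1_(`]-oo, x]) t)%:E)%E.
Proof.
move=> ig; rewrite /primitive /Rintegral fineK; last first.
  by apply: integrable_fin_num => //; exact: integrableS ig.
rewrite integral_mkcond; apply: eq_integral => t _.
by rewrite patchE indicE; case: ifPn; rewrite ?mulr1 ?mulr0.
Qed.

(** The limits at both ends are instances of dominated convergence for the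
    indicators of half-lines. *)
Lemma primitive_dominated g (x : nat -> R) (l : R -> R) :
  mu.-integrable setT (EFin \o g) -> measurable_fun setT l ->
  (forall t, \1_(`]-oo, x n]) t @[n --> \oo] --> l t) ->
  primitive g (x n) @[n --> \oo] --> \int[mu]_t (g t * l t).
Proof.
move=> ig ml xl.
have mg : measurable_fun setT g by case/integrableP : ig => /measurable_EFinP.
have := @dominated_convergence _ _ _ mu setT measurableT
  (fun n t => (g t * \1_(`]-oo, x n]) t)%:E) (fun t => (g t * l t)%:E)
  (fun t => `|g t|%:E).
case.
- by move=> n; apply/measurable_EFinP; exact: measurable_funM.
- by apply/measurable_EFinP; exact: measurable_funM.
- apply: aeW => t _; apply: cvg_EFin; first exact: nearW.
  by apply: cvgM; [exact: cvg_cst|exact: xl].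
- exact: integrable_norm.
- apply: aeW => t n _; rewrite /= lee_fin normrM ler_piMr// indicE.
  by rewrite ger0_norm// lern1 leq_b1.
move=> igl _ h.
rewrite (_ : (fun n => primitive g (x n)) =
    fine \o (fun n => \int[mu]_t (g t * \1_(`]-oo, x n]) t)%:E)%E); last first.
  by apply/funext => n; rewrite /= -primitive_indic.
by apply: fine_cvg; rewrite fineK//; exact: integrable_fin_num.
Qed.

Lemma primitive_cvgy g : mu.-integrable setT (EFin \o g) ->
  primitive g n%:R @[n --> \oo] --> \int[mu]_t g t.
Proof.
move=> ig; rewrite (_ : \int[mu]_t g t = \int[mu]_t (g t * 1)); last first.
  by apply: eq_Rintegral => t _; rewrite mulr1.
apply: (@primitive_dominated g (fun n => n%:R) (fun=> 1)) => // t.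
apply: cvg_near_cst; exists (Num.truncn `|t|).+1 => //= n /= tn.
rewrite indicE mem_set//= in_itv/= (le_trans (ler_norm _))//.
by rewrite (le_trans (ltW (truncnS_gt _)))// ler_nat.
Qed.

Lemma primitive_cvgNy g : mu.-integrable setT (EFin \o g) ->
  primitive g (- n%:R) @[n --> \oo] --> (0 : R).
Proof.
move=> ig; have := @primitive_dominated g (fun n => - n%:R) (fun=> 0) ig.
rewrite (_ : \int[mu]_t (g t * 0) = 0); last first.
  rewrite (@eq_Rintegral _ _ _ mu setT (fun=> 0))//; last first.
    by move=> t _; rewrite mulr0.
  by rewrite /Rintegral integral0.
apply => // t.
apply: cvg_near_cst; exists (Num.truncn `|t|).+1 => //= n /= tn.
rewrite indicE memNset//= in_itv/=; apply/negP; rewrite -ltNge ltrNl.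
apply: (le_lt_trans (ler_norm _)); rewrite normrN.
by apply: (lt_le_trans (truncnS_gt _)); rewrite ler_nat.
Qed.

End gaussian_primitive.

Section normal_density.
Context {R : realType}.
Local Notation mu := (@lebesgue_measure R).
Local Notation nu := (@normal_prob R 0 1).
Implicit Types (f : R -> R).

Lemma normal_pdf_gauss x : normal_pdf 0 1 x = normal_peak 1 * @gauss R x.
Proof.
rewrite normal_pdfE ?oner_eq0// /normal_fun /gauss subr0 expr1n.
by [].
Qed.

(** The density is a Radon-Nikodym derivative, by uniqueness of the latter. *)
Lemma integral_normal_prob (f : R -> \bar R) : nu.-integrable setT f ->
  (\int[nu]_x f x = \int[mu]_x (f x * (normal_pdf 0 1 x)%:E))%E.
Proof.
move=> fi; have mf := measurable_int _ fi.
have s10 : (1 : R) != 0 by rewrite oner_eq0.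
rewrite -(Radon_Nikodym_change_of_variables (normal_prob_dominates 0 1))//=.
apply: ae_eq_integral => //.
- apply: emeasurable_funM => //; apply: (measurable_int mu).
  by apply: Radon_Nikodym_integrable; exact: normal_prob_dominates.
- apply: emeasurable_funM => //=; apply/measurableT_comp => //=.
  exact: measurable_normal_pdf.
- apply: ae_eqe_mul2l => /=.
  rewrite Radon_NikodymE//=; first exact: normal_prob_dominates.
  move=> abmu; case: cid => /= h [h1 h2 h3].
  apply: integral_ae_eq => //=.
  + by apply/measurableT_comp => //; exact: measurable_normal_pdf.
  + by move=> E E01 mE; rewrite -h3.
Qed.

(** [integral_normal_prob] presupposes integrability; it is applied to the bounded
    truncations of |f|, which increase to |f|. *)
Lemma integrable_normal_prob f : measurable_fun setT f ->
  mu.-integrable setT (fun x => (f x * normal_pdf 0 1 x)%:E) ->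
  nu.-integrable setT (EFin \o f).
Proof.
move=> mf ifp.
pose g n x := Num.min `|f x| n%:R.
have mg n : measurable_fun setT (g n).
  by apply: measurable_minr => //; exact: measurableT_comp.
have g0 n x : 0 <= g n x by rewrite le_min normr_ge0/=.
have ig n : nu.-integrable setT (EFin \o g n).
  apply: (@le_integrable _ _ _ nu setT measurableT _ (cst n%:R%:E)).
  - apply/measurable_EFinP; exact: (mg n).
  - by move=> x _; rewrite /= lee_fin (ger0_norm (g0 n x)) (ger0_norm (ler0n _ _)) /g ge_min lexx orbT.
  - exact: finite_measure_integrable_cst.
have gn n : (\int[nu]_x (g n x)%:E <= \int[mu]_x `|(f x * normal_pdf 0 1 x)%:E|)%E.
  rewrite (integral_normal_prob (ig n)); apply: ge0_le_integral => //.
  - by move=> x _; rewrite -EFinM lee_fin mulr_ge0// normal_pdf_ge0.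
  - apply: emeasurable_funM; apply/measurable_EFinP; first exact: (mg n).
    exact: measurable_normal_pdf.
  - by apply: measurableT_comp => //; exact: measurable_int ifp.
  - move=> x _; rewrite -EFinM /= lee_fin normrM.
    by rewrite (ger0_norm (normal_pdf_ge0 _ _ _)) ler_wpM2r ?normal_pdf_ge0// ge_min lexx.
have mono x : {homo (fun n => (g n x)%:E) : m n / (m <= n)%N >-> (m <= n)%E}.
  move=> m n mn; rewrite lee_fin le_min ge_min lexx/= ge_min.
  by rewrite ler_nat mn orbT.
have cg x : (g n x)%:E @[n --> \oo] --> `|f x|%:E.
  apply: cvg_near_cst; exists (Num.truncn `|f x|).+1 => //= n /= tn.
  congr EFin; apply/min_idPl; rewrite (le_trans (ltW (truncnS_gt _)))//.
  by rewrite ler_nat.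
apply/integrableP; split; first exact/measurable_EFinP.
case/integrableP : ifp => mfp; apply: le_lt_trans.
rewrite (_ : (\int[nu]_x `|(EFin \o f) x| =
    \int[nu]_x limn (fun n => (g n x)%:E))%E); last first.
  by apply: eq_integral => x _; apply/esym/cvg_lim => //; exact: cg.
have h := @cvg_monotone_convergence _ _ _ nu setT measurableT (fun n => EFin \o g n)
    (fun n => (measurable_EFinP _ _).2 (mg n))
    (fun n x _ => g0 n x) (fun x _ => mono x).
rewrite -(cvg_lim _ h)//; apply: lime_le; first by apply/cvg_ex; eexists; exact: h.
by apply: nearW => n; exact: gn.
Qed.

Lemma integrable_gauss : mu.-integrable setT (EFin \o @gauss R).
Proof.
have := integrableZl measurableT (normal_peak 1)^-1 (integrable_normal_pdf (0 : R) 1).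
apply: eq_integrable => // x _ /=; rewrite normal_pdf_gauss -EFinM mulKf//.
by rewrite gt_eqF// normal_peak_gt0// oner_eq0.
Qed.

(** The dominating function is a multiple of the normal density of variance 2. *)
Lemma integrable_growth_gauss (h : R -> R) (a : R) : continuous h ->
  (forall x : R, `|h x| <= a + `|x|) ->
  mu.-integrable setT (fun x => (h x * gauss x)%:E).
Proof.
move=> ch ha; have a0 : 0 <= a by have := ha 0; rewrite normr0 addr0; apply: le_trans.
have s20 : Num.sqrt 2 != 0 :> R by rewrite gt_eqF// sqrtr_gt0.
pose k := (normal_peak (Num.sqrt 2 : R))^-1.
have k0 : 0 < k by rewrite invr_gt0 normal_peak_gt0.
have mh : measurable_fun setT (fun x => h x * gauss x).
  apply: continuous_measurable_fun => x; apply: cvgM; first exact: ch.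
  exact: is_derive_continuous (is_derive_gauss (R := R)) x.
apply: (@le_integrable _ _ _ mu setT measurableT _
  (fun x => ((a + 2) * k)%:E * (normal_pdf 0 (Num.sqrt 2) x)%:E)%E).
- exact/measurable_EFinP.
- move=> x _; rewrite /= lee_fin normrM [leRHS]normrM.
  rewrite (gtr0_norm (gauss_gt0 x)) (ger0_norm (normal_pdf_ge0 _ _ _)).
  rewrite normal_pdfE// (ger0_norm (_ : 0 <= (a + 2) * k)); last first.
    by rewrite mulr_ge0 ?addr_ge0// ltW.
  have -> : (a + 2) * k * (normal_peak (Num.sqrt 2) * normal_fun 0 (Num.sqrt 2) x) =
      (a + 2) * normal_fun 0 (Num.sqrt 2) x.
    by rewrite /k mulrA mulfVK// gt_eqF// normal_peak_gt0.
  (* half of the Gaussian exponent absorbs the linear growth *)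
  have -> : gauss x = normal_fun 0 (Num.sqrt 2) x * expR (- (x ^+ 2 / 4)).
    rewrite /gauss /normal_fun -expRD sqr_sqrtr// subr0; congr expR; by field.
  rewrite mulrCA mulrC ler_wpM2r ?normal_fun_ge0//.
  have e1 : expR (- (x ^+ 2 / 4)) * (1 + x ^+ 2 / 4) <= 1.
    have := ler_wpM2l (expR_ge0 (- (x ^+ 2 / 4))) (expR_ge1Dx (x ^+ 2 / 4)).
    by rewrite [X in _ <= X]mulrC expRxMexpNx_1.
  have e0 : 0 < expR (- (x ^+ 2 / 4)) by exact: expR_gt0.
  have hx := ha x.
  apply: (@le_trans _ _ ((a + `|x|) * expR (- (x ^+ 2 / 4)))).
    by rewrite ler_wpM2r// ltW.
  have x2 : x ^+ 2 = `|x| ^+ 2 by rewrite real_normK// num_real.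
  move: e1 e0; rewrite x2; set y := `|x|; set e := expR _ => e1 e0.
  have y0 : 0 <= y by exact: normr_ge0.
  have le1 : y <= 2 * (1 + y ^+ 2 / 4) by nra.
  have le2 : 1 <= 1 + y ^+ 2 / 4 by nra.
  have e2 : e * y <= 2.
    apply: (le_trans (ler_wpM2l (ltW e0) le1)); lra.
  have e3 : e <= 1.
    by apply: le_trans e1; rewrite -[leLHS]mulr1 ler_wpM2l// ltW.
  nra.
- exact: (integrableZl measurableT _ (integrable_normal_pdf (0 : R) (Num.sqrt 2))).
Qed.

Lemma mean_growth_normal (h : R -> R) (a : R) : continuous h ->
  (forall x : R, `|h x| <= a + `|x|) ->
  nu.-integrable setT (EFin \o h) /\
  \int[mu]_x ((h x - Rintegral nu setT h) * gauss x) = 0.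
Proof.
move=> ch ha.
have ihg := integrable_growth_gauss ch ha.
have mh : measurable_fun setT h by exact: continuous_measurable_fun.
have pk0 : normal_peak 1 != 0 :> R by rewrite gt_eqF// normal_peak_gt0// oner_eq0.
have ihp : mu.-integrable setT (fun x => (h x * normal_pdf 0 1 x)%:E).
  have := integrableZl measurableT (normal_peak 1) ihg.
  apply: eq_integrable => // x _ /=; rewrite normal_pdf_gauss -EFinM; congr EFin.
  by rewrite mulrCA.
have ih := integrable_normal_prob mh ihp.
split => //.
have hE : Rintegral nu setT h = normal_peak 1 * \int[mu]_x (h x * gauss x).
  rewrite -RintegralZl// /Rintegral integral_normal_prob//; congr fine.
  apply: eq_integral => x _; rewrite -EFinM normal_pdf_gauss mulrCA//.
have gE : normal_peak 1 * \int[mu]_x (@gauss R x) = 1.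
  rewrite -RintegralZl//; last exact: integrable_gauss.
  rewrite /Rintegral -[RHS]/(fine 1%E) -(integral_normal_pdf (0 : R) 1); congr fine.
  by apply: eq_integral => x _; rewrite normal_pdf_gauss.
under eq_Rintegral do rewrite mulrBl.
rewrite RintegralB//; last exact: (integrableZl measurableT _ integrable_gauss).
rewrite RintegralZl//; last exact: integrable_gauss.
by rewrite hE mulrAC gE mul1r subrr.
Qed.

End normal_density.


(** * Solution of the Stein equation *)

Section stein_solution.
Context {R : realType}.
Local Notation mu := (@lebesgue_measure R).
Local Notation nu := (@normal_prob R 0 1).

Lemma supnorm_le1 (g : R -> R) : (supnorm g <= 1)%E -> forall x, `|g x| <= 1.
Proof.
move=> g1 x; rewrite -lee_fin; apply: le_trans g1.
by apply: ereal_sup_ubound; exists x.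
Qed.

(** The tail of the Gaussian integral is the reflection of its primitive from minus
    infinity. *)
Lemma gaussian_tail : exists2 Q : R -> R,
  (forall x : R, is_derive x 1 Q (- gauss x)) & vanishes Q.
Proof.
have cg : continuous (@gauss R) by exact: is_derive_continuous (@is_derive_gauss R).
exists (fun x => primitive gauss (- x)); last exact: primitive_cvgNy integrable_gauss.
move=> x.
have h : is_derive (- x) 1 (primitive gauss) (gauss (- x)).
  by apply: is_derive_primitive => //; exact: integrable_gauss.
have hN : is_derive x 1 (fun y : R => - y) (- 1) by apply: is_derive_eq.
have := is_derive1_comp h hN.
by congr is_derive; rewrite gaussN mulrN1.
Qed.

(** f is the primitive of (h - E h(N)) e^(-t^2/2) from minus infinity, divided by the
    weight.  It vanishes at plus infinity after multiplication by the weight because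
    the total integral is zero: this fixes the constant E h(N). *)
Lemma stein_solution_exists (h : R -> R) (a : R) : continuous h ->
  (forall x : R, `|h x| <= a + `|x|) ->
  exists f, [/\ stein_eq f (fun x => h x - Rintegral nu setT h),
    vanishes (fun x => f x * gauss x) & vanishes (fun x => f (- x) * gauss x)].
Proof.
move=> ch ha; have [ih h0] := mean_growth_normal ch ha.
set m := Rintegral nu setT h in h0 *.
pose g x := (h x - m) * gauss x.
have cgs : continuous (@gauss R) by exact: is_derive_continuous (@is_derive_gauss R).
have chm : continuous (fun x => h x - m).
  by move=> x; apply: cvgB; [exact: ch|exact: cvg_cst].
have cg : continuous g by move=> x; apply: cvgM; [exact: chm|exact: cgs].
have ig : mu.-integrable setT (EFin \o g).
  apply: (@integrable_growth_gauss _ (fun x => h x - m) (a + `|m|)) => // x.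
  by rewrite (le_trans (ler_normB _ _))// addrAC lerD2r.
exists (fun x => primitive g x / gauss x); split.
- move=> x; have hp := @is_derive_primitive R g x cg ig.
  have g0 : gauss x != 0 by rewrite gt_eqF// gauss_gt0.
  have hV : is_derive x 1 (fun x => (gauss x)^-1) (- (gauss x) ^- 2 *: (- x * gauss x)).
    by apply: is_deriveV => //; exact: is_derive_gauss.
  apply: is_derive_eq; rewrite /GRing.scale/= /g; field.
  by [].
- have := primitive_cvgy ig; rewrite h0; apply: vanishes_eq => x.
  by rewrite divfK// gt_eqF// gauss_gt0.
- have := primitive_cvgNy ig; apply: (@vanishes_eq _ (fun x => primitive g (- x))) => x.
  by rewrite gaussN divfK// gt_eqF// gauss_gt0.
Qed.

(** First |f'| <= 1/2 and |f'' - h'| <= 1.  Differentiating, f' solves the equation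
    with right-hand side h' + f, whose derivative is at most 3/2 in absolute value;
    so |f''' - (h'' + f')| <= 3/2 and |f'''| <= 3.  The Hoelder bound for every
    delta interpolates between the bounds for f'' and f'''. *)
Lemma stein_regularity (h : R -> R) : C2 h ->
  (forall x, `|derive1 h x| <= 1) -> (forall x, `|derive1 (derive1 h) x| <= 1) ->
  nu.-integrable setT (EFin \o h) /\
  exists f f1 f2 : R -> R,
   [/\ forall x : R, is_derive x 1 f (f1 x), forall x : R, is_derive x 1 f1 (f2 x),
       continuous f2, (forall x, `|f2 x| <= 2) /\
       (forall delta x y, 0 < delta <= 1 -> `|f2 x - f2 y| <= 4 * `|x - y| `^ delta) &
       forall x, f1 x - x * f x = h x - Rintegral nu setT h].
Proof.
case=> dh ddh cddh h1le h2le.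
pose h1 := derive1 h; pose h2 := derive1 h1.
have dh1 (x : R) : is_derive x 1 h (h1 x).
  by apply: DeriveDef; [exact: dh|rewrite -derive1E].
have dh2 (x : R) : is_derive x 1 h1 (h2 x).
  by apply: DeriveDef; [exact: ddh|rewrite -derive1E].
have ch : continuous h by exact: is_derive_continuous dh1.
have ch1 : continuous h1 by exact: is_derive_continuous dh2.
have ha x : `|h x| <= `|h 0| + `|x|.
  have [<-|x0] := eqVneq 0 x; first by rewrite normr0 addr0.
  have [c [e _ _]] := mean_value dh1 x0.
  have -> : h x = h 0 + h1 c * x by rewrite -[in RHS](subr0 x) -e addrCA subrr addr0.
  by rewrite (le_trans (ler_normD _ _))// lerD2l normrM ler_piMl.
have [ih _] := mean_growth_normal ch ha.
split => //.
have [Q dQ vQ] := gaussian_tail.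
have [f [df vf vfN]] := stein_solution_exists ch ha.
set m := Rintegral nu setT h in df *.
pose H x := h x - m.
have dH (x : R) : is_derive x 1 H (h1 x).
  have hx := dh1 x; rewrite /H; apply: is_derive_eq; by rewrite oppr0 addr0.
pose f1 x := x * f x + H x.
pose f2 x := f x + x * f1 x + h1 x.
have df1 (x : R) : is_derive x 1 f (f1 x) by exact: df.
have df2 (x : R) : is_derive x 1 f1 (f2 x).
  have hx := df1 x; have hHx := dH x; rewrite /f1.
  by apply: is_derive_eq; rewrite /f2 /GRing.scale/=; ring.
have f1le x : `|f1 x| <= 1 / 2.
  exact: (stein_bound_smooth dQ vQ df vf vfN dH x dh2 h2le).
have f2le x : `|f2 x| <= 2.
  have := stein_bound_lipschitz dQ vQ df vf vfN dH x h1le => b.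
  have -> : f2 x = ((1 + x ^+ 2) * f x + x * H x) + h1 x by rewrite /f2 /f1; ring.
  apply: le_trans (ler_normD _ _) _.
  by have := lerD b (h1le x); rewrite -/h1 (_ : 1 + 1 = 2 :> R).
pose H2 x := h1 x + f x.
have dH2 (x : R) : is_derive x 1 H2 (h2 x + f1 x).
  by have hx := df1 x; have hh := dh2 x; rewrite /H2; apply: is_derive_eq.
have sf1 : stein_eq f1 H2.
  move=> t; have hx := df2 t; apply: is_derive_eq.
  by rewrite /f2 /H2; ring.
have vf1 : vanishes (fun x => f1 x * gauss x) by exact: vanishes_bounded f1le.
have vf1N : vanishes (fun x => f1 (- x) * gauss x).
  by apply: (@vanishes_bounded _ (fun x => f1 (- x)) (1 / 2)) => x; exact: f1le.
pose f3 x := 2 * f1 x + x * f2 x + h2 x.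
have df3 (x : R) : is_derive x 1 f2 (f3 x).
  have hx := df1 x; have hx2 := df2 x; have hh := dh2 x; rewrite /f2.
  by apply: is_derive_eq; rewrite /f3 /f2 /GRing.scale/=; ring.
have h2f1 x : `|h2 x + f1 x| <= 3 / 2.
  apply: le_trans (ler_normD _ _) _.
  by apply: le_trans (lerD (h2le x) (f1le x)) _; lra.
have f3le x : `|f3 x| <= 3.
  have := stein_bound_lipschitz dQ vQ sf1 vf1 vf1N dH2 x h2f1 => b.
  have -> : f3 x = ((1 + x ^+ 2) * f1 x + x * H2 x) + (h2 x + f1 x).
    by rewrite /f3 /f2 /H2; ring.
  apply: le_trans (ler_normD _ _) _.
  by apply: le_trans (lerD b (h2f1 x)) _; lra.
exists f, f1, f2; split => //.
- exact: is_derive_continuous df3.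
- split => // delta x y /andP[d0 d1].
  have [xy|xy] := leP `|x - y| 1.
    have [->|xny] := eqVneq y x.
      by rewrite !subrr !normr0 mulr_ge0// powR_ge0.
    have [c [-> _ _]] := mean_value df3 xny.
    have xy0 : 0 < `|x - y| <= 1 by rewrite xy andbT normr_gt0 subr_eq0 eq_sym.
    rewrite normrM; apply: ler_pM => //; first by apply: le_trans (f3le c) _; lra.
    exact: ger1_powR.
  apply: (@le_trans _ _ 4).
    apply: le_trans (ler_normB _ _) _.
    by apply: le_trans (lerD (f2le x) (f2le y)) _; lra.
  rewrite ler_peMr//; have <- : 1 `^ delta = 1 :> R by rewrite powR1.
  by apply: ler_powRl => //; exact: ltW.
- by move=> x; rewrite /f1 /H addrAC subrr add0r.
Qed.

End stein_solution.


(** * The two bounds *)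

Section smooth_test.
Context {d d' : measure_display} {Om : measurableType d}
  {T : measurableType d'} {R : realType}.
Variables (P : probability Om R) (n : nat) (X : 'I_n -> {RV P >-> T}).
Hypothesis indepX : mutually_independent X.

Local Notation Ex U := (Rintegral P setT U).
Local Notation Intg U := (P.-integrable setT (EFin \o U)).

Lemma expectation_Ex (U : Om -> R) : Intg U -> 'E_P[U]%E = (Ex U)%:E.
Proof. by move=> iU; rewrite unlock ExE. Qed.

Lemma gmeas_function_of (f : n.-tuple T -> R) : measurable_fun setT f ->
  gmeas (sigma_of X predT) (fun w => f [tuple X i w | i < n]).
Proof.
move=> mf; apply: (measurableT_comp mf).
apply/measurable_fun_tnthP => i.
rewrite (_ : _ \o _ = X i); last by apply/funext => w; rewrite /= tnth_mktuple.
move=> _ B mB; rewrite setTI GTE; last exact: sigma_of_sigma.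
apply: sub_sigma_algebra; exists i => //; exists B => //.
by rewrite setTI.
Qed.

Variables (delta c : R) (F : Om -> R).
Hypothesis delta01 : 0 < delta <= 1.
Hypothesis c0 : 0 < c.
Hypothesis cE : (3 + delta) * c = 1.
Hypothesis lF : Lr P c F.
Hypothesis gF : gmeas (sigma_of X predT) F.
Hypothesis EF0 : Ex F = 0.
Hypothesis EF3 : Ex (fun w => F w ^+ 3) = 0.
Variable sigma : R.
Hypothesis sigma0 : 0 < sigma.
Hypothesis EF2 : Ex (fun w => F w * F w) = sigma ^+ 2.
Variables (al be ga : R).

Let c1 : c <= 1.
Proof. by have := cE; have := c0; case/andP : delta01 => d0 _; nra. Qed.

Let c2 : c + c <= 1.
Proof. by have := cE; have := c0; case/andP : delta01 => d0 _; nra. Qed.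

Let c3 : c + c + c <= 1.
Proof. by have := cE; have := c0; case/andP : delta01 => d0 _; nra. Qed.

(** [stein_expansion] for phi(x) = f(x/s)/s; the scaling turns the constants of
    [stein_regularity] into L = 4 / s^(3 + delta). *)
Lemma smooth_test_bound (h : R -> R) : C2 h ->
  (forall x, `|derive1 h x| <= 1) -> (forall x, `|derive1 (derive1 h) x| <= 1) ->
  Intg (fun w => h (F w / sigma)) /\
  `|Ex (fun w => h (F w / sigma)) - Rintegral (normal_prob 0 1) setT h| <=
  4 / sigma `^ (3 + delta) * err0 X delta F al be ga
  + 2 `^ (2 + delta) / sigma `^ (3 + delta) * err1 X delta F al be
  + 2 `^ (2 + delta) / sigma `^ (3 + delta) * err2 X delta F al.
Proof.
move=> C2h h1 h2; have [ih [f [f1 [f2 [df df1 cf2 [f2b f2h] feq]]]]] :=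
  stein_regularity C2h h1 h2.
have s0 : sigma != 0 by rewrite gt_eqF.
set m := Rintegral _ _ _ in feq *.
pose phi x := f (x / sigma) / sigma.
pose phi1 x := f1 (x / sigma) / sigma ^+ 2.
pose phi2 x := f2 (x / sigma) / sigma ^+ 3.
have ds (x : R) : is_derive x 1 (fun x => x / sigma) sigma^-1.
  by apply: is_derive_eq; rewrite /GRing.scale/=; ring.
have dphi (x : R) : is_derive x 1 phi (phi1 x).
  have hx := @is_derive1_comp R f (fun x => x / sigma) x _ _ (df (x / sigma)) (ds x).
  have := is_deriveZ (sigma^-1) hx.
  rewrite (_ : _ \*: _ = phi); last first.
    by apply/funext => y; rewrite /phi/= /GRing.scale/= mulrC.
  by congr is_derive; rewrite /phi1 /GRing.scale/=; field.
have dphi1 (x : R) : is_derive x 1 phi1 (phi2 x).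
  have hx := @is_derive1_comp R f1 (fun x => x / sigma) x _ _ (df1 (x / sigma)) (ds x).
  have := is_deriveZ ((sigma ^+ 2)^-1) hx.
  rewrite (_ : _ \*: _ = phi1); last first.
    by apply/funext => y; rewrite /phi1/= /GRing.scale/= mulrC.
  by congr is_derive; rewrite /phi2 /GRing.scale/=; field.
have cs : continuous (fun x : R => x / sigma) by exact: is_derive_continuous ds.
have cphi2 : continuous phi2.
  move=> x; apply: cvgM; last exact: cvg_cst.
  by apply: (@continuous_comp _ _ _ (fun x : R => x / sigma) f2); [exact: cs|exact: cf2].
have phi2b x : `|phi2 x| <= 2 / sigma ^+ 3.
  rewrite normrM (@ger0_norm _ (_^-1)) ?invr_ge0 ?exprn_ge0 ?(ltW sigma0)//.
  by rewrite ler_wpM2r ?invr_ge0 ?exprn_ge0 ?(ltW sigma0).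
pose L := 4 / sigma `^ (3 + delta).
have L0 : 0 <= L by rewrite divr_ge0// powR_ge0.
have phi2h x y : `|phi2 x - phi2 y| <= L * `|x - y| `^ delta.
  have i3 : 0 <= (sigma ^+ 3)^-1 by rewrite invr_ge0 exprn_ge0 ?(ltW sigma0).
  rewrite /phi2 -mulrBl normrM (ger0_norm i3).
  have := ler_wpM2r i3 (f2h delta (x / sigma) (y / sigma) delta01).
  move=> /le_trans; apply.
  rewrite -mulrBl normrM (gtr0_norm (_ : 0 < sigma^-1)) ?invr_gt0//.
  rewrite powRM ?invr_ge0 ?(ltW sigma0)//.
  have -> : sigma^-1 `^ delta = (sigma `^ delta)^-1.
    by rewrite -powR_inv1 ?(ltW sigma0)// -powRrM mulN1r powRN.
  rewrite /L powRD; last by rewrite s0 implybT.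
  rewrite (_ : sigma `^ 3 = sigma ^+ 3); last exact: powR_mulrn (ltW sigma0).
  have sd : sigma `^ delta != 0 by rewrite gt_eqF// powR_gt0.
  by rewrite le_eqVlt; apply/orP; left; apply/eqP; field; rewrite sd s0.
have EZ := Ex_Zab indepX delta01 c0 cE lF gF EF0 al be EF3.
have := stein_expansion indepX delta01 c0 cE lF gF EF0 ga dphi dphi1 cphi2 phi2b L0 phi2h EZ.
have lphi := Lr_phi c0 lF gF dphi dphi1 phi2b.
have lphi1 : Lr P c (phi1 \o F) := Lr_phi1 c0 lF gF dphi1 phi2b.
have c20 : 0 < c + c by exact: addr_gt0.
have c30 : 0 < c + c + c by exact: addr_gt0.
have iphiF : Intg (fun w => phi (F w) * F w).
  exact: (Lr_Intg c30 c3 (LrM c20 c0 lphi lF)).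
have iphi1 : Intg (phi1 \o F) by exact: (Lr_Intg c0 c1 lphi1).
have hE w : h (F w / sigma) = m + (sigma ^+ 2 * phi1 (F w) - phi (F w) * F w).
  have e := feq (F w / sigma).
  have -> : sigma ^+ 2 * phi1 (F w) - phi (F w) * F w =
     f1 (F w / sigma) - F w / sigma * f (F w / sigma).
    by rewrite /phi1 /phi; field.
  by rewrite e addrCA subrr addr0.
have iR : Intg (fun w => sigma ^+ 2 * phi1 (F w) - phi (F w) * F w).
  by apply: IntgB => //; exact: IntgZ iphi1.
have ihF : Intg (fun w => h (F w / sigma)).
  by apply: eq_Intg (IntgD (Intg_cst P m) iR) => w; rewrite hE.
have EhF : Ex (fun w => h (F w / sigma)) =
    m + (sigma ^+ 2 * Ex (phi1 \o F) - Ex (fun w => phi (F w) * F w)).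
  rewrite (eq_Ex _ hE) (ExD (Intg_cst P m) iR) Ex_cst; congr (_ + _).
  by rewrite (ExB (IntgZ _ iphi1) iphiF) (ExZ _ iphi1).
rewrite EF2 => bound; split => //.
rewrite EhF (_ : m + _ - m = - (Ex (fun w => phi (F w) * F w) - sigma ^+ 2 * Ex (phi1 \o F))).
  rewrite normrN; apply: le_trans bound _.
  have -> : L * 2 `^ delta = 2 `^ (2 + delta) / sigma `^ (3 + delta).
    rewrite powRD ?pnatr_eq0 ?implybT//.
    rewrite (_ : 2 `^ 2 = 2 ^+ 2); last exact: powR_mulrn.
    by rewrite /L; ring.
  exact: lexx.
by rewrite addrAC subrr add0r opprB.
Qed.

Lemma Intg_err0 k : Intg (fun w => absD_plus_E X delta k F w *
  `|Dalpha X ga k (Zalphabeta X al be F) w|).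
Proof.
have c30 : 0 < c + c + c by rewrite !addr_gt0.
case/andP : (delta01) => d0 _.
apply: (Intg_absD X delta01 c0 cE lF k d0 c30); first by have := cE; lra.
exact: (Lr_DZab X delta01 c0 cE lF).
Qed.

Lemma Intg_err1 k : Intg (fun w => absD_plus_E X (1 + delta) k F w *
  `|Dalpha X be k (Zalpha X al F) w|).
Proof.
have c20 : 0 < c + c by rewrite addr_gt0.
case/andP : (delta01) => d0 _.
have p0 : 0 < 1 + delta by rewrite addr_gt0.
apply: (Intg_absD X delta01 c0 cE lF k p0 c20); first by have := cE; lra.
exact: (Lr_DZa X delta01 c0 cE lF).
Qed.

Lemma Intg_err2 k : Intg (fun w => absD_plus_E X (2 + delta) k F w *
  `|Dalpha X al k F w|).
Proof.
case/andP : (delta01) => d0 _.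
have p0 : 0 < 2 + delta by rewrite addr_gt0.
apply: (Intg_absD X delta01 c0 cE lF k p0 c0); first by have := cE; lra.
exact: (Lr_DaF X delta01 c0 cE lF).
Qed.

End smooth_test.

Section normal_transfer.
Context {R : realType} {d : measure_display} {Om : measurableType d}.
Variables (P : probability Om R) (N : {RV P >-> R}).
Hypothesis N_normal : forall B : set R, measurable B ->
  distribution P N B = normal_prob 0 1 B.

(** The variable N is retyped to take its values in the copy of the line on which the
    Lebesgue measure is defined, since the two types carry the same measurable sets
    under different names. *)
Lemma expectation_normal (h : R -> R) : measurable_fun setT h ->
  (normal_prob (0 : R) 1).-integrable setT (EFin \o h) ->
  'E_P[h \o N]%E = (Rintegral (normal_prob 0 1) setT h)%:E.
Proof.
move=> mh ih.
have mN0 : measurable_fun setT N by exact: measurable_funPT.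
have mN : measurable_fun setT (N : Om -> measurableTypeR R).
  by move=> _ B mB; exact: (mN0 measurableT B mB).
pose N' : {mfun Om >-> measurableTypeR R} :=
  MeasurableFun.Pack (MeasurableFun.Class (isMeasurableFun.Build _ _ _ _ _ mN)).
have dE (g : R -> \bar R) : (\int[distribution P N']_x g x =
    \int[normal_prob (0 : R) 1]_x g x)%E.
  by apply: eq_measure_integral => A mA _; exact: (N_normal mA).
have mE : measurable_fun [set: measurableTypeR R] (EFin \o h).
  exact/measurable_EFinP.
have iN : P.-integrable setT ((EFin \o h) \o N').
  apply/integrableP; split; first exact: measurableT_comp.
  have -> : (\int[P]_x `|((EFin \o h) \o N') x| =
      \int[distribution P N']_x `|(EFin \o h) x|)%E.
    by rewrite ge0_integral_distribution//; exact: measurableT_comp.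
  by rewrite dE; case/integrableP : ih.
rewrite unlock /Rintegral fineK; last exact: integrable_fin_num.
by rewrite -dE (integral_distribution mE iN).
Qed.

End normal_transfer.

Lemma double_lincomb (R : realType) (v t2 t3 e0 e1 e2 a0 a1 a2 : R) :
  0 <= v -> 0 <= t2 -> t3 = t2 * 2 ->
  e0 <= 2 * a0 -> e1 <= 2 * a1 -> e2 <= 2 * a2 ->
  ((4 * v * e0 + t2 * v * e1 + t2 * v * e2)%:E <=
   (8 * v * a0 + t3 * v * a1 + t3 * v * a2)%:E)%E.
Proof.
move=> v0 t0 -> b0 b1 b2; rewrite lee_fin.
have h0 : 0 <= 4 * v by rewrite mulr_ge0.
have h1 : 0 <= t2 * v by rewrite mulr_ge0.
apply: le_trans (lerD (lerD (ler_wpM2l h0 b0) (ler_wpM2l h1 b1)) (ler_wpM2l h1 b2)) _.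
by rewrite le_eqVlt; apply/orP; left; apply/eqP; ring.
Qed.

Theorem theorem2p2 (R : realType)
  (d : measure_display) (Omega : measurableType d) (P : probability Omega R)
  (dT : measure_display) (T : measurableType dT)
  (n : nat) (X : 'I_n -> {RV P >-> T}) (indepX : mutually_independent X)
  (delta : R) (delta_gt0 : 0 < delta) (delta_le1 : delta <= 1)
  (f : n.-tuple T -> R) (mf : measurable_fun setT f)
  (F : Omega -> R) (FE : F = fun w => f [tuple X i w | i < n])
  (FL : F \in Lfun P (3 + delta)%:E)
  (EF : ('E_P[F] = 0)%E)
  (sigma : R) (sigma_gt0 : 0 < sigma) (VF : ('V_P[F] = (sigma ^+ 2)%:E)%E)
  (EF3 : ('E_P[fun w => (F w ^+ 3)%R] = 0)%E)
  (alpha beta gamma : R)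
  (alpha01 : 0 <= alpha <= 1) (beta01 : 0 <= beta <= 1)
  (gamma01 : 0 <= gamma <= 1)
  (d' : measure_display) (Omega' : measurableType d')
  (P' : probability Omega' R) (N : {RV P' >-> R})
  (N_normal : forall B : set R, measurable B ->
     distribution P' N B = normal_prob 0 1 B) :
  let Za := Zalpha X alpha F in
  let Zab := Zalphabeta X alpha beta F in
  let bound1 : \bar R :=
    ((4 / sigma `^ (3 + delta))%:E *
       (\sum_(k < n) 'E_P[fun w =>
          (absD_plus_E X delta k F w * `|Dalpha X gamma k Zab w|)%R])
     + (2 `^ (2 + delta) / sigma `^ (3 + delta))%:E *
       (\sum_(k < n) 'E_P[fun w =>
          (absD_plus_E X (1 + delta) k F w * `|Dalpha X beta k Za w|)%R])
     + (2 `^ (2 + delta) / sigma `^ (3 + delta))%:E *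
       (\sum_(k < n) 'E_P[fun w =>
          (absD_plus_E X (2 + delta) k F w * `|Dalpha X alpha k F w|)%R]))%E in
  let sumDF : \bar R :=
    (\sum_(k < n) 'E_P[fun w => (`|Ddiff X k F w| `^ (3 + delta))%R])%E in
  let sumDZa : \bar R :=
    (\sum_(k < n) 'E_P[fun w =>
       (`|Ddiff X k Za w| `^ ((3 + delta) / 2))%R])%E in
  let sumDZab : \bar R :=
    (\sum_(k < n) 'E_P[fun w =>
       (`|Ddiff X k Zab w| `^ ((3 + delta) / 3))%R])%E in
  let bound2 : \bar R :=
    ((8 / sigma `^ (3 + delta))%:E *
       (sumDF `^ (delta / (3 + delta)) * sumDZab `^ (3 / (3 + delta)))
     + (2 `^ (3 + delta) / sigma `^ (3 + delta))%:E *
       (sumDF `^ ((1 + delta) / (3 + delta)) * sumDZa `^ (2 / (3 + delta)))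
     + (2 `^ (3 + delta) / sigma `^ (3 + delta))%:E * sumDF)%E in
  (d2 P (fun w => (F w / sigma)%R) P' N <= bound1)%E /\ (bound1 <= bound2)%E.
Proof.
pose c := (3 + delta)^-1.
have delta01 : 0 < delta <= 1 by rewrite delta_gt0.
have q0 : 0 < 3 + delta by rewrite addr_gt0.
have qn : 3 + delta != 0 by rewrite gt_eqF.
have c0 : 0 < c by rewrite invr_gt0.
have cE : (3 + delta) * c = 1 by rewrite /c divff.
have cV : c^-1 = 3 + delta by rewrite /c invrK.
have c1 : c <= 1 by nra.
have p1 : 0 < 1 + delta by rewrite addr_gt0.
have p2 : 0 < 2 + delta by rewrite addr_gt0.
have pt0 : delta * c + (c + c + c) = 1 by lra.
have pt1 : (1 + delta) * c + (c + c) = 1 by lra.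
have pt2 : (2 + delta) * c + c = 1 by lra.
have gF : gmeas (sigma_of X predT) F by rewrite FE; exact: gmeas_function_of.
have mF : measurable_fun setT F.
  apply: gmeas_meas gF; first exact: sigma_of_sigma.
  exact: sigma_of_measurable.
have lF : Lr P c F.
  split => //; rewrite cV; apply: Lfun_integrable => //.
  by lra.
have c20 : 0 < c + c by rewrite addr_gt0.
have c30 : 0 < c + c + c by rewrite addr_gt0.
have c3 : c + c + c <= 1 by nra.
have c2 : c + c <= 1 by lra.
have iF := Lr_Intg c0 c1 lF.
have EF0 : Rintegral P setT F = 0.
  by move: EF; rewrite (expectation_Ex iF) => -[].
have EFF : Rintegral P setT (fun w => F w * F w) = sigma ^+ 2.
  have iFF := Lr_Intg c20 c2 (LrM c0 c0 lF lF).
  move: VF; rewrite /variance covariance.unlock EF/=.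
  rewrite (_ : ((F \- cst 0) * (F \- cst 0)) = (fun w => F w * F w)); last first.
    by apply/funext => w; rewrite /= -[LHS]/((F w - 0) * (F w - 0)) subr0.
  by rewrite (expectation_Ex iFF) => -[].
have EFFF : Rintegral P setT (fun w => F w ^+ 3) = 0.
  have iF3 : P.-integrable setT (EFin \o (fun w => F w ^+ 3)).
    have := Lr_Intg c30 c3 (LrM c20 c0 (LrM c0 c0 lF lF) lF).
    by apply: eq_Intg => w; rewrite -expr2 -exprSr.
  by move: EF3; rewrite (expectation_Ex iF3) => -[].
move=> Za Zab bound1 sumDF sumDZa sumDZab bound2.
have lZa : Lr P (c + c) Za by exact: (Lr_Za X delta01 c0 cE lF).
have lZab : Lr P (c + c + c) Zab by exact: (Lr_Zab X delta01 c0 cE lF).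
pose e0 := err0 X delta F alpha beta gamma.
pose e1 := err1 X delta F alpha beta.
pose e2 := err2 X delta F alpha.
have lincomb3 (r1 r2 r3 x y z : R) :
    (r1%:E * x%:E + r2%:E * y%:E + r3%:E * z%:E)%E = (r1 * x + r2 * y + r3 * z)%:E.
  by [].
have bound1E : bound1 = (4 / sigma `^ (3 + delta) * e0
  + 2 `^ (2 + delta) / sigma `^ (3 + delta) * e1
  + 2 `^ (2 + delta) / sigma `^ (3 + delta) * e2)%:E.
  transitivity ((4 / sigma `^ (3 + delta))%:E * e0%:E
    + (2 `^ (2 + delta) / sigma `^ (3 + delta))%:E * e1%:E
    + (2 `^ (2 + delta) / sigma `^ (3 + delta))%:E * e2%:E)%E; last first.
    exact: lincomb3.
  rewrite /bound1; congr (_ * _ + _ * _ + _ * _)%E.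
  - rewrite /e0 /err0 -sumEFin; apply: eq_bigr => k _; apply: expectation_Ex.
    exact: (Intg_err0 X delta01 c0 cE lF).
  - rewrite /e1 /err1 -sumEFin; apply: eq_bigr => k _; apply: expectation_Ex.
    exact: (Intg_err1 X delta01 c0 cE lF).
  - rewrite /e2 /err2 -sumEFin; apply: eq_bigr => k _; apply: expectation_Ex.
    exact: (Intg_err2 X delta01 c0 cE lF).
split.
  rewrite /d2; apply: ge_ereal_sup => _ [h [C2h h1 h2] <-].
  have h1' := supnorm_le1 h1; have h2' := supnorm_le1 h2.
  have [iN _] := stein_regularity C2h h1' h2'.
  have [ihF le] := smooth_test_bound indepX delta01 c0 cE lF gF EF0 EFFF sigma_gt0 EFF alpha beta gamma C2h h1' h2'.
  have mh : measurable_fun setT h.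
    apply: continuous_measurable_fun => x; apply/differentiable_continuous/derivable1_diffP.
    by case: C2h.
  rewrite (expectation_normal N_normal mh iN) (expectation_Ex ihF).
  by rewrite bound1E -EFinB /= lee_fin.
pose A := \sum_(k < n) Rintegral P setT (fun w => `|Ddiff X k F w| `^ (3 + delta)).
pose B := \sum_(k < n) Rintegral P setT (fun w => `|Ddiff X k Za w| `^ ((3 + delta) / 2)).
pose C := \sum_(k < n) Rintegral P setT (fun w => `|Ddiff X k Zab w| `^ ((3 + delta) / 3)).
have t2 : 2 / (3 + delta) = c + c by rewrite /c; field.
have t3 : 3 / (3 + delta) = c + c + c by rewrite /c; field.
have t2V : (c + c)^-1 = (3 + delta) / 2 by rewrite -t2 invf_div.
have t3V : (c + c + c)^-1 = (3 + delta) / 3 by rewrite -t3 invf_div.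
have AE : sumDF = A%:E.
  rewrite /sumDF /A -sumEFin; apply: eq_bigr => k _; apply: expectation_Ex.
  by rewrite -cV; case: (Lr_Ddiff X k c0 c1 lF).
have BE : sumDZa = B%:E.
  rewrite /sumDZa /B -sumEFin; apply: eq_bigr => k _; apply: expectation_Ex.
  by rewrite -t2V; case: (Lr_Ddiff X k c20 c2 lZa).
have CE : sumDZab = C%:E.
  rewrite /sumDZab /C -sumEFin; apply: eq_bigr => k _; apply: expectation_Ex.
  by rewrite -t3V; case: (Lr_Ddiff X k c30 c3 lZab).
have A0 : 0 <= A.
  by apply: sumr_ge0 => k _; apply: Rintegral_ge0 => w _; exact: powR_ge0.
have b0 : e0 <= 2 * (A `^ (delta / (3 + delta)) * C `^ (3 / (3 + delta))).
  have := sum_absD_Dalpha_le X gamma01 c0 delta_gt0 c30 c1 pt0 lF lZab.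
  by rewrite cV t3V -t3.
have b1 : e1 <= 2 * (A `^ ((1 + delta) / (3 + delta)) * B `^ (2 / (3 + delta))).
  have := sum_absD_Dalpha_le X beta01 c0 p1 c20 c1 pt1 lF lZa.
  by rewrite cV t2V -t2.
have b2 : e2 <= 2 * A.
  have := sum_absD_Dalpha_le X alpha01 c0 p2 c0 c1 pt2 lF lF.
  rewrite cV -powRD; last by rewrite pt2 oner_eq0.
  by rewrite pt2 powRr1.
have sg0 : 0 <= (sigma `^ (3 + delta))^-1 by rewrite invr_ge0 powR_ge0.
have two : 2 `^ (3 + delta) = 2 `^ (2 + delta) * 2 :> R.
  have -> : 3 + delta = (2 + delta) + 1 by ring.
  by rewrite powRD ?pnatr_eq0 ?implybT// powRr1.
(* only the inequalities between these numbers matter from here on *)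
clearbody bound1 sumDF sumDZa sumDZab e0 e1 e2 A B C.
rewrite bound1E.
have -> : bound2 = (8 / sigma `^ (3 + delta) *
      (A `^ (delta / (3 + delta)) * C `^ (3 / (3 + delta)))
    + 2 `^ (3 + delta) / sigma `^ (3 + delta) *
      (A `^ ((1 + delta) / (3 + delta)) * B `^ (2 / (3 + delta)))
    + 2 `^ (3 + delta) / sigma `^ (3 + delta) * A)%:E.
  rewrite /bound2 AE BE CE !poweR_EFin; exact: lincomb3.
have h1 : 0 <= 2 `^ (2 + delta) :> R by exact: powR_ge0.
exact: (double_lincomb sg0 h1 two b0 b1 b2).
Qed.
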